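(* Put $\eta=\frac{\sqrt3+1}{\sqrt3-1}$ and let $a,b,c,d\in\mathbb{R}$ and $\mu$ satisfy: $a\in[\eta^{-1},\eta]\setminus\{1\}$; $0<\mu\le\mu^\ast:=\ln\left(\frac{|1+a|}{\sqrt3\,|1-a|}\right)$; $\left|\tfrac{bd}{c}\right|\le1$; $c\ge\tfrac{\pi^2}{8}$; $1+2(\sinh\mu+2\cosh\mu)b^2\le c$; and $|d|\le2\sqrt{\mu e^{-\mu}}$. Let $F(\mu)=2\sinh(\mu)+10\cosh(\mu)$ and suppose that $\frac{|bd|}{c}\le\sqrt{\mu e^{-\mu}(F(\mu))^{-1}}$. (i) If $\frac{\pi^2}{4}+F(\mu)b^2\le c$, then there exist $\varepsilon_1^\ast,C_1>0$ such that for every $\varepsilon\in(0,\varepsilon_1^\ast)$ and all $(u_0,u_1,p_0)\in H^1(0,1)\times L^2(0,1)\times L^2(0,1)$ with $u_0(0)=0$, the solution of the coupled wave-heat system described in the context satisfies $$\|(u(t),u_t(t),p(t))\|_{H^1(0,1)\times L^2(0,1)\times L^2(0,1)}\le C_1e^{-\frac{\mu}{4}t}\|(u_0,u_1,p_0)\|_{H^1(0,1)\times L^2(0,1)\times L^2(0,1)},\qquad \forall t\ge0.$$ (ii) If $3F(\mu)b^2\le c$, then there exist $\varepsilon_2^\ast,C_2>0$ such that for every $\varepsilon\in(0,\varepsilon_2^\ast)$ and all $(u_0,u_1,p_0)\in H^1(0,1)\times L^2(0,1)\times H^1(0,1)$ with $u_0(0)=0$, the solution of the same system satisfies $$\|(u(t),u_t(t),p(t))\|_{H^1(0,1)\times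 L^2(0,1)\times H^1(0,1)}\le C_2e^{-\frac{\mu}{4}t}\|(u_0,u_1,p_0)\|_{H^1(0,1)\times L^2(0,1)\times H^1(0,1)},\qquad \forall t\ge0.$$
   Context: The coupled system, with parameter $\varepsilon>0$, is $$\begin{cases} u_{tt}=u_{xx}, & (x,t)\in(0,1)\times(0,\infty),\\ u(0,t)=0,\quad u_x(1,t)=-a\,u_t(1,t)+b\,p(0,t), & t>0,\\ u(x,0)=u_0(x),\ u_t(x,0)=u_1(x), & x\in(0,1),\\ \varepsilon p_t=p_{xx}, & (x,t)\in(0,1)\times(0,\infty),\\ p_x(0,t)=c\,p(0,t),\quad p_x(1,t)=d\,u(1,t), & t>0,\\ p(x,0)=p_0(x), & x\in(0,1).\end{cases}$$ All functions are real valued. Let $H^1_L(0,1)=\{u\in H^1(0,1): u(0)=0\}$ and $\mathcal H=H^1_L(0,1)\times L^2(0,1)\times L^2(0,1)$. The system is written as $\dot Y=A_\varepsilon Y$, $Y(0)=(u_0,u_1,p_0)$, with $Y=(u,u_t,p)$, $A_\varepsilon(u,v,p)=(v,u_{xx},\varepsilon^{-1}p_{xx})$ and $$D(A_\varepsilon)=\{(u,v,p)\in (H^2(0,1)\cap H^1_L(0,1))\times H^1_L(0,1)\times H^2(0,1):\ u_x(1)=-av(1)+bp(0),\ p_x(0)=cp(0),\ p_x(1)=du(1)\}.$$ ''The solution'' is the unique mild solution, i.e. the function $Y\in C([0,\infty);\mathcal H)$ with $\int_0^tY(s)\,ds\in D(A_\varepsilon)$ and $Y(t)=Y(0)+A_\varepsilon\int_0^tY(s)\,ds$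 for all $t\ge0$ (the orbit of the $C_0$-semigroup generated by $A_\varepsilon$). *)

(* Defs.v *)
From HB Require Import structures.
From mathcomp Require Import all_boot all_order all_algebra.
From mathcomp Require Import all_classical all_reals all_analysis.

Set Implicit Arguments.
Unset Strict Implicit.
Unset Printing Implicit Defensive.

Import Order.TTheory GRing.Theory Num.Theory.
Import numFieldNormedType.Exports.

Local Open Scope classical_set_scope.
Local Open Scope ring_scope.

(* Elements of L^2(0,1) and of the Sobolev spaces are represented by Borel
   functions R -> R, two of them equal a.e. on ]0,1[ being the same element.
   All the notions below are invariant under this identification. *)

Section Hyperbolic.
Context {R : realType}.
Implicit Types x : R.

Definition sinh x : R := (expR x - expR (- x)) / 2.
Definition cosh x : R := (expR x + expR (- x)) / 2.

End Hyperbolic.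

Section Sobolev.
Context {R : realType}.
Implicit Types (u g w phi : R -> R^o) (x : R).

Definition leb01 : {measure set (measurableTypeR R) -> \bar R} :=
  mrestr (@lebesgue_measure R) (measurable_itv `]0, 1[).

Definition L2 u : Prop := (u : measurableTypeR R -> R) \in Lfun leb01 2%:E.

Definition L2norm u : R := fine ('N[leb01]_2%:E [EFin \o u])%E.

(* C^1_c(0,1); as usual, testing against C^1_c or against C^infty_c gives the
   same weak derivatives. A closed set contained in ]0,1[ is compact. *)
Definition test_fun phi : Prop :=
  [/\ forall x, derivable phi x 1,
      continuous (derive1 phi) &
      closure [set x | phi x != 0] `<=` `]0, 1[].

Definition weak_deriv u g : Prop :=
  L2 g /\
  forall phi, test_fun phi ->
    (\int[leb01]_x (u x * derive1 phi x) = - \int[leb01]_x (g x * phi x))%R.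

Definition H1 u : Prop := L2 u /\ exists g, weak_deriv u g.

(* Any two weak derivatives agree a.e.; when there is none, wD u = 0. *)
Definition wD u : R -> R^o := xget (0 : R -> R^o) [set g | weak_deriv u g].

Definition H2 u : Prop := H1 u /\ H1 (wD u).

Definition H1norm u : R := Num.sqrt (L2norm u ^+ 2 + L2norm (wD u) ^+ 2).

(* The value at x in [0,1] of u in H^1(0,1), i.e. the value at x of the
   representative of u that is continuous on [0,1]. *)
Definition trace u x : R :=
  xget (0 : R -> R^o)
    [set w | {within `[0, 1], continuous (w : R -> R)} /\
             u = w %[ae leb01]] x.

Definition H1L u : Prop := H1 u /\ trace u 0 = 0.

End Sobolev.

Section VectorIntegral.
Context {R : realType} {V : lmodType R}.

(* I is the Riemann integral over [0, t] of f, a function with values in V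
   equipped with the (semi)norm N: the tagged Riemann sums converge to I as the
   mesh tends to 0. The nodes are s 0 <= ... <= s n, and the tags are the xi k. *)
Definition is_Riemann_integral (N : V -> R) (f : R -> V) (t : R) (I : V) : Prop :=
  forall e : R, 0 < e -> exists2 delta : R, 0 < delta &
    forall (n : nat) (s xi : nat -> R),
      s 0%N = 0 -> s n = t ->
      (forall k, (k < n)%N ->
        s k <= xi k <= s k.+1 /\ s k.+1 - s k < delta) ->
      N (\sum_(k < n) (s k.+1 - s k) *: f (xi k) - I) < e.

End VectorIntegral.

Section WaveHeat.
Context {R : realType}.

(* Triples (u, v, p). *)
Definition state : Type := ((R -> R^o) * (R -> R^o) * (R -> R^o))%type.

Implicit Types (X : state) (Y : R -> state).

Definition cu X : R -> R^o := X.1.1.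
Definition cv X : R -> R^o := X.1.2.
Definition cp X : R -> R^o := X.2.

Definition inH X : Prop := [/\ H1L (cu X), L2 (cv X) & L2 (cp X)].

Definition eqH X X' : Prop :=
  [/\ cu X = cu X' %[ae leb01], cv X = cv X' %[ae leb01] &
      cp X = cp X' %[ae leb01]].

Definition norm_H1L2L2 X : R :=
  Num.sqrt (H1norm (cu X) ^+ 2 + L2norm (cv X) ^+ 2 + L2norm (cp X) ^+ 2).

Definition norm_H1L2H1 X : R :=
  Num.sqrt (H1norm (cu X) ^+ 2 + L2norm (cv X) ^+ 2 + H1norm (cp X) ^+ 2).

Definition domA (a b c d : R) X : Prop :=
  let u := cu X in let v := cv X in let p := cp X in
  [/\ H2 u /\ H1L u, H1L v & H2 p] /\
  [/\ trace (wD u) 1 = - a * trace v 1 + b * trace p 0,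
      trace (wD p) 0 = c * trace p 0 &
      trace (wD p) 1 = d * trace u 1].

Definition opA (eps : R) X : state :=
  (cv X, wD (wD (cu X)), eps^-1 *: wD (wD (cp X))).

(* Y is continuous from [0, +oo[ to H, and the data of the equation
   Y(t) = Y(0) + A \int_0^t Y(s) ds are compared in H. *)
Definition mild_solution (a b c d eps : R) X0 Y : Prop :=
  [/\ forall t : R, 0 <= t -> inH (Y t),
      forall t : R, 0 <= t ->
        (norm_H1L2L2 (Y s - Y t) : R)
          @[s --> within [set s : R | 0 <= s] (nbhs t)]
          --> (0 : R),
      eqH (Y 0) X0 &
      forall t : R, 0 <= t -> exists I : state,
        [/\ is_Riemann_integral norm_H1L2L2 Y t I,
            domA a b c d I &
            eqH (Y t) (Y 0 + opA eps I)]].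

End WaveHeat.

Arguments state R : clear implicits.

(* Main.v *)
Require Import Defs.
From mathcomp Require Import all_boot all_order all_algebra.
From mathcomp Require Import all_classical all_reals all_analysis.
From mathcomp Require Import measurable_realfun ring lra.

(** The decay rate comes from a Lyapunov functional adapted to the separation of time
    scales.  The Riemann invariants [u_t + u_x] and [u_t - u_x] are transported in opposite
    directions; weighting their energies by [e^{mu x}] and [e^{-mu x}] gives a functional
    [Vwave] whose derivative is [- mu Vwave] plus the flux at [x = 1].  The upper bound on [mu]
    guarantees that the damping [a] makes this flux at most
    [- delta u_t(1)^2 + (F/2) (b p(0))^2] with [delta > 0] ([flux_bound]).

    For small [eps] the heat component is close to the stationary profile
    [(d/c) u(1) (1 + c x)].  The difference [q] ([qst]) satisfies homogeneous boundary conditions,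
    and [p(0) = q(0) + (d/c) u(1)].  The bound on [bd/c] lets half of [- mu Vwave] absorb
    the term with [u(1)] ([wave_dissipation]).  The dissipation of the heat equation has a factor
    [1/eps], so that for small [eps] it dominates [q(0)^2] and, with the help of
    [delta u_t(1)^2], the motion of the stationary profile.  Hence [Vwave + |q|^2] decays at rate
    [mu/2] ([energy_L2]), and so does [Vwave + |q_x|^2 + c q(0)^2] ([energy_H1]); these
    two functionals control the squared norms of (i) and of (ii), whence the rate [mu/4].

    These computations make sense on the domain of the generator, while a mild solution is only
    a continuous curve in the energy space.  Its averages over windows of length [h] are strong
    solutions: they take values in the domain, and are differentiable in time since the
    increments of the Riemann integral of a continuous curve are controlled by the values
    of the curve ([Riemann_increment], [avg_domA], [avg_der], [avg_eq]).  For (i) the decay of the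
    averages passes to the limit [h -> 0] by continuity ([energy_decay]).

    For (ii) the functional is not continuous on the energy space.  Along the averages it
    is still differentiable, because the heat operator is symmetric and [eps p_xx] is an
    increment of the solution ([der_form], [energy_decay_H1]).  At time 0 the averages are bounded
    in H^1 along a sequence of windows tending to 0 ([heat_start]), and the resulting bound at
    time [t] passes to the limit by lower semicontinuity of the Dirichlet energy ([H1_lsc]).

    The underlying facts on H^1(0,1) -- continuous representatives, traces, integration by
    parts, uniqueness of weak derivatives -- all follow from the lemma of du Bois-Reymond
    and from integration by parts for primitives of L^2 functions ([du_bois_reymond],
    [ac_ibp]). *)

Set Implicit Arguments.
Unset Strict Implicit.
Unset Printing Implicit Defensive.

Import Order.TTheory GRing.Theory Num.Theory.
Import numFieldNormedType.Exports.
Local Open Scope classical_set_scope.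
Local Open Scope ring_scope.

(** * The inner product of L^2(0,1) *)

Section L2.
Context {R : realType}.
Implicit Types (f g h : R -> R^o) (a : R).
Notation mu := (@leb01 R).

Definition ip f g : R := \int[mu]_x (f x * g x).

Lemma ae_sub (P Q : R -> Prop) : (forall x, P x -> Q x) ->
  (\forall x \ae mu, P x) -> \forall x \ae mu, Q x.
Proof. by move=> PQ; apply: (@filterS _ _ (ae_filter_ringOfSetsType mu)). Qed.

Lemma ae_and (P Q : R -> Prop) : (\forall x \ae mu, P x) ->
  (\forall x \ae mu, Q x) -> \forall x \ae mu, P x /\ Q x.
Proof. exact: (@filterI _ _ (ae_filter_ringOfSetsType mu)). Qed.

Lemma L2_mfun f : L2 f -> measurable_fun setT (f : R -> R).
Proof. by rewrite /L2 => /sub_Lfun_mfun; rewrite inE. Qed.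

Lemma L2_lin a f g : L2 f -> L2 g -> L2 (a *: f + g).
Proof.
move=> Lf Lg; have [_] := @Lfun_submod_closed _ _ _ mu 2%:E (lee1n 2).
by move=> /(_ a f g Lf Lg).
Qed.

Lemma L2_0 : L2 (0 : R -> R^o).
Proof. by have [] := @Lfun_submod_closed _ _ _ mu 2%:E (lee1n 2). Qed.

Lemma L2Z a f : L2 f -> L2 (a *: f).
Proof. by move=> Lf; rewrite -[a *: f]addr0; exact: L2_lin Lf L2_0. Qed.

Lemma L2D f g : L2 f -> L2 g -> L2 (f + g).
Proof. by move=> Lf Lg; rewrite -[f]scale1r; exact: L2_lin. Qed.

Lemma L2B f g : L2 f -> L2 g -> L2 (f - g).
Proof. by move=> Lf Lg; rewrite addrC -scaleN1r; exact: L2_lin. Qed.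

Lemma L2_integrable f g : L2 f -> L2 g ->
  mu.-integrable setT (EFin \o (fun x => f x * g x)).
Proof. by move=> Lf Lg; apply/Lfun1_integrable; exact: Lfun2_mul_Lfun1. Qed.

Lemma ipC f g : ip f g = ip g f.
Proof. by congr Rintegral; apply/funext => x; rewrite mulrC. Qed.

Lemma ipDl f g h : L2 f -> L2 g -> L2 h -> ip (f + g) h = ip f h + ip g h.
Proof.
move=> Lf Lg Lh; rewrite /ip -RintegralD//; [|exact: L2_integrable..].
by congr Rintegral; apply/funext => x; rewrite mulrDl.
Qed.

Lemma ipZl a f h : L2 f -> L2 h -> ip (a *: f) h = a * ip f h.
Proof.
move=> Lf Lh; rewrite /ip -RintegralZl//; last exact: L2_integrable.
by congr Rintegral; apply/funext => x; rewrite mulrA.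
Qed.

Lemma ipDr f g h : L2 f -> L2 g -> L2 h -> ip h (f + g) = ip h f + ip h g.
Proof. by move=> *; rewrite ipC ipDl// ![ip _ h]ipC. Qed.

Lemma ipZr a f h : L2 f -> L2 h -> ip h (a *: f) = a * ip h f.
Proof. by move=> *; rewrite ipC ipZl// ![ip _ h]ipC. Qed.

Lemma ipNr f h : L2 f -> L2 h -> ip h (- f) = - ip h f.
Proof. by move=> *; rewrite -scaleN1r ipZr// mulN1r. Qed.

Lemma ipBl f g h : L2 f -> L2 g -> L2 h -> ip (f - g) h = ip f h - ip g h.
Proof. by move=> *; rewrite -scaleN1r ipDl ?ipZl ?mulN1r//; exact: L2Z. Qed.

Lemma ipBr f g h : L2 f -> L2 g -> L2 h -> ip h (f - g) = ip h f - ip h g.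
Proof. by move=> *; rewrite ipC ipBl// ![ip _ h]ipC. Qed.

Lemma ip_ge0 f : 0 <= ip f f.
Proof. by apply: Rintegral_ge0 => x _; rewrite -expr2 sqr_ge0. Qed.

Lemma L2norm_ge0 f : 0 <= L2norm f.
Proof. by rewrite fine_ge0// Lnorm_ge0. Qed.

Lemma L2normE f : L2norm f = Num.sqrt (ip f f).
Proof.
rewrite /L2norm /ip /Rintegral unlock fine_poweR powR12_sqrt; last first.
  by rewrite fine_ge0// integral_ge0// => x _; exact: poweR_ge0.
congr (Num.sqrt (fine _)); apply: eq_integral => x _ /=.
by rewrite powR_mulrn// real_normK ?num_real.
Qed.

Lemma L2norm_sqr f : L2norm f ^+ 2 = ip f f.
Proof. by rewrite L2normE sqr_sqrtr// ip_ge0. Qed.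

Lemma ip_lin2 s t f g : L2 f -> L2 g -> ip (s *: f + t *: g) (s *: f + t *: g)
  = s ^+ 2 * ip f f + 2 * (s * t * ip f g) + t ^+ 2 * ip g g.
Proof.
move=> Lf Lg; rewrite ipDl ?ipDr ?ipZl ?ipZr//; do ?[exact: L2Z|apply: L2D].
by rewrite (ipC g f); ring.
Qed.

(** Expanding [|| |g|^2 f - <f,g> g ||^2 >= 0] gives the inequality times
    [|g|^2]; when [|g| = 0] the same expansion of [f + t g] with [t] free
    forces [<f,g> = 0]. *)
Lemma cauchy_schwarz f g : L2 f -> L2 g -> `|ip f g| <= L2norm f * L2norm g.
Proof.
move=> Lf Lg; rewrite -ler_sqr ?nnegrE ?mulr_ge0 ?L2norm_ge0//.
rewrite exprMn !L2norm_sqr real_normK ?num_real//.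
have key s t : 0 <= s ^+ 2 * ip f f + 2 * (s * t * ip f g) + t ^+ 2 * ip g g.
  by rewrite -ip_lin2// ip_ge0.
have [g0|g0] := eqVneq (ip g g) 0.
  have := ip_ge0 f; set A := ip f f; set B := ip f g => A0.
  have [->|B0] := eqVneq B 0; first by rewrite g0 mulr0 expr0n.
  have : 0 < B ^+ 2 by rewrite exprn_even_gt0.
  (* with t = - n B the expansion reads A - 2 n B^2 >= 0; take n = (A + 1) / B^2 *)
  have := key 1 (- B * ((A + 1) / B ^+ 2)); rewrite g0 mulr0 addr0 -/A -/B => k B2.
  have e : B ^+ 2 * ((A + 1) / B ^+ 2) = A + 1 by rewrite mulrC divfK ?gt_eqF.
  have : 0 <= A - 2 * (B ^+ 2 * ((A + 1) / B ^+ 2)).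
    by apply: (le_trans k); rewrite le_eqVlt; apply/orP; left; apply/eqP; ring.
  by rewrite e; lra.
have G0 : 0 < ip g g by rewrite lt_neqAle eq_sym g0 ip_ge0.
have := key (ip g g) (- ip f g).
have -> : ip g g ^+ 2 * ip f f + 2 * (ip g g * - ip f g * ip f g)
   + (- ip f g) ^+ 2 * ip g g = ip g g * (ip f f * ip g g - ip f g ^+ 2) by ring.
by rewrite pmulr_rge0// subr_ge0.
Qed.

Lemma L2norm_sqrD f g : L2 f -> L2 g ->
  L2norm (f + g) ^+ 2 = L2norm f ^+ 2 + 2 * ip f g + L2norm g ^+ 2.
Proof.
move=> Lf Lg; rewrite !L2norm_sqr ipDl ?ipDr//; try exact: L2D.
by rewrite (ipC g f); ring.
Qed.

Lemma L2normZ a f : L2 f -> L2norm (a *: f) = `|a| * L2norm f.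
Proof.
move=> Lf; rewrite !L2normE ipZl ?ipZr//; last exact: L2Z.
by rewrite mulrA -expr2 sqrtrM ?sqr_ge0// sqrtr_sqr.
Qed.

Lemma L2normD f g : L2 f -> L2 g -> L2norm (f + g) <= L2norm f + L2norm g.
Proof.
move=> Lf Lg; rewrite -ler_sqr ?nnegrE ?addr_ge0 ?L2norm_ge0//.
rewrite L2norm_sqrD//; have := cauchy_schwarz Lf Lg.
by move=> /(le_trans (ler_norm _)); lra.
Qed.

Lemma L2normN f : L2 f -> L2norm (- f) = L2norm f.
Proof. by move=> Lf; rewrite -scaleN1r L2normZ// normrN1 mul1r. Qed.

Lemma L2normB f g : L2 f -> L2 g -> L2norm (f - g) <= L2norm f + L2norm g.
Proof.
move=> Lf Lg; rewrite -(L2normN Lg); apply: L2normD => //.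
by rewrite -scaleN1r; exact: L2Z.
Qed.

Lemma L2norm_distC f g : L2 f -> L2 g -> L2norm (f - g) = L2norm (g - f).
Proof. by move=> Lf Lg; rewrite -opprB L2normN//; exact: L2B. Qed.

Lemma parallelogram f g : L2 f -> L2 g ->
  L2norm (f - g) ^+ 2 + L2norm (f + g) ^+ 2 = 2 * L2norm f ^+ 2 + 2 * L2norm g ^+ 2.
Proof.
move=> Lf Lg; rewrite -scaleN1r !L2norm_sqrD//; last exact: L2Z.
by rewrite L2normZ// normrN1 mul1r ipZr//; ring.
Qed.

Lemma L2norm0 : L2norm (0 : R -> R^o) = 0.
Proof.
by have := L2normZ 0 L2_0; rewrite scale0r normr0 mul0r.
Qed.

Lemma ae_ipl f f' g : L2 f -> L2 f' -> L2 g -> f = f' %[ae mu] ->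
  ip f g = ip f' g.
Proof.
move=> Lf Lf' Lg ff'; rewrite /ip /Rintegral; congr fine.
apply: ae_eq_integral => //.
- by have /integrableP[] := L2_integrable Lf Lg.
- by have /integrableP[] := L2_integrable Lf' Lg.
- by apply: ae_sub ff' => x /= h _; rewrite h.
Qed.

Lemma ae_ipr f f' g : L2 f -> L2 f' -> L2 g -> f = f' %[ae mu] ->
  ip g f = ip g f'.
Proof. by move=> *; rewrite ipC (@ae_ipl f f')// ipC. Qed.

Lemma ae_L2norm f f' : L2 f -> L2 f' -> f = f' %[ae mu] -> L2norm f = L2norm f'.
Proof.
by move=> *; rewrite !L2normE (@ae_ipl f f')// (@ae_ipr f f').
Qed.

Lemma L2norm0_ae f : L2 f -> L2norm f = 0 -> f = 0 %[ae mu].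
Proof.
move=> Lf n0; exact: (@fine_Lnormr_eq0 _ _ _ mu _ (lee1n 2) (Lfun_Sub (lee1n 2) Lf)).
Qed.

Lemma leb01_full : (mu setT = 1)%E.
Proof.
rewrite /leb01 /= /mrestr setTI lebesgue_measure_itv/= lte_fin ltr01.
by rewrite oppr0 adde0.
Qed.

Lemma ae01 : \forall x \ae mu, x \in `]0, 1[%R.
Proof.
exists (~` `]0, 1[%classic); split => //.
- exact: measurableC.
- by rewrite /leb01 /= /mrestr setICl measure0.
Qed.

Lemma L2_dom (m : R -> R^o) f :
  measurable_fun setT (m : R -> R) -> L2 f -> {ae mu, forall x, `|m x| <= `|f x|} ->
  L2 m.
Proof.
move=> mm Lf mf; rewrite /L2 inE/=; apply/andP; split; rewrite inE//=.
have mf' := L2_mfun Lf.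
rewrite /finite_norm unlock; apply: poweR_lty.
have := Lfun_integrable (ler1n _ 2) Lf => /integrableP[_]; apply: le_lt_trans.
apply: ae_ge0_le_integral => //.
- by move=> x _; exact: poweR_ge0.
- apply/measurable_EFinP; apply: (measurableT_comp (measurable_powR _)) => //.
  exact: measurableT_comp.
- apply: measurableT_comp => //; apply/measurable_EFinP.
  apply: (measurableT_comp (measurable_powR _)) => //.
  exact: measurableT_comp.
apply: ae_sub mf => x mfx _ /=.
rewrite lee_fin [leRHS]ger0_norm ?powR_ge0//.
by rewrite ge0_ler_powR ?nnegrE.
Qed.

Lemma L2_cst a : L2 (cst a : R -> R^o).
Proof.
rewrite /L2 inE/=; apply/andP; split; rewrite inE//=.
rewrite /finite_norm unlock poweR_lty//=.
rewrite [X in (X < _)%E](_ : _ = \int[mu]_(x in setT) cst (`|a| `^ 2)%:E x)%E//.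
by rewrite integral_cst// leb01_full mule1 ltry.
Qed.

Lemma L2norm_cst a : L2norm (cst a : R -> R^o) = `|a|.
Proof.
rewrite L2normE /ip; have -> : (fun x => (cst a : R -> R^o) x * (cst a : R -> R^o) x) = cst (a ^+ 2).
  by apply/funext => x; rewrite expr2.
by rewrite Rintegral_cst// [X in fine X]leb01_full mulr1 sqrtr_sqr.
Qed.

Lemma L2M (m f : R -> R^o) (M : R) :
  measurable_fun setT (m : R -> R) -> (forall x, 0 < x < 1 -> `|m x| <= M) ->
  L2 f -> L2 (fun x => m x * f x).
Proof.
move=> mm mM Lf; apply: (@L2_dom _ (M *: f)).
- by apply: measurable_funM => //; exact: L2_mfun.
- exact: L2Z.
apply: ae_sub ae01 => x /=; rewrite in_itv/= => /mM mx.
rewrite normrM (@normrM _ M) ler_wpM2r//.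
by rewrite (le_trans mx)// ler_norm.
Qed.

Lemma L2norm_le (m f : R -> R^o) : L2 m -> L2 f ->
  {ae mu, forall x, `|m x| <= `|f x|} -> L2norm m <= L2norm f.
Proof.
move=> Lm Lf mf; rewrite !L2normE ler_wsqrtr// /ip /Rintegral.
apply: fine_le.
- by apply: integrable_fin_num => //; exact: L2_integrable.
- by apply: integrable_fin_num => //; exact: L2_integrable.
apply: ae_ge0_le_integral => //.
- by move=> x _; rewrite lee_fin -expr2 sqr_ge0.
- by have /integrableP[] := L2_integrable Lm Lm.
- by move=> x _; rewrite lee_fin -expr2 sqr_ge0.
- by have /integrableP[] := L2_integrable Lf Lf.
apply: ae_sub mf => x mfx _ /=; rewrite lee_fin -!expr2.
by rewrite -(real_normK (num_real (m x))) -(real_normK (num_real (f x))) lerXn2r ?nnegrE.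
Qed.

End L2.

(** * Primitives of L^2 functions *)

Section Primitive.
Context {R : realType}.
Implicit Types (f g h u : R -> R^o) (x y z s t c : R).
Notation mu := (@leb01 R).
Notation leb := (@lebesgue_measure R).

Definition chi x : R -> R^o := \1_(`]-oo, x]%classic : set R).

Definition seg x y : R -> R^o := chi y - chi x.

Definition loc x y f : R -> R^o := fun z => seg x y z * f z.

(** For [x] in [0,1] this is the integral of [f] over [0,x]; writing it as an
    inner product with a step function makes it a bounded linear functional of
    [f] and a 1/2-Hoelder function of [x]. *)
Definition prim f x : R := ip (chi x) f.

Lemma chiE x z : chi x z = (z <= x)%R%:R.
Proof. by rewrite /chi indicE; congr (nat_of_bool _)%:R; apply/idP/idP; rewrite inE/= in_itv. Qed.

Lemma segE x y z : x <= y -> seg x y z = (x < z <= y)%R%:R.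
Proof.
move=> xy; rewrite /seg [LHS]/= !fctE !chiE; have [zx|xz] := leP z x.
  by rewrite (le_trans zx xy) subrr.
by rewrite subr0.
Qed.

Lemma L2_chi x : L2 (chi x).
Proof.
apply: (@L2_dom _ _ (cst 1)); [exact: measurable_indic|exact: L2_cst|].
by apply: aeW => z /=; rewrite chiE; case: (z <= x) => /=; rewrite ?normr0 ?normr1.
Qed.

Lemma L2_seg x y : L2 (seg x y). Proof. by apply: L2B; exact: L2_chi. Qed.

Lemma seg_le1 x y z : x <= y -> `|seg x y z| <= 1.
Proof. by move=> xy; rewrite segE//; case: (x < z <= y) => /=; rewrite ?normr0 ?normr1. Qed.

Lemma segK x y z : x <= y -> seg x y z * seg x y z = seg x y z.
Proof. by move=> xy; rewrite segE//; case: (x < z <= y) => /=; rewrite ?mulr0 ?mulr1. Qed.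

Lemma L2_loc x y f : x <= y -> L2 f -> L2 (loc x y f).
Proof.
move=> xy Lf; apply: (@L2M _ _ _ 1) => //; first by apply: L2_mfun; exact: L2_seg.
by move=> z _; exact: seg_le1.
Qed.

Lemma L2_chiM x f : L2 f -> L2 (fun z => chi x z * f z).
Proof.
move=> Lf; apply: (@L2M _ _ _ 1) => //; first by apply: L2_mfun; exact: L2_chi.
by move=> z _; rewrite chiE; case: (z <= x) => /=; rewrite ?normr0 ?normr1.
Qed.

Lemma L2norm_seg x y : x <= y -> L2norm (seg x y) <= Num.sqrt (y - x).
Proof.
move=> xy; rewrite L2normE ler_wsqrtr// /ip.
rewrite (_ : (fun _ => _) = \1_(`]x, y]%classic : set R)); last first.
  apply/funext => z; rewrite segK// segE// indicE; congr (nat_of_bool _)%:R.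
  by apply/idP/idP; rewrite inE/= in_itv.
rewrite /Rintegral integral_indic// setIT /leb01/= /mrestr.
have -> : y - x = fine (leb `]x, y]%classic).
  by rewrite lebesgue_measure_itv/= lte_fin; case: ltP xy => //= ? ?; lra.
have fi : (leb `]x, y]%classic < +oo)%E.
  by rewrite lebesgue_measure_itv/= lte_fin; case: ifP => _; rewrite -?EFinB ltry.
have le : (leb (`]x, y] `&` `]0%R, 1%R[) <= leb `]x, y]%classic)%E.
  by apply: le_measure; rewrite ?inE//; apply: measurableI.
apply: fine_le => //; rewrite ge0_fin_numE//.
exact: le_lt_trans fi.
Qed.

Lemma L2norm_chi x : L2norm (chi x) <= 1.
Proof.
rewrite -[leRHS]normr1 -L2norm_cst; apply: L2norm_le; [exact: L2_chi|exact: L2_cst|].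
by apply: aeW => z /=; rewrite chiE; case: (z <= x) => /=; rewrite ?normr0 ?normr1.
Qed.

Lemma prim_bound f x : L2 f -> `|prim f x| <= L2norm f.
Proof.
move=> Lf; apply: (le_trans (cauchy_schwarz (L2_chi x) Lf)).
by rewrite ler_piMl ?L2norm_ge0// L2norm_chi.
Qed.

Lemma primB f x y : L2 f -> prim f y - prim f x = ip (seg x y) f.
Proof. by move=> Lf; rewrite /prim -ipBl//; exact: L2_chi. Qed.

Lemma prim_lin a f g x : L2 f -> L2 g -> prim (a *: f + g) x = a * prim f x + prim g x.
Proof. by move=> Lf Lg; have ? := L2_chi x; rewrite /prim ipDr ?ipZr//; exact: L2Z. Qed.

Lemma prim_holder f x y : L2 f -> `|prim f y - prim f x| <= Num.sqrt `|y - x| * L2norm f.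
Proof.
move=> Lf; wlog xy : x y / x <= y => [hw|].
  have [|/ltW] := leP x y; first exact: hw.
  by move=> /hw; rewrite distrC (distrC x y).
rewrite primB//; apply: (le_trans (cauchy_schwarz (L2_seg x y) Lf)).
by rewrite ler_wpM2r ?L2norm_ge0// ger0_norm ?subr_ge0// L2norm_seg.
Qed.

Lemma prim_continuous f : L2 f -> continuous (prim f : R -> R).
Proof.
move=> Lf x; apply/cvgrPdist_le => e e0.
have N0 : 0 < L2norm f + 1 by rewrite ltr_wpDl// L2norm_ge0.
have D0 : 0 < (e / (L2norm f + 1)) ^+ 2 by rewrite exprn_gt0// divr_gt0.
near=> y; rewrite distrC.
apply: (le_trans (prim_holder _ _ Lf)).
apply: (@le_trans _ _ (e / (L2norm f + 1) * (L2norm f + 1))); last first.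
  by rewrite divfK// gt_eqF.
apply: ler_pM; rewrite ?sqrtr_ge0 ?L2norm_ge0 ?lerDl//.
rewrite (_ : e / (L2norm f + 1) = Num.sqrt ((e / (L2norm f + 1)) ^+ 2)); last first.
  by rewrite sqrtr_sqr ger0_norm// ltW// divr_gt0.
apply: ler_wsqrtr; rewrite distrC; near: y.
by apply/nbhs_ballP; exists ((e / (L2norm f + 1)) ^+ 2) => //= z /= /ltW.
Unshelve. all: by end_near. Qed.

(** The absolutely continuous function with value [c] at 0 and derivative [f]:
    the continuous representative of an element of H^1(0,1). *)
Definition ac c f : R -> R^o := fun x => c + prim f x.

Lemma ac_continuous c f : L2 f -> continuous (ac c f : R -> R).
Proof.
move=> Lf x; apply: (@cvgD _ R^o); first exact: cvg_cst.
exact: prim_continuous.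
Qed.

Lemma L2_ac c f : L2 f -> L2 (ac c f).
Proof.
move=> Lf; apply: L2D; first exact: (L2_cst c).
apply: (@L2_dom _ _ (cst (L2norm f))); last 1 first.
- by apply: aeW => x; rewrite [leRHS]ger0_norm ?L2norm_ge0// prim_bound.
- by apply: continuous_measurable_fun; exact: prim_continuous.
- exact: L2_cst.
Qed.

Let D : set R := `]0, 1[%classic.

Let mD : measurable (D : set (measurableTypeR R)).
Proof. exact: measurable_itv. Qed.

Lemma leb01_sub (h : R -> \bar R) :
  (\int[mu]_(x in D) h x = \int[leb]_(x in D) h x)%E.
Proof.
by apply: eq_measure_integral => A mA AD; rewrite /leb01/= /mrestr setIidl.
Qed.

Lemma leb01_integral (h : R -> R) : mu.-integrable setT (EFin \o h) ->
  \int[mu]_x h x = \int[leb]_(x in D) h x.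
Proof.
move=> ih; rewrite /Rintegral -leb01_sub.
rewrite (@negligible_integral _ _ _ mu setT (~` D))//.
- by rewrite setDE setCK setTI.
- exact: measurableC.
- by rewrite /leb01/= /mrestr setICl measure0.
Qed.

Lemma leb01_integrable (h : R -> R) : mu.-integrable setT (EFin \o h) ->
  leb.-integrable D (EFin \o h).
Proof.
move=> ih; have /integrableP[mh fh] := integrableS measurableT mD (@subsetT _ D) ih.
by apply/integrableP; split => //; rewrite -leb01_sub.
Qed.

(** An [f] whose integral over every interval [0,x] vanishes is null, because
    Lebesgue's theorem recovers [f] as the derivative of its primitive. *)
Lemma prim_eq0 f : L2 f -> (forall x, 0 < x < 1 -> prim f x = 0) -> f = 0 %[ae mu].
Proof.
move=> Lf pf.
have if1 : mu.-integrable setT (EFin \o f).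
  have := L2_integrable (L2_cst 1) Lf.
  by congr (mu.-integrable setT _); apply/funext => x /=; rewrite mul1r.
have intD := leb01_integrable if1.
pose F : R -> R := f \_ D.
have intF : leb.-integrable setT (EFin \o F).
  have /(integrable_mkcond _ mD) := intD.
  by congr (leb.-integrable setT _); rewrite /F restrict_EFin.
have /FTC1Ny : forall y, leb.-integrable `]-oo, y] (EFin \o F).
  by move=> y; apply: integrableS intF => //; exact: measurable_itv.
move=> /(_ (integrable_locally_restrict mD intD)).
have FE x : \int[leb]_(t in `]-oo, x]) F t = prim f x.
  rewrite /prim /ip leb01_integral; last by apply: L2_integrable => //; exact: L2_chi.
  rewrite Rintegral_mkcond [RHS]Rintegral_mkcond; congr Rintegral.
  apply/funext => t; rewrite /F !patchE chiE.
  have -> : (t \in `]-oo, x]%classic) = (t <= x) by rewrite mem_setE in_itv.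
  by case: (t \in D) => //; case: (t <= x); rewrite ?mul1r ?mul0r.
under eq_fun do rewrite FE; move=> [N [mN N0 sub]].
exists (N `|` ~` D); split.
- by apply: measurableU => //; exact: measurableC.
- apply/eqP; rewrite eq_le measure_ge0 andbT /leb01/= /mrestr setIUl setICl setU0.
  rewrite -N0; apply: le_measure; rewrite ?inE//.
  exact: measurableI.
move=> x /= fx; have [Dx|] := pselect (D x); last by right.
left; apply: sub => -[_]; move=> dF; apply: fx => _.
have Dx' : x \in D by rewrite inE.
move: dF; rewrite /F patchE Dx' => <-.
rewrite derive1E (@near_eq_derive _ _ _ _ (cst 0)) ?derive_cst//.
near=> y; apply: pf.
have : y \in `]0, 1[%R by near: y; apply: near_in_itvoo; rewrite inE in Dx'.
by rewrite in_itv.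
Unshelve. all: by end_near. Qed.

Lemma ip_seg_loc x y s t g : s <= x -> x <= y -> y <= t ->
  ip (seg x y) g = ip (seg x y) (loc s t g).
Proof.
move=> sx xy yt; congr Rintegral; apply/funext => z.
rewrite /loc !segE ?(le_trans sx) ?(le_trans xy)//.
have [/andP[xz zy]|_] := boolP (x < z <= y); last by rewrite !mul0r.
by rewrite (le_lt_trans sx xz) (le_trans zy yt) !mul1r.
Qed.

Lemma eq0_of_harmonic_bound (x K : R) : (forall n, `|x| <= K / n.+1%:R) -> x = 0.
Proof.
move=> h; apply/normr0_eq0/eqP; rewrite eq_le normr_ge0 andbT leNgt; apply/negP => x0.
have K0 : 0 <= K by have := h 0%N; rewrite divr1; apply: le_trans.
have := h (Num.bound (K / `|x|)); rewrite ler_pdivlMr//.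
have := archi_boundP (divr_ge0 K0 (ltW x0)); rewrite ltr_pdivrMr// => h1 h2.
have : `|x| * (Num.bound (K / `|x|)).+1%:R <= (Num.bound (K / `|x|))%:R * `|x|.
  exact: (le_trans h2 (ltW h1)).
by rewrite mulrC ler_pM2r// ler_nat ltnn.
Qed.

(** On a short interval both sides of
    [u(t)^2 - u(s)^2 = 2 \int_s^t u g] differ by at most [2 (t - s)] times the
    mass of [g^2] there; summing over a fine subdivision the errors vanish. *)
Lemma ac_sqr_ip c g : L2 g ->
  ac c g 1 ^+ 2 - ac c g 0 ^+ 2 = 2 * ip (ac c g) g.
Proof.
move=> Lg; set u := ac c g.
have Lu : L2 u by exact: L2_ac.
(* m is the mass of g^2 on [0,t], and e the defect, to be shown constant *)
pose m t := ip (fun z => chi t z * g z) g.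
pose e t := u t ^+ 2 - 2 * ip (fun z => chi t z * u z) g.
have uB x y : u y - u x = ip (seg x y) g.
  by rewrite -primB// /u /ac; ring.
have step s t : s <= t -> `|e t - e s| <= 2 * (t - s) * (m t - m s).
  move=> st; set G := loc s t g.
  have LG : L2 G by exact: L2_loc.
  have Ls := L2_seg s t.
  have Lsu : L2 (loc s t u) by exact: L2_loc.
  have locE f : L2 f -> loc s t f = (fun z => chi t z * f z) - (fun z => chi s z * f z).
    by move=> _; apply/funext => z; rewrite /loc /seg !fctE mulrBl.
  have -> : m t - m s = L2norm G ^+ 2.
    rewrite /m -ipBl//; try exact: L2_chiM.
    rewrite -locE// L2norm_sqr; congr Rintegral; apply/funext => z.
    by rewrite /G /loc [RHS]mulrACA segK// mulrA.
  pose h : R -> R^o := (u t + u s) *: seg s t - 2 *: loc s t u.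
  have Lh : L2 h by apply: L2B; apply: L2Z.
  have hE z : h z = seg s t z * (u t + u s - 2 * u z).
    by rewrite /h /loc !fctE /GRing.scale/=; ring.
  have -> : e t - e s = ip h G.
    have -> : ip h G = ip h g.
      congr Rintegral; apply/funext => z; rewrite /G /loc hE.
      by rewrite mulrACA segK// mulrA.
    rewrite /h ipBl ?ipZl//; try exact: L2Z.
    rewrite -uB locE// ipBl//; try exact: L2_chiM.
    by rewrite /e; ring.
  have osc z : s < z <= t -> `|u t + u s - 2 * u z| <= 2 * Num.sqrt (t - s) * L2norm G.
    move=> /andP[sz zt]; have {}sz := ltW sz.
    have B x y : s <= x -> x <= y -> y <= t -> `|u y - u x| <= Num.sqrt (t - s) * L2norm G.
      move=> sx xy yt; rewrite uB (@ip_seg_loc x y s t g)//.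
      apply: (le_trans (cauchy_schwarz (L2_seg x y) LG)).
      rewrite ler_wpM2r ?L2norm_ge0// (le_trans (L2norm_seg xy))// ler_wsqrtr//.
      by lra.
    have -> : u t + u s - 2 * u z = (u t - u z) - (u z - u s) by ring.
    apply: (le_trans (ler_normB _ _)).
    have := B z t sz zt (lexx _); have := B s z (lexx _) sz zt.
    by lra.
  apply: (le_trans (cauchy_schwarz Lh LG)).
  have -> : 2 * (t - s) * L2norm G ^+ 2 = (2 * (t - s) * L2norm G) * L2norm G by ring.
  rewrite ler_wpM2r ?L2norm_ge0//.
  have C0 : 0 <= 2 * Num.sqrt (t - s) * L2norm G.
    by rewrite mulr_ge0 ?L2norm_ge0// mulr_ge0// sqrtr_ge0.
  apply: (@le_trans _ _ (L2norm ((2 * Num.sqrt (t - s) * L2norm G) *: seg s t))).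
    apply: L2norm_le => //; first exact: L2Z.
    apply: aeW => z; rewrite hE !fctE /GRing.scale/= normrM [leRHS]normrM (ger0_norm C0) mulrC.
    rewrite segE//; have [/osc|_] := boolP (s < z <= t); last by rewrite normr0 !mulr0.
    by rewrite normr1 !mulr1.
  rewrite L2normZ// (ger0_norm C0).
  have := L2norm_seg st; have := sqr_sqrtr (_ : 0 <= t - s); rewrite subr_ge0 => /(_ st).
  move=> sq ns.
  have -> : 2 * (t - s) * L2norm G = (2 * Num.sqrt (t - s) * L2norm G) * Num.sqrt (t - s).
    by rewrite -[in LHS]sq; ring.
  by rewrite ler_wpM2l.
have tele N k : `|e (k%:R / N%:R) - e 0| <= 2 / N%:R * (m (k%:R / N%:R) - m 0).
  elim: k => [|k ih]; first by rewrite mul0r !subrr normr0 mulr0.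
  have le : k%:R / N%:R <= k.+1%:R / N%:R :> R.
    by rewrite ler_wpM2r ?invr_ge0// ler_nat.
  have := step _ _ le; rewrite -mulrBl -natrB// subSnn div1r => st.
  have -> : e (k.+1%:R / N%:R) - e 0 =
     (e (k.+1%:R / N%:R) - e (k%:R / N%:R)) + (e (k%:R / N%:R) - e 0) by ring.
  apply: (le_trans (ler_normD _ _)); apply: (le_trans (lerD st ih)).
  by rewrite le_eqVlt; apply/orP; left; apply/eqP; ring.
have e10 : e 1 = e 0.
  apply/subr0_eq/(@eq0_of_harmonic_bound _ (2 * (m 1 - m 0))) => n.
  have := tele n.+1 n.+1; rewrite divff ?pnatr_eq0//.
  by rewrite mulrAC.
have := e10; rewrite /e.
have -> : ip (fun z => chi 1 z * u z) g = ip u g.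
  apply: ae_ipl => //; first exact: L2_chiM.
  apply: ae_sub ae01 => z; rewrite in_itv/= => /andP[_ /ltW z1] _.
  by rewrite chiE z1 mul1r.
have -> : ip (fun z => chi 0 z * u z) g = ip 0 g.
  apply: ae_ipl => //; [exact: L2_chiM|exact: L2_0|].
  apply: ae_sub ae01 => z; rewrite in_itv/= => /andP[z0 _] _.
  by rewrite chiE leNgt z0 mul0r.
rewrite -[0 : R -> R^o](scale0r g) ipZl// mul0r.
by lra.
Qed.

(** Polarisation of [ac_sqr_ip]. *)
Lemma ac_ibp c1 c2 g1 g2 : L2 g1 -> L2 g2 ->
  ip (ac c1 g1) g2 + ip g1 (ac c2 g2) =
  ac c1 g1 1 * ac c2 g2 1 - ac c1 g1 0 * ac c2 g2 0.
Proof.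
move=> L1 L2'.
have acD : ac (c1 + c2) (g1 + g2) = ac c1 g1 + ac c2 g2.
  apply/funext => x; rewrite /ac !fctE.
  by have := @prim_lin 1 g1 g2 x L1 L2'; rewrite scale1r mul1r => ->; ring.
have := ac_sqr_ip (c1 + c2) (L2D L1 L2'); rewrite acD.
have := ac_sqr_ip c1 L1; have := ac_sqr_ip c2 L2'.
move: (ac c1 g1) (ac c2 g2) (L2_ac c1 L1) (L2_ac c2 L2') => w1 w2 A1 A2.
rewrite !fctE ipDl ?ipDr//; try exact: L2D.
rewrite (ipC w2 g1).
by lra.
Qed.

End Primitive.

(** * Sobolev functions and their traces *)

Section Sobolev.
Context {R : realType}.
Implicit Types (f g h u w phi : R -> R^o) (x y z s t c : R).
Notation mu := (@leb01 R).
Notation leb := (@lebesgue_measure R).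

Lemma sqrt_small (A K d0 : R) : 0 < d0 ->
  (forall d, 0 < d < d0 -> `|A| <= K * Num.sqrt d) -> A = 0.
Proof.
move=> d00 h; have K0 : 0 <= K.
  have d2 : 0 < d0 / 2 < d0 by lra.
  have /andP[? _] := d2; have := le_trans (normr_ge0 _) (h _ d2).
  by rewrite pmulr_lge0// sqrtr_gt0.
apply: (@eq0_of_harmonic_bound _ _ (K * Num.sqrt d0 + K)) => n.
pose d := d0 / (n.+2%:R ^+ 2) : R.
have n1 : (1 : R) < n.+2%:R by rewrite ltr1n.
have n0 : (0 : R) < n.+2%:R by rewrite ltr0n.
have hd : 0 < d < d0.
  rewrite divr_gt0 ?exprn_gt0//= ltr_pdivrMr ?exprn_gt0// ltr_pMr//.
  by rewrite expr_gt1// ltW.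
apply: (le_trans (h _ hd)).
rewrite /d sqrtrM ?(ltW d00)// sqrtrV ?exprn_ge0 ?ler0n// sqrtr_sqr gtr0_norm// mulrA.
have s0 := sqrtr_ge0 d0.
apply: ler_pM; rewrite ?mulr_ge0 ?invr_ge0 ?ler0n ?lerDl//.
by rewrite lef_pV2 ?posrE// ler_nat.
Qed.

Lemma L2_continuous f : continuous (f : R -> R) -> L2 f.
Proof.
move=> cf; have mf : measurable_fun setT (f : R -> R) by exact: continuous_measurable_fun.
have cf' : {within `[0, 1], continuous (fun x => `|f x| : R)}.
  apply: continuous_subspaceT => x; apply: continuous_comp; first exact: cf.
  exact: norm_continuous.
have [M _ hM] := EVT_max (@ler01 R) cf'.
apply: (@L2_dom _ _ (cst `|f M|)) => //; first exact: L2_cst.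
apply: ae_sub ae01 => x; rewrite in_itv/= => /andP[x0 x1].
rewrite [leRHS]ger0_norm//; apply: hM.
by rewrite in_itv/= !ltW.
Qed.

Lemma prim_itv f x : L2 f -> 0 <= x <= 1 ->
  prim f x = \int[leb]_(t in `[0, x]) f t.
Proof.
move=> Lf /andP[x0 x1].
have intf : leb.-integrable `]0, 1[ (EFin \o f).
  apply: leb01_integrable.
  have := L2_integrable (L2_cst 1) Lf.
  by congr (mu.-integrable setT _); apply/funext => z /=; rewrite mul1r.
rewrite /prim /ip leb01_integral; last by apply: L2_integrable => //; exact: L2_chi.
transitivity (\int[leb]_(t in `]0, 1[ `&` `]-oo, x]) f t).
  rewrite Rintegral_mkcond [RHS]Rintegral_mkcond; congr Rintegral.
  apply/funext => t; rewrite !patchE in_setI chiE.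
  have -> : (t \in `]-oo, x]%classic) = (t <= x) by rewrite mem_setE in_itv.
  by case: (t \in _) => //=; case: (t <= x); rewrite ?mul1r ?mul0r.
have mf A : measurable_fun A (EFin \o f).
  by apply/measurable_EFinP; apply: measurable_funTS; exact: L2_mfun.
have [x1'|] := ltP x 1; last first.
  move=> x1'; have -> : x = 1 by apply/eqP; rewrite eq_le x1 x1'.
  have -> : `]0, 1[%classic `&` `]-oo, 1]%classic = `]0, 1[%classic :> set R.
    by rewrite setIidl// => t /=; rewrite !in_itv/= => /andP[_ /ltW].
  by rewrite /Rintegral integral_itv_bndo_bndc// integral_itv_obnd_cbnd.
have E : `]0, 1[%classic `&` `]-oo, x]%classic = `]0, x]%classic :> set R.
  apply/seteqP; split => t /=; rewrite !in_itv/=.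
    by move=> [/andP[-> _] ->].
  by move=> /andP[-> tx]; rewrite (le_lt_trans tx).
by rewrite E /Rintegral integral_itv_obnd_cbnd.
Qed.

Lemma prim_cst k x : 0 <= x <= 1 -> prim (cst k) x = k * x.
Proof.
move=> x01; have /andP[x0 x1] := x01; rewrite prim_itv//; last exact: L2_cst.
rewrite Rintegral_cst//; congr (k * _).
have [->|xN0] := eqVneq x 0; first by rewrite set_itv1 [X in fine X]lebesgue_measure_set1.
have lx : (leb `[0%R, x]%classic = x%:E)%E.
  rewrite lebesgue_measure_itv/= lte_fin lt_neqAle eq_sym xN0 x0/=.
  by rewrite oppr0 adde0.
exact: (congr1 fine lx).
Qed.

Lemma prim0 f : L2 f -> prim f 0 = 0.
Proof. by move=> Lf; rewrite prim_itv ?lexx ?ler01// set_itv1 Rintegral_set1. Qed.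

Lemma ac0 c f : L2 f -> ac c f 0 = c.
Proof. by move=> Lf; rewrite /ac prim0// addr0. Qed.

Lemma C1_ac f : (forall x, derivable f x 1) -> continuous (derive1 f : R -> R) ->
  forall x, 0 <= x <= 1 -> f x = ac (f 0) (derive1 f) x.
Proof.
move=> df cf x /andP[x0 x1]; have Lf := L2_continuous cf.
have [->|xN0] := eqVneq x 0; first by rewrite ac0.
have {xN0}x0 : 0 < x by rewrite lt_neqAle eq_sym xN0.
rewrite /ac prim_itv ?(ltW x0)//= /Rintegral.
have cF : continuous (f : R -> R).
  by move=> z; apply: differentiable_continuous; apply/derivable1_diffP.
have cdf : {within `[0, x], continuous (derive1 f : R -> R)}.
  by apply: continuous_subspaceT => z; exact: cf.
have lr : derivable_oo_LRcontinuous f 0 x.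
  split => [z _||]; first exact: df.
  - by apply: cvg_at_right_filter; exact: cF.
  - by apply: cvg_at_left_filter; exact: cF.
have FTC := continuous_FTC2 x0 cdf lr (fun z _ => erefl).
by rewrite [X in fine X]FTC -EFinB/=; ring.
Qed.

Lemma derivable_cont f : (forall x, derivable f x 1) -> continuous (f : R -> R).
Proof.
by move=> df z; apply: differentiable_continuous; apply/derivable1_diffP.
Qed.

Lemma test_L2 phi : test_fun phi -> L2 phi /\ L2 (derive1 phi).
Proof.
by move=> [dp cp _]; split; apply: L2_continuous => //; exact: derivable_cont.
Qed.

Lemma test_out phi x : test_fun phi -> ~~ (0 < x < 1) -> phi x = 0.
Proof.
move=> [_ _ sub] x01; apply/eqP/negPn/negP => px.
have := sub x (@subset_closure _ [set x | phi x != 0] x px); rewrite /= in_itv/=.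
by rewrite (negbTE x01).
Qed.

Lemma test_ac phi : test_fun phi -> phi = ac 0 (derive1 phi) %[ae mu].
Proof.
move=> tp; have [dp cp _] := tp.
apply: ae_sub ae01 => x; rewrite in_itv/= => /andP[x0 x1] _.
rewrite (C1_ac dp cp); last by rewrite !ltW.
by rewrite (test_out tp)// ltxx.
Qed.

Lemma ac_weak_deriv c g : L2 g -> weak_deriv (ac c g) g.
Proof.
move=> Lg; split=> // phi tp; have [Lp Ldp] := test_L2 tp; have [dp cp _] := tp.
have E := @ac_ibp _ c 0 _ _ Lg Ldp.
have p1 : ac 0 (derive1 phi) 1 = 0.
  have := C1_ac dp cp (_ : 0 <= 1 <= 1); rewrite lexx ler01 => /(_ isT).
  by rewrite !(test_out tp) ?ltxx ?andbF.
move: E; rewrite p1 (ac0 0 Ldp) !mulr0 subr0 => /eqP; rewrite addr_eq0 => /eqP E.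
rewrite [LHS]E; congr (- _); apply: ae_ipr => //; first exact: L2_ac.
by apply: ae_sub (test_ac tp) => x /= h _; rewrite h.
Qed.

Lemma ae_weak_deriv u u' g : L2 u -> L2 u' -> u = u' %[ae mu] ->
  weak_deriv u g -> weak_deriv u' g.
Proof.
move=> Lu Lu' uu' [Lg h]; split => // phi tp; rewrite -h//.
have [_ Ldp] := test_L2 tp.
apply: (@ae_ipl _ u' u (derive1 phi)) => //.
by apply: ae_sub uu' => x h' xT; rewrite h'.
Qed.

Lemma weak_deriv_lin a u w g h : L2 u -> L2 w -> weak_deriv u g -> weak_deriv w h ->
  weak_deriv (a *: u + w) (a *: g + h).
Proof.
move=> Lu Lw [Lg hg] [Lh hh]; split; first exact: L2_lin.
move=> phi tp; have [Lp Ldp] := test_L2 tp.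
have E1 := hg _ tp; have E2 := hh _ tp.
rewrite -/(ip (a *: u + w) (derive1 phi)) -/(ip (a *: g + h) phi).
rewrite ipDl ?ipZl//; try exact: L2Z.
rewrite ipDl ?ipZl//; try exact: L2Z.
rewrite /ip E1 E2; ring.
Qed.

(** This criterion treats at once both sides of the kink of a squared ramp. *)
Lemma is_derive_quad (f : R -> R^o) (x L K : R) :
  (forall y, `|f y - f x - L * (y - x)| <= K * (y - x) ^+ 2) -> is_derive x 1 f L.
Proof.
move=> h; have h' := h.
have lim : (fun t => t^-1 *: (f (t *: (1 : R^o) + x) - f x)) @ 0^' --> L.
  apply/cvgrPdist_le => e e0.
  have K0 : 0 <= K.
    have := le_trans (normr_ge0 _) (h (x + 1)).
    by rewrite [x + 1]addrC addrK expr1n mulr1.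
  near=> t.
  have t0 : t != 0 by near: t; exact: nbhs_dnbhs_neq.
  have := h (t *: (1 : R^o) + x); rewrite addrK [_ *: _]mulr1 => ht.
  have -> : L - t^-1 *: (f (t + x) - f x) = - t^-1 * (f (t + x) - f x - L * t).
    by rewrite /GRing.scale/=; field.
  rewrite normrM normrN normfV ler_pdivrMl ?normr_gt0//.
  apply: (le_trans ht); rewrite -(real_normK (num_real t)) mulrCA ler_wpM2l//.
  rewrite mulrC; apply: (@le_trans _ _ (e / (K + 1) * (K + 1))); last first.
    by rewrite divfK// gt_eqF// ltr_wpDl.
  apply: ler_pM => //; last by rewrite lerDl.
  near: t; apply: dnbhs0_le; rewrite divr_gt0// ltr_wpDl//.
apply: DeriveDef; first by apply/cvg_ex; exists L.
by apply/cvg_lim.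
Unshelve. all: by end_near. Qed.

Definition ramp s : R -> R^o := fun x => Num.max 0 (x - s).

Lemma ramp_continuous s : continuous (ramp s : R -> R).
Proof.
move=> x; apply: (@continuous_max _ _ (cst 0) (fun y => y - s)); first exact: cvg_cst.
by apply: (@cvgB _ R^o); [exact: cvg_id|exact: cvg_cst].
Qed.

Lemma is_derive_ramp2 s x : is_derive x 1 (fun y => ramp s y ^+ 2 : R^o) (2 * ramp s x).
Proof.
apply: (@is_derive_quad _ _ _ 1) => y; rewrite /ramp mul1r.
have [h1|h1] := leP 0 (x - s); have [h2|h2] := leP 0 (y - s); rewrite ler_norml.
- by have sq := sqr_ge0 (y - x); apply/andP; split; lra.
- have sq := sqr_ge0 (y - s); have sq2 := sqr_ge0 (y - x); have sq3 := sqr_ge0 (x - s).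
  have p : 0 <= (x - s) * (s - y) by rewrite mulr_ge0//; lra.
  by apply/andP; split; lra.
- have sq := sqr_ge0 (s - x); have sq2 := sqr_ge0 (y - x); have sq3 := sqr_ge0 (y - s).
  have p : 0 <= (s - x) * (y - s) by rewrite mulr_ge0//; lra.
  by apply/andP; split; lra.
- by have sq := sqr_ge0 (y - x); apply/andP; split; lra.
Qed.

(** The trapezoidal approximation of the indicator of ]s, +oo[.  Its primitive
    [bend s d] is of class C^1, vanishes on the left of [s] and is affine with
    slope 1 on the right of [s + d], so that combinations of bends whose weights
    annihilate affine functions are compactly supported. *)
Definition step s d : R -> R^o := fun x => (ramp s x - ramp (s + d) x) / d.

Definition bend s d : R -> R^o := fun x => (ramp s x ^+ 2 - ramp (s + d) x ^+ 2) / (2 * d).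

Lemma is_derive_bend s d x : 0 < d -> is_derive x 1 (bend s d) (step s d x).
Proof.
move=> d0.
have h1 := @is_derive_ramp2 s x; have h2 := @is_derive_ramp2 (s + d) x.
have -> : bend s d = (2 * d)^-1 *: ((fun y => ramp s y ^+ 2 : R^o) - (fun y => ramp (s + d) y ^+ 2 : R^o)).
  by apply/funext => y; rewrite /bend !fctE /GRing.scale/= mulrC.
apply: is_derive_eq; rewrite /step /GRing.scale/=.
by field; rewrite gt_eqF.
Qed.

Lemma step_continuous s d : continuous (step s d : R -> R).
Proof.
move=> x; apply: (@cvgM _ R); last exact: cvg_cst.
by apply: (@cvgB _ R^o); exact: ramp_continuous.
Qed.

Lemma bend_left s d x : 0 < d -> x <= s -> bend s d x = 0.
Proof.
by move=> d0 xs; rewrite /bend /ramp !max_l; [rewrite subrr mul0r|lra|lra].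
Qed.

Lemma bend_right s d x : 0 < d -> s + d <= x -> bend s d x = x - s - d / 2.
Proof.
by move=> d0 xs; rewrite /bend /ramp !max_r; [field; rewrite gt_eqF|lra|lra].
Qed.

Lemma step_ip f s d : 0 < d -> L2 f ->
  `|ip (step s d) f - ip (cst 1 - chi s) f| <= L2norm f * Num.sqrt d.
Proof.
move=> d0 Lf; have Ls := L2_continuous (@step_continuous s d).
have Lc : L2 (cst 1 - chi s) by apply: L2B; [exact: L2_cst|exact: L2_chi].
have sd : s <= s + d by lra.
rewrite -ipBl//; apply: (le_trans (cauchy_schwarz (L2B Ls Lc) Lf)).
rewrite mulrC ler_wpM2l ?L2norm_ge0//.
have -> : Num.sqrt d = Num.sqrt ((s + d) - s) by congr Num.sqrt; ring.
apply: (le_trans _ (L2norm_seg sd)); apply: L2norm_le; [exact: L2B|exact: L2_seg|].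
apply: aeW => z; rewrite /step !fctE chiE segE//.
have [zs|sz] := leP z s.
  rewrite /ramp !max_l; [|lra|lra].
  by rewrite !subrr mul0r subr0 normr0.
have [zsd|sdz] := leP z (s + d) => /=.
  rewrite /ramp max_r; last by lra.
  rewrite max_l; last by lra.
  rewrite !subr0 normr1 ler_norml; apply/andP; split.
    by rewrite lerBrDl subrr divr_ge0//; lra.
  by rewrite lerBlDl (_ : 1 + 1 = 2)// ler_pdivrMr//; lra.
rewrite /ramp !max_r; [|lra|lra].
rewrite (_ : _ / d = 1); last by field; rewrite gt_eqF.
by rewrite subr0 subrr normr0.
Qed.

(** Testing with bends at three points of ]0,1[ whose weights annihilate affine
    functions, and letting their width tend to 0, gives a linear relation between
    three values of the primitive of [f]; hence the primitive is affine. *)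
Lemma du_bois_reymond f : L2 f ->
  (forall phi, test_fun phi -> ip f (derive1 phi) = 0) ->
  exists k, f = cst k %[ae mu].
Proof.
move=> Lf h.
pose a1 := 1 / 3 : R; pose a2 := 2 / 3 : R.
have three x : 0 < x < 1 ->
    prim f x / 3 = (2 / 3 - x) * prim f a1 + (x - 1 / 3) * prim f a2.
  move=> /andP[x0 x1].
  pose l := Num.min x a1; pose r := Num.max x a2.
  have l0 : 0 < l by rewrite lt_min x0 divr_gt0.
  have r1 : r < 1 by rewrite gt_max x1 /a2; lra.
  pose A := 1 / 3 * ip (cst 1 - chi x) f + (x - 2 / 3) * ip (cst 1 - chi a1) f +
            (1 / 3 - x) * ip (cst 1 - chi a2) f.
  have A0 : A = 0.
    pose K := (`|1 / 3| + `|x - 2 / 3| + `|1 / 3 - x|) * L2norm f.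
    apply: (@sqrt_small A K (1 - r)); first by rewrite subr_gt0.
    move=> d /andP[d0 dr].
    (* 1/3 + (x - 2/3) + (1/3 - x) = 0 and x/3 + (x - 2/3)/3 + 2 (1/3 - x)/3 = 0 *)
    pose phi : R -> R^o := (1 / 3) *: bend x d + (x - 2 / 3) *: bend a1 d + (1 / 3 - x) *: bend a2 d.
    pose dphi : R -> R^o := (1 / 3) *: step x d + (x - 2 / 3) *: step a1 d + (1 / 3 - x) *: step a2 d.
    have dE z : is_derive z 1 phi (dphi z).
      have hx := @is_derive_bend x d z d0; have h1 := @is_derive_bend a1 d z d0.
      have h2 := @is_derive_bend a2 d z d0.
      exact: (is_deriveD (is_deriveD (is_deriveZ (1 / 3) hx)
        (is_deriveZ (x - 2 / 3) h1)) (is_deriveZ (1 / 3 - x) h2)).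
    have d1 : derive1 phi = dphi.
      by apply/funext => z; rewrite derive1E; have [_ ->] := dE z.
    have tp : test_fun phi.
      split.
      - by move=> z; have [] := dE z.
      - rewrite d1 => z; rewrite /dphi.
        apply: (@cvgD _ R^o); first apply: (@cvgD _ R^o).
        + by apply: (@cvgZr _ R^o); exact: step_continuous.
        + by apply: (@cvgZr _ R^o); exact: step_continuous.
        + by apply: (@cvgZr _ R^o); exact: step_continuous.
      have sub : [set z | phi z != 0] `<=` `[l, r + d]%classic.
        move=> z /= pz; rewrite in_itv/=; apply/andP; split; rewrite leNgt; apply/negP => hz.
          move/eqP: pz; apply.
          move: hz; rewrite lt_min => /andP[zx za1].
          rewrite /phi !fctE !bend_left ?ltW// ?scaler0 ?addr0//.
          by rewrite /a2; move: za1; rewrite /a1; lra.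
        move/eqP: pz; apply.
        have /andP[zx za2] : (x + d <= z) && (a2 + d <= z).
          have rx : x <= r by rewrite le_max lexx.
          have ra : a2 <= r by rewrite le_max lexx orbT.
          by apply/andP; split; lra.
        rewrite /phi !fctE !bend_right//; last by move: za2; rewrite /a1 /a2; lra.
        by rewrite /GRing.scale/= /a1 /a2; field.
      have cl : closed (`[l, r + d]%classic : set R) by exact: itv_closed.
      move=> z zc; have := closure_subset sub zc.
      rewrite -(closure_id _).1// /= !in_itv/= => /andP[lz zr].
      by rewrite (lt_le_trans l0 lz)/=; lra.
    have Ls s := L2_continuous (@step_continuous s d).
    have := h _ tp; rewrite d1 ipC /dphi.
    rewrite !ipDl ?ipZl//; do ?[exact: L2Z|apply: L2D]; rewrite ?ipZl//.
    move=> E; have -> : A = - (1 / 3 * (ip (step x d) f - ip (cst 1 - chi x) f) +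
       (x - 2 / 3) * (ip (step a1 d) f - ip (cst 1 - chi a1) f) +
       (1 / 3 - x) * (ip (step a2 d) f - ip (cst 1 - chi a2) f)).
      by rewrite /A; lra.
    have -> : K * Num.sqrt d = `|1 / 3| * L2norm f * Num.sqrt d +
        `|x - 2 / 3| * L2norm f * Num.sqrt d + `|1 / 3 - x| * L2norm f * Num.sqrt d.
      by rewrite /K; ring.
    rewrite normrN.
    have T (al s : R) : `|al * (ip (step s d) f - ip (cst 1 - chi s) f)| <=
         `|al| * L2norm f * Num.sqrt d.
      by rewrite normrM -mulrA ler_wpM2l// step_ip.
    apply: (le_trans (ler_normD _ _)); apply: lerD; last exact: T.
    by apply: (le_trans (ler_normD _ _)); apply: lerD; exact: T.
  have pr s : ip (cst 1 - chi s) f = ip (cst 1) f - prim f s.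
    by rewrite ipBl//; [exact: L2_cst|exact: L2_chi].
  by move: A0; rewrite /A !pr; lra.
(* [three] reads prim f x = k x + A, and A = 0 since prim f tends to 0 at 0 *)
pose k := 3 * (prim f a2 - prim f a1).
pose A := 3 * (2 / 3 * prim f a1 - 1 / 3 * prim f a2).
exists k.
have Lg : L2 (f - cst k) by apply: L2B => //; exact: L2_cst.
have pc x : 0 < x < 1 -> prim (cst k) x = k * x.
  by move=> /andP[x0 x1]; rewrite prim_cst// (ltW x0) (ltW x1).
have pg x : 0 < x < 1 -> prim (f - cst k) x = A.
  move=> x01; have := @prim_lin _ (-1) (cst k) f x (L2_cst k) Lf.
  rewrite scaleN1r addrC => ->; rewrite pc//; have := three _ x01; rewrite /A /k; lra.
have A0 : A = 0.
  apply: (@sqrt_small _ (L2norm (f - cst k)) 1) => // x x01.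
  rewrite -(pg _ x01) -[prim _ x]subr0 -(prim0 Lg) mulrC.
  apply: (le_trans (prim_holder _ _ Lg)).
  by rewrite subr0 ger0_norm//; case/andP: x01 => /ltW.
have pg0 x : 0 < x < 1 -> prim (f - cst k) x = 0 by move=> /pg ->.
apply: ae_sub (prim_eq0 Lg pg0) => x hx xT; apply/eqP; rewrite -subr_eq0; apply/eqP.
exact: hx.
Qed.

(** [u - \int g] has a null weak derivative, hence is constant by
    [du_bois_reymond]; this gives [u] its continuous representative. *)
Lemma weak_deriv_ac u g : L2 u -> weak_deriv u g -> exists c, u = ac c g %[ae mu].
Proof.
move=> Lu wu; have [Lg _] := wu; have Lp := L2_ac 0 Lg.
have [phi tp|k hk] := @du_bois_reymond (u - ac 0 g) (L2B Lu Lp).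
  have [_ Ldp] := test_L2 tp; rewrite ipBl//.
  have := wu.2 _ tp; have := (ac_weak_deriv 0 Lg).2 _ tp.
  by rewrite /ip => -> ->; rewrite subrr.
exists k; apply: ae_sub hk => x hx xT; have := hx xT.
by rewrite /ac !fctE add0r => /eqP; rewrite subr_eq => /eqP.
Qed.

Lemma ae_dense (P : R -> Prop) a b : 0 <= a -> a < b -> b <= 1 ->
  (\forall x \ae mu, P x) -> exists2 x, a < x < b & P x.
Proof.
move=> a0 ab b1 [N [mN N0 sub]]; apply: contrapT => hn.
have sN : `]a, b[%classic `<=` N.
  move=> x /=; rewrite in_itv/= => xab; apply: sub => Px; apply: hn.
  by exists x.
have : (leb (`]a, b[%classic : set R) <= mu N)%E.
  rewrite /leb01/= /mrestr; apply: le_measure; rewrite ?inE//.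
    exact: measurableI.
  move=> x xab; split; first exact: sN.
  move: xab; rewrite /= !in_itv/= => /andP[ax xb].
  by rewrite (le_lt_trans a0 ax) (lt_le_trans xb b1).
rewrite N0 lebesgue_measure_itv/= lte_fin ab -EFinB lee_fin subr_le0.
by rewrite leNgt ab.
Qed.

(** If continuous functions differ at a point, they differ on an interval, which
    is not negligible. *)
Lemma continuous_ae_unique (v w : R -> R) : {within `[0, 1], continuous v} ->
  {within `[0, 1], continuous w} -> v = w %[ae mu] ->
  forall x, 0 <= x <= 1 -> v x = w x.
Proof.
move=> cv cw vw x x01.
have cd : {within `[0, 1], continuous (fun x => `|v x - w x| : R)}.
  move=> z; apply: (@cvg_norm _ R^o).
  by apply: (@cvgB _ R^o); [exact: cv|exact: cw].
apply/eqP; rewrite -subr_eq0 -normr_eq0; apply/negP => /negP d0.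
have {}d0 : 0 < `|v x - w x| by rewrite lt_neqAle eq_sym d0 normr_ge0.
have : (fun y => `|v y - w y|) @ within `[0, 1]%classic (nbhs x) --> `|v x - w x|.
  by rewrite nbhs_subspace_in; [exact: cd|rewrite /= in_itv].
move=> /cvgrPdist_lt /(_ _ d0); rewrite near_withinE => /nbhs_ballP[r /= r0 hr].
pose a := Num.max 0 (x - r); pose b := Num.min 1 (x + r).
have [/andP[x0 x1]] := x01.
have a0 : 0 <= a by rewrite le_max lexx.
have b1 : b <= 1 by rewrite ge_min lexx.
have ab : a < b by rewrite gt_max !lt_min; apply/andP; split; apply/andP; split; lra.
have [z /andP[az zb] vz] := ae_dense a0 ab b1 vw.
have : ball x r z.
  move: az zb; rewrite gt_max lt_min => /andP[_ h1] /andP[_ h2].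
  by rewrite /ball/= ltr_distlC; apply/andP; split; lra.
move=> /hr; rewrite /= in_itv/= (ltW (le_lt_trans a0 az)) (ltW (lt_le_trans zb b1)).
move=> /(_ isT); rewrite vz// subrr normr0 subr0 normr_id ltxx.
by [].
Qed.

Lemma trace_eq u w : {within `[0, 1], continuous (w : R -> R)} -> u = w %[ae mu] ->
  forall x, 0 <= x <= 1 -> trace u x = w x.
Proof.
move=> cw uw x x01; rewrite /trace; case: xgetP => [v -> [cv uv]|/(_ w)]; last first.
  by move=> []; split.
apply: (continuous_ae_unique cv cw) => //.
by apply: ae_sub (ae_and uv uw) => z [h1 h2] _; rewrite -h1// h2.
Qed.

Lemma trace_ac c g u : L2 g -> u = ac c g %[ae mu] ->
  forall x, 0 <= x <= 1 -> trace u x = ac c g x.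
Proof.
by move=> Lg; apply: trace_eq; apply: continuous_subspaceT; exact: ac_continuous.
Qed.

Lemma weak_deriv_unique u g h : L2 u -> weak_deriv u g -> weak_deriv u h ->
  g = h %[ae mu].
Proof.
move=> Lu wg wh; have [Lg _] := wg; have [Lh _] := wh.
have [c uc] := weak_deriv_ac Lu wg; have [k uk] := weak_deriv_ac Lu wh.
have E x (x01 : 0 <= x <= 1) : ac c g x = ac k h x.
  by rewrite -(trace_ac Lg uc x01) -(trace_ac Lh uk x01).
have ck : c = k by have := E 0; rewrite !ac0// => ->//; rewrite lexx ler01.
have pg x : 0 < x < 1 -> prim (g - h) x = 0.
  move=> /andP[x0 x1]; have := E x; rewrite !ltW// => /(_ isT).
  rewrite /ac ck => /addrI e; have Lx := L2_chi x.
  by rewrite /prim ipBr// -!/(prim _ x) e subrr.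
apply: ae_sub (prim_eq0 (L2B Lg Lh) pg) => x hx xT; apply/eqP; rewrite -subr_eq0; apply/eqP.
exact: hx.
Qed.

Lemma H1_wD u : H1 u -> weak_deriv u (wD u).
Proof.
move=> [Lu [g wg]]; rewrite /wD; case: xgetP => [v -> //|/(_ g)].
by move=> /(_ wg).
Qed.

Lemma H1_L2 u : H1 u -> L2 u. Proof. by case. Qed.

Lemma L2_wD u : H1 u -> L2 (wD u). Proof. by move=> /H1_wD[]. Qed.

Lemma wD_eq u g : L2 u -> weak_deriv u g -> wD u = g %[ae mu].
Proof.
move=> Lu wg; apply: (weak_deriv_unique Lu) => //; apply: H1_wD.
by split => //; exists g.
Qed.

Lemma H1_ae u : H1 u -> u = ac (trace u 0) (wD u) %[ae mu].
Proof.
move=> hu; have Lw := L2_wD hu; have [c uc] := weak_deriv_ac (H1_L2 hu) (H1_wD hu).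
by rewrite (trace_ac Lw uc) ?lexx ?ler01// ac0.
Qed.

Lemma H1_trace u x : H1 u -> 0 <= x <= 1 -> trace u x = trace u 0 + prim (wD u) x.
Proof. by move=> hu x01; rewrite (trace_ac (L2_wD hu) (H1_ae hu)). Qed.

Lemma H1_trace1 u : H1 u -> trace u 1 = trace u 0 + ip (cst 1) (wD u).
Proof.
move=> hu; rewrite H1_trace ?ler01 ?lexx//; congr (_ + _).
have := L2_wD hu => Lw; apply: ae_ipl => //; [exact: L2_chi|exact: L2_cst|].
apply: ae_sub ae01 => x; rewrite in_itv/= => /andP[_ /ltW x1] _.
by rewrite chiE x1.
Qed.

Lemma H1_lin a u w : H1 u -> H1 w -> H1 (a *: u + w).
Proof.
move=> hu hw; split; first by apply: L2_lin; exact: H1_L2.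
by exists (a *: wD u + wD w); apply: weak_deriv_lin; by [exact: H1_L2|exact: H1_wD].
Qed.

Lemma wD_lin a u w : H1 u -> H1 w -> wD (a *: u + w) = a *: wD u + wD w %[ae mu].
Proof.
move=> hu hw; apply: wD_eq; first by apply: L2_lin; exact: H1_L2.
by apply: weak_deriv_lin; by [exact: H1_L2|exact: H1_wD].
Qed.

Lemma trace_lin a u w x : H1 u -> H1 w -> 0 <= x <= 1 ->
  trace (a *: u + w) x = a * trace u x + trace w x.
Proof.
move=> hu hw x01.
have Lu := L2_wD hu; have Lw := L2_wD hw.
rewrite (@trace_ac (a * trace u 0 + trace w 0) (a *: wD u + wD w)) //; last 2 first.
- exact: L2_lin.
- apply: ae_sub (ae_and (H1_ae hu) (H1_ae hw)) => z [h1 h2] zT.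
  rewrite (_ : (a *: u + w) z = a * u z + w z)// (h1 zT) (h2 zT) /ac prim_lin//.
  by rewrite mulrDr addrACA.
by rewrite /ac prim_lin// (H1_trace hu x01) (H1_trace hw x01) mulrDr addrACA.
Qed.

Lemma H1_ibp u w : H1 u -> H1 w -> ip u (wD w) + ip (wD u) w =
  trace u 1 * trace w 1 - trace u 0 * trace w 0.
Proof.
move=> hu hw; have Lu := L2_wD hu; have Lw := L2_wD hw.
have := @ac_ibp _ (trace u 0) (trace w 0) _ _ Lu Lw.
rewrite -!(trace_ac _ (H1_ae hu)) -?(trace_ac _ (H1_ae hw)) ?lexx ?ler01// => <-.
by congr (_ + _); [apply: ae_ipl|apply: ae_ipr] => //;
   by [exact: H1_L2|exact: L2_ac|exact: H1_ae].
Qed.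

(** The sets in which [wD] and [trace] are chosen only depend on the class of the
    function, so these choices are equal, and not only a.e. equal. *)
Lemma ae_H1 u u' : H1 u -> L2 u' -> u = u' %[ae mu] ->
  [/\ H1 u', wD u' = wD u & trace u' = trace u].
Proof.
move=> hu Lu' uu'; have Lu := H1_L2 hu.
have u'u : u' = u %[ae mu] by apply: ae_sub uu' => x h xT; rewrite h.
split.
- split => //; exists (wD u); apply: (ae_weak_deriv Lu Lu') => //; exact: H1_wD.
- rewrite /wD; congr xget; apply/seteqP; split => g /=.
    exact: ae_weak_deriv.
  exact: ae_weak_deriv.
- rewrite /trace; apply/funext => x; congr (xget _ _ x).
  apply/seteqP; split => w /= [cw h]; split => //.
    by apply: ae_sub (ae_and uu' h) => z [h1 h2] zT; rewrite h1// h2.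
  by apply: ae_sub (ae_and u'u h) => z [h1 h2] zT; rewrite h1// h2.
Qed.

Lemma H1_cst a : H1 (cst a : R -> R^o).
Proof.
split; first exact: L2_cst.
exists 0; have := ac_weak_deriv a (@L2_0 R).
apply: ae_weak_deriv; [exact: L2_ac (@L2_0 R)|exact: L2_cst|].
apply: aeW => x xT; rewrite /ac /prim -[0 : R -> R^o](scale0r 0) ipZr ?mul0r ?addr0//.
  exact: L2_0.
exact: L2_chi.
Qed.

End Sobolev.

(** * Exponential weights *)

Section Weights.
Context {R : realType}.
Implicit Types (f g u r phi : R -> R^o) (k x m : R).
Notation mu := (@leb01 R).

Definition expw k f : R -> R^o := fun x => expR (k * x) * f x.

Lemma expw_continuous k : continuous (fun x => expR (k * x) : R).
Proof.
move=> x; apply: continuous_comp; last exact: continuous_expR.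
by apply: (@cvgM _ R); [exact: cvg_cst|exact: cvg_id].
Qed.

Lemma expw_bounds m k x : `|k| <= m -> 0 < x < 1 -> expR (- m) <= expR (k * x) <= expR m.
Proof.
move=> km /andP[x0 x1]; rewrite !ler_expR; have m0 := le_trans (normr_ge0 k) km.
move: km; rewrite ler_norml => /andP[k1 k2].
by apply/andP; split; nra.
Qed.

Lemma L2_expw k f : L2 f -> L2 (expw k f).
Proof.
move=> Lf; apply: (@L2M _ _ _ (expR `|k|)) => //.
  by apply: continuous_measurable_fun; exact: expw_continuous.
move=> x /(expw_bounds (lexx `|k|))/andP[_].
by move=> h; rewrite ger0_norm.
Qed.

Lemma expwC k f g : ip (expw k f) g = ip f (expw k g).
Proof. by congr Rintegral; apply/funext => x; rewrite /expw; ring. Qed.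

Lemma expw_expw k f : expw k (expw k f) = expw (k + k) f.
Proof. by apply/funext => x; rewrite /expw mulrA -expRD mulrDl. Qed.

Lemma expw_lin k a f g : expw k (a *: f + g) = a *: expw k f + expw k g.
Proof. apply/funext => x; rewrite /expw (_ : (a *: f + g) x = a * f x + g x)//.
by rewrite mulrDr mulrCA. Qed.

Lemma ae_expw k f g : f = g %[ae mu] -> expw k f = expw k g %[ae mu].
Proof. by apply: ae_sub => x h xT; rewrite /expw h. Qed.

Lemma expw_norm m k f : `|k + k| <= m -> L2 f ->
  expR (- m) * L2norm f ^+ 2 <= L2norm (expw k f) ^+ 2 <= expR m * L2norm f ^+ 2.
Proof.
move=> km Lf; have Le := L2_expw k Lf.
have E y : expR y = expR (y / 2) ^+ 2.
  by rewrite expr2 -expRD; congr expR; field.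
have mono y z : y <= z -> expR (y / 2) <= expR (z / 2).
  by move=> yz; rewrite ler_expR ler_pM2r.
have scal (y : R) : expR y * L2norm f ^+ 2 = L2norm (expR (y / 2) *: f) ^+ 2.
  by rewrite L2normZ// ger0_norm ?expR_ge0// exprMn -E.
have cmp x : 0 < x < 1 -> expR (- m / 2) <= expR (k * x) <= expR (m / 2).
  have -> : - m / 2 = - (m / 2) by ring.
  apply: expw_bounds; move: km; rewrite -mulr2n normrMn => ?.
  by rewrite ler_pdivlMr// mulr_natr.
have nf y x : `|(expR y *: f) x| = expR y * `|f x|.
  by rewrite fctE /GRing.scale/= normrM ger0_norm ?expR_ge0.
have ne x : `|expw k f x| = expR (k * x) * `|f x|.
  by rewrite /expw normrM ger0_norm ?expR_ge0.
rewrite !scal; apply/andP; split; rewrite lerXn2r ?nnegrE ?L2norm_ge0//.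
- apply: L2norm_le => //; first exact: L2Z.
  apply: ae_sub ae01 => x; rewrite in_itv/= => /cmp/andP[h _].
  by rewrite (nf (- m / 2) x) (ne x) ler_wpM2r.
- apply: L2norm_le => //; first exact: L2Z.
  apply: ae_sub ae01 => x; rewrite in_itv/= => /cmp/andP[_ h].
  by rewrite (nf (m / 2) x) (ne x) ler_wpM2r.
Qed.

Lemma ip_expw k f : ip (expw k f) f = L2norm (expw (k / 2) f) ^+ 2.
Proof.
by rewrite L2norm_sqr [RHS]expwC expw_expw -splitr expwC.
Qed.

Lemma expw_test k phi : test_fun phi -> test_fun (expw k phi) /\
  derive1 (expw k phi) = k *: expw k phi + expw k (derive1 phi).
Proof.
move=> [dp cp sp].
have de x : is_derive x 1 (expw k phi) (k * expw k phi x + expw k (derive1 phi) x).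
  have h0 : is_derive x (1 : R) (fun y : R => k * y) k.
    by apply: (@is_derive_quad _ _ _ _ 0) => y; rewrite -mulrBr subrr normr0 mul0r.
  have h1 := is_derive1_comp (is_derive_expR (k * x)) h0.
  have h2 : is_derive x 1 phi (derive1 phi x) by rewrite derive1E; exact: derivableP.
  have h3 := is_deriveM h1 h2.
  apply: (@is_derive_eq _ _ _ _ _ _ _ _ h3).
  by rewrite /GRing.scale/= addrC /expw; congr (_ + _); rewrite mulrC mulrAC mulrA mulrC mulrA.
have d1 : derive1 (expw k phi) = k *: expw k phi + expw k (derive1 phi).
  by apply/funext => x; rewrite derive1E; have [_ ->] := de x.
split; last exact: d1.
split.
- by move=> x; have [] := de x.
- rewrite d1 => x; apply: (@cvgD _ R^o).
    apply: (@cvgZr _ R^o); apply: (@cvgM _ R); first exact: expw_continuous.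
    exact: (derivable_cont dp).
  by apply: (@cvgM _ R); [exact: expw_continuous|exact: cp].
- apply: subset_trans sp; apply: closure_subset => x /=; rewrite /expw.
  by apply: contra_neq => ->; rewrite mulr0.
Qed.

Lemma expw_H1 k u : H1 u ->
  [/\ H1 (expw k u), wD (expw k u) = k *: expw k u + expw k (wD u) %[ae mu] &
      forall x, 0 <= x <= 1 -> trace (expw k u) x = expR (k * x) * trace u x].
Proof.
move=> hu; have Lu := H1_L2 hu; have Lw := L2_wD hu.
have Le := L2_expw k Lu; have Lew := L2_expw k Lw.
have we : weak_deriv (expw k u) (k *: expw k u + expw k (wD u)).
  split; first exact: L2_lin.
  move=> phi tp; have [te de] := expw_test k tp.
  have [Lp Ldp] := test_L2 tp.
  suff : ip (expw k u) (derive1 phi) = - ip (k *: expw k u + expw k (wD u)) phi by [].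
  have : ip u (derive1 (expw k phi)) = - ip (wD u) (expw k phi).
    exact: (H1_wD hu).2.
  rewrite de.
  have Lep := L2_expw k Lp; have Ledp := L2_expw k Ldp.
  rewrite ipDr ?ipZr//; last exact: L2Z.
  rewrite ipDl ?ipZl//; last exact: L2Z.
  by rewrite -!expwC opprD => <-; rewrite addrA addNr add0r.
have [c uc] : exists c, u = ac c (wD u) %[ae mu] by exists (trace u 0); exact: H1_ae.
split.
- by split => //; exists (k *: expw k u + expw k (wD u)).
- exact: wD_eq.
- move=> x x01; rewrite (@trace_eq _ _ (expw k (ac (trace u 0) (wD u))))//.
  + by rewrite /expw -(trace_ac Lw (H1_ae hu)).
  + apply: continuous_subspaceT => z; apply: (@cvgM _ R); first exact: expw_continuous.
    exact: ac_continuous.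
  + by apply: ae_expw; exact: H1_ae.
Qed.

(** For [r_t = r_x] this is the time derivative of the weighted energy
    [<e^{kx} r, r>]: boundary fluxes and an interior damping of rate [k]. *)
Lemma expw_flux k r : H1 r -> 2 * ip (expw k r) (wD r) =
  expR k * trace r 1 ^+ 2 - trace r 0 ^+ 2 - k * ip (expw k r) r.
Proof.
move=> hr; have [he we te] := expw_H1 k hr.
have Lr := H1_L2 hr; have Lw := L2_wD hr; have Le := L2_expw k Lr.
have Lew := L2_expw k Lw.
have := H1_ibp he hr; rewrite (@ae_ipl _ (wD (expw k r)) (k *: expw k r + expw k (wD r)))//.
- rewrite ipDl ?ipZl//; last exact: L2Z.
  rewrite !te ?lexx ?ler01// mulr1 mulr0 expR0 mul1r (expwC k (wD r)) (ipC (wD r)).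
  by rewrite !expr2; lra.
- exact: L2_wD.
- exact: L2_lin.
Qed.

Lemma poincare u : H1 u -> L2norm u <= `|trace u 0| + L2norm (wD u).
Proof.
move=> hu; have Lw := L2_wD hu.
have La := L2_ac (trace u 0) Lw.
rewrite (ae_L2norm (H1_L2 hu) La (H1_ae hu)).
apply: (@le_trans _ _ (L2norm (cst (`|trace u 0| + L2norm (wD u)) : R -> R^o))).
  apply: L2norm_le => //; first exact: L2_cst.
  apply: aeW => x; rewrite [leRHS]ger0_norm ?addr_ge0 ?L2norm_ge0//.
  by rewrite (le_trans (ler_normD _ _))// lerD2l prim_bound.
by rewrite L2norm_cst ger0_norm// addr_ge0 ?L2norm_ge0.
Qed.

(** The constant [u(0)] is the difference of [u] and a function bounded by the norm
    of [u_x]. *)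
Lemma trace0_bound u : H1 u -> `|trace u 0| <= L2norm u + L2norm (wD u).
Proof.
move=> hu; have Lw := L2_wD hu; have La := L2_ac 0 Lw; have Lu := H1_L2 hu.
have e : cst (trace u 0) = u - ac 0 (wD u) %[ae mu].
  apply: ae_sub (H1_ae hu) => x h xT.
  rewrite (_ : (u - ac 0 (wD u)) x = u x - ac 0 (wD u) x)// h// /ac add0r.
  by rewrite addrK.
rewrite -(L2norm_cst (trace u 0)) (ae_L2norm (@L2_cst _ _) (L2B Lu La) e).
apply: (le_trans (L2normB Lu La)); rewrite lerD2l.
rewrite -[leRHS](ger0_norm (L2norm_ge0 (wD u))) -L2norm_cst.
apply: (L2norm_le La (@L2_cst _ _)); apply: aeW => x.
by rewrite /ac add0r [leRHS]ger0_norm ?L2norm_ge0// prim_bound.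
Qed.

End Weights.

(** * Lyapunov functionals on the domain of the generator *)

Section Generator.
Context {R : realType}.
Notation mu := (@leb01 R).
Variables (a b c d m eps : R).
Implicit Types (X : state R).
#[local] Opaque ip trace wD L2norm.

Definition psi : R -> R^o := fun x => 1 + c * x.

Lemma psi_H1 : [/\ H1 psi, wD psi = cst c %[ae mu] &
  forall x, 0 <= x <= 1 -> trace psi x = 1 + c * x].
Proof.
have Lc := @L2_cst R c.
have e : psi = ac 1 (cst c) %[ae mu].
  apply: ae_sub ae01 => x; rewrite in_itv/= => /andP[x0 x1] _.
  by rewrite /ac prim_cst// (ltW x0) (ltW x1).
have Lp : L2 psi.
  apply: L2_continuous => x; apply: (@cvgD _ R^o); first exact: cvg_cst.
  by apply: (@cvgM _ R); [exact: cvg_cst|exact: cvg_id].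
have w : weak_deriv psi (cst c).
  apply: ae_weak_deriv (ac_weak_deriv 1 Lc) => //; first exact: L2_ac.
  by apply: ae_sub e => x h xT; rewrite h.
split.
- by split => //; exists (cst c).
- exact: wD_eq.
- by move=> x x01; rewrite (trace_ac Lc e)// /ac prim_cst.
Qed.

(** The heat component relative to the quasi-stationary profile
    [(d/c) u(1) psi], which solves [p_xx = 0] with the boundary conditions of
    the heat equation; [qst X] satisfies homogeneous boundary conditions. *)
Definition qst X : R -> R^o := cp X - (d / c * trace (cu X) 1) *: psi.

Definition riem1 X : R -> R^o := expw (m / 2) (cv X + wD (cu X)).
Definition riem2 X : R -> R^o := expw (- (m / 2)) (cv X - wD (cu X)).

(** The Riemann invariant [u_t + u_x] travels to the left and [u_t - u_x] to the
    right; the weights [e^{mx}] and [e^{-mx}] decrease along the motion, which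
    produces the decay of this energy at rate [m]. *)
Definition Vwave X : R := L2norm (riem1 X) ^+ 2 + L2norm (riem2 X) ^+ 2.

(** The quadratic form of the heat operator, with its boundary term at 0; it plays
    for data with [p] in H^1 the role of [|qst X|^2] in the energy space. *)
Definition Wheat X : R := L2norm (wD (qst X)) ^+ 2 + c * trace (qst X) 0 ^+ 2.

(** At [x = 1] the boundary condition gives [u_t + u_x = (1 - a) v + z] and
    [u_t - u_x = (1 + a) v - z] with [v = u_t(1)] and [z = b p(0)].  The cross terms are
    split by the squares of [(1 - a) v - 2 z] and [(1 + a) v - 3 z]; the hypothesis makes
    the remaining coefficient of [v^2] negative. *)
Lemma flux_bound (z v : R) : 3 * expR m * (1 - a) ^+ 2 <= expR (- m) * (1 + a) ^+ 2 ->
  expR m * ((1 - a) * v + z) ^+ 2 - expR (- m) * ((1 + a) * v - z) ^+ 2 <=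
  (3 * expR m + 2 * expR (- m)) * z ^+ 2 - expR (- m) * (1 + a) ^+ 2 / 6 * v ^+ 2.
Proof.
have := expR_gt0 m; have := expR_gt0 (- m).
move: (expR m) (expR (- m)) => E E' E'0 E0 h.
have h1 : 0 <= E * (((1 - a) * v - 2 * z) ^+ 2).
  by rewrite mulr_ge0 ?sqr_ge0// ltW.
have h2 : 0 <= E' * (((1 + a) * v - 3 * z) ^+ 2).
  by rewrite mulr_ge0 ?sqr_ge0// ltW.
have h3 : 3 * E * (1 - a) ^+ 2 * v ^+ 2 <= E' * (1 + a) ^+ 2 * v ^+ 2.
  by rewrite ler_wpM2r ?sqr_ge0.
lra.
Qed.

Lemma Vwave_lower X : 0 < m -> L2 (cv X) -> L2 (wD (cu X)) ->
  2 * (L2norm (cv X) ^+ 2 + L2norm (wD (cu X)) ^+ 2) <= expR m * Vwave X.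
Proof.
move=> m0 Lv Lux; have P := parallelogram Lv Lux.
have s2 : `|m / 2 + m / 2| <= m by rewrite -splitr ger0_norm// ltW.
have s2' : `|- (m / 2) + - (m / 2)| <= m by rewrite -opprD normrN.
have /andP[B1 _] := expw_norm s2 (L2D Lv Lux).
have /andP[B2 _] := expw_norm s2' (L2B Lv Lux).
rewrite -/(riem1 X) in B1; rewrite -/(riem2 X) in B2.
rewrite mulrDr -P -ler_pdivrMl ?expR_gt0// -expRN mulrDr addrC /Vwave.
exact: lerD B1 B2.
Qed.

Hypothesis c0 : 0 < c.

Section Domain.
Variable X : state R.
Hypothesis dX : domA a b c d X.

Let u := cu X.
Let v := cv X.
Let p := cp X.
Let u1 := trace u 1.
Let v1 := trace v 1.
Let q := qst X.
Let q0 := trace q 0.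
Let p0 := trace p 0.

Let hu : H1 u. Proof. by have [[[[]]]] := dX. Qed.
Let hux : H1 (wD u). Proof. by have [[[[]]]] := dX. Qed.
Let hv : H1 v. Proof. by have [[_ []]] := dX. Qed.
Let hp : H1 p. Proof. by have [[_ _ []]] := dX. Qed.
Let hpx : H1 (wD p). Proof. by have [[_ _ []]] := dX. Qed.
Let u0E : trace u 0 = 0. Proof. by have [[[_ []]]] := dX. Qed.
Let v0E : trace v 0 = 0. Proof. by have [[_ []]] := dX. Qed.

Lemma qst_H1 : [/\ H1 q, wD q = wD p - cst (d * u1) %[ae mu] &
  forall x, 0 <= x <= 1 -> trace q x = trace p x - d / c * u1 * (1 + c * x)].
Proof.
have [hs ws ts] := psi_H1.
have qE : q = (- (d / c * u1)) *: psi + p by rewrite /q /qst scaleNr addrC.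
split.
- by rewrite qE; exact: H1_lin.
- rewrite qE; apply: ae_sub (ae_and (wD_lin (- (d / c * u1)) hs hp) ws) => x [h1 h2] xT.
  rewrite h1// (_ : _ x = (- (d / c * u1)) * wD psi x + wD p x)// h2//.
  rewrite (_ : (wD p - _) x = wD p x - d * u1)// addrC /= mulNr; congr (_ - _).
  by rewrite mulrAC divfK// gt_eqF.
- by move=> x x01; rewrite qE trace_lin// ts// mulNr addrC.
Qed.

(** The heat operator is, on the domain, the symmetric form whose quadratic form
    is [Wheat]; the test function need not satisfy the boundary conditions. *)
Lemma heat_form f : H1 f ->
  ip f (wD (wD p)) = - (ip (wD f) (wD q) + c * trace f 0 * q0).
Proof.
move=> hf; have [hq wq tq] := qst_H1.
have [_ [_ bp0 bp1]] := dX.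
have Lf := H1_L2 hf; have Lfx := L2_wD hf; have Lpx := L2_wD hp; have L1 := @L2_cst R 1.
have Lqx := L2_wD hq.
have := H1_ibp hf hpx.
have -> : ip (wD f) (wD p) = ip (wD f) (wD q) + d * u1 * (trace f 1 - trace f 0).
  have -> : trace f 1 - trace f 0 = ip (wD f) (cst 1).
    by rewrite (H1_trace1 hf) addrC addKr ipC.
  rewrite -ipZr// -ipDr//; last exact: L2Z.
  apply: ae_ipr => //; first by apply: L2D => //; exact: L2Z.
  apply: ae_sub wq => x h xT.
  rewrite (_ : (wD q + _) x = wD q x + d * u1 * 1)// h//.
  by rewrite (_ : (wD p - _) x = wD p x - d * u1)// mulr1 subrK.
have q0E : q0 = p0 - d / c * u1.
  by rewrite /q0 tq ?lexx ?ler01// mulr0 addr0 mulr1.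
rewrite [trace (wD p) 0]bp0 [trace (wD p) 1]bp1 -/u -/u1 -/p -/p0.
have -> : c * p0 = c * q0 + d * u1.
  by rewrite q0E; field; rewrite gt_eqF.
move: (ip f _) (ip _ (wD q)) (trace f 1) (trace f 0) q0 u1 => A B f1 f0 x y; lra.
Qed.

Lemma heat_ip : ip q (wD (wD p)) = - Wheat X.
Proof.
have [hq _ _] := qst_H1.
by rewrite (heat_form hq) -L2norm_sqr -mulrA -expr2.
Qed.

Lemma Wheat_ge0 : 0 <= Wheat X.
Proof. by rewrite /Wheat addr_ge0 ?sqr_ge0// mulr_ge0 ?sqr_ge0// ltW. Qed.

Lemma q0_le_Wheat : q0 ^+ 2 <= Wheat X / c.
Proof.
by rewrite ler_pdivlMr// mulrC /Wheat -/q -/q0 lerDr sqr_ge0.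
Qed.

Lemma qst_le_Wheat : L2norm q ^+ 2 <= 2 * (1 / c + 1) * Wheat X.
Proof.
have [hq wq tq] := qst_H1.
have P := poincare hq.
apply: (@le_trans _ _ ((`|q0| + L2norm (wD q)) ^+ 2)).
  by rewrite lerXn2r ?nnegrE ?addr_ge0 ?L2norm_ge0.
have := q0_le_Wheat; rewrite -(real_normK (num_real q0)).
have : L2norm (wD q) ^+ 2 <= Wheat X.
  by rewrite /Wheat lerDl mulr_ge0 ?sqr_ge0// ltW.
have -> : 2 * (1 / c + 1) * Wheat X = 2 * (Wheat X / c) + 2 * Wheat X by ring.
move: (Wheat X / c) (Wheat X) (L2norm _) (`|q0|) => A B x y h1 h2.
have := sqr_ge0 (x - y); lra.
Qed.

(** Coercivity of the heat operator: [Wheat = - <q, p_xx>] is at most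
    [|q| |p_xx|], while [|q|^2] is a multiple of [Wheat] by Poincare's inequality. *)
Lemma Wheat_le_pxx : Wheat X <= 2 * (1 / c + 1) * L2norm (wD (wD p)) ^+ 2.
Proof.
have [hq wq tq] := qst_H1.
have Lq := H1_L2 hq; have Lpxx := L2_wD hpx.
have CS := cauchy_schwarz Lq Lpxx; rewrite heat_ip normrN ger0_norm ?Wheat_ge0// in CS.
have [w0|w0] := eqVneq (Wheat X) 0.
  by rewrite w0 mulr_ge0 ?sqr_ge0// mulr_ge0// addr_ge0// divr_ge0// ltW.
have W0 : 0 < Wheat X by rewrite lt_neqAle eq_sym w0 Wheat_ge0.
rewrite -(ler_pM2l W0); apply: (@le_trans _ _ ((L2norm q * L2norm (wD (wD p))) ^+ 2)).
  rewrite -expr2 lerXn2r ?nnegrE ?mulr_ge0 ?L2norm_ge0//; exact: Wheat_ge0.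
rewrite exprMn; apply: (le_trans (ler_wpM2r (sqr_ge0 _) qst_le_Wheat)).
by rewrite le_eqVlt; apply/orP; left; apply/eqP; ring.
Qed.

Let hr : H1 (v + wD u).
Proof. by rewrite -[v]scale1r; exact: H1_lin. Qed.
Let hs : H1 (v - wD u).
Proof. by rewrite addrC -scaleN1r; exact: H1_lin. Qed.

Let wr : wD (v + wD u) = wD v + wD (wD u) %[ae mu].
Proof. by have := wD_lin 1 hv hux; rewrite !scale1r. Qed.
Let ws : wD (v - wD u) = wD v - wD (wD u) %[ae mu].
Proof. by have := wD_lin (-1) hux hv; rewrite !scaleN1r ![- _ + _]addrC. Qed.

Let tr x : 0 <= x <= 1 -> trace (v + wD u) x = trace v x + trace (wD u) x.
Proof. by move=> x01; have := trace_lin 1 hv hux x01; rewrite scale1r mul1r. Qed.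
Let ts x : 0 <= x <= 1 -> trace (v - wD u) x = trace v x - trace (wD u) x.
Proof.
by move=> x01; have := trace_lin (-1) hux hv x01; rewrite scaleN1r mulN1r ![- _ + _]addrC.
Qed.

Lemma u1_le_Vwave : 0 < m -> u1 ^+ 2 <= expR m / 2 * Vwave X.
Proof.
move=> m0; have := Vwave_lower m0 (H1_L2 hv) (L2_wD hu).
have : u1 ^+ 2 <= L2norm (wD u) ^+ 2.
  rewrite -(real_normK (num_real u1)) lerXn2r ?nnegrE ?L2norm_ge0//.
  by rewrite /u1 H1_trace ?ler01 ?lexx// u0E add0r; exact: prim_bound (L2_wD hu).
have := sqr_ge0 (L2norm v); rewrite -/u -/v.
move: (u1 ^+ 2) (L2norm v ^+ 2) (L2norm (wD u) ^+ 2) (expR m) (Vwave X) => *; lra.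
Qed.

(** The flux at [x = 1] is absorbed by the
    damping [a], except for the coupling term [b p(0) = b q(0) + (b d / c) u(1)].
    The size of [b d / c] lets half of the interior damping absorb the part with
    [u(1)]; the part with [q(0)] is left to the heat dissipation. *)
Lemma wave_dissipation (F : R) : 0 < m ->
  3 * expR m * (1 - a) ^+ 2 <= expR (- m) * (1 + a) ^+ 2 ->
  F = 6 * expR m + 4 * expR (- m) ->
  (b * d / c) ^+ 2 <= m * expR (- m) * F^-1 ->
  2 * ip (riem1 X) (riem1 (opA eps X)) + 2 * ip (riem2 X) (riem2 (opA eps X)) <=
  - (m / 2) * Vwave X + F * b ^+ 2 * q0 ^+ 2 - expR (- m) * (1 + a) ^+ 2 / 6 * v1 ^+ 2.
Proof.
move=> m0 ha FE hb.
have Lr := H1_L2 hr; have Ls := H1_L2 hs.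
have Lvx := L2_wD hv; have Luxx := L2_wD hux.
have E1 : 2 * ip (riem1 X) (riem1 (opA eps X)) =
   expR m * trace (v + wD u) 1 ^+ 2 - trace (v + wD u) 0 ^+ 2 - m * L2norm (riem1 X) ^+ 2.
  rewrite /riem1 -expwC expw_expw -splitr -/v -/u -ip_expw -expw_flux//.
  congr (2 * _); apply: ae_ipr.
  - by apply: L2D => //; exact: L2_wD.
  - exact: L2_wD.
  - exact: L2_expw.
  - by apply: ae_sub wr => x h xT; rewrite h// addrC.
have E2 : 2 * ip (riem2 X) (riem2 (opA eps X)) =
   - (expR (- m) * trace (v - wD u) 1 ^+ 2 - trace (v - wD u) 0 ^+ 2) - m * L2norm (riem2 X) ^+ 2.
  rewrite /riem2 -expwC expw_expw -opprD -splitr -/v -/u -[- (m / 2)]mulNr -ip_expw.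
  have F1 := expw_flux (- m) hs.
  have -> : ip (expw (- m) (v - wD u)) (cv (opA eps X) - wD (cu (opA eps X))) =
     - ip (expw (- m) (v - wD u)) (wD (v - wD u)).
    rewrite -ipNr; [|exact: L2_wD|exact: L2_expw]; apply: ae_ipr.
    - by apply: L2B => //; exact: L2_wD.
    - by rewrite -scaleN1r; apply: L2Z; exact: L2_wD.
    - exact: L2_expw.
    - apply: ae_sub ws => x h xT.
      rewrite (_ : (- wD (v - wD u)) x = - (wD (v - wD u) x))// h//.
      by rewrite (_ : (wD v - wD (wD u)) x = wD v x - wD (wD u) x)// opprB.
  move: F1; move: (ip _ _) (ip (expw _ _) (v - _)) (trace _ _) (trace _ 0) => x y z t; lra.
have [_ [bu1 _ _]] := dX.
have t1 : (0 : R) <= (1 : R) <= 1 by apply/andP; split.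
have t0 : (0 : R) <= (0 : R) <= 1 by apply/andP; split.
have [hq wq tq] := qst_H1.
have q0E : q0 = p0 - d / c * u1 by rewrite /q0 tq// mulr0 addr0 mulr1.
have FB := flux_bound (b * p0) v1 ha.
have U := u1_le_Vwave m0.
rewrite E1 E2 !tr// !ts// v0E [trace (wD u) 1]bu1 -/u -/v -/p -/p0 -/v1.
have F0 : 0 < F by rewrite FE addr_gt0// mulr_gt0// expR_gt0.
have Z : F / 2 * (b * p0) ^+ 2 <= F * b ^+ 2 * q0 ^+ 2 + m / 2 * Vwave X.
  have B : F * (b * d / c) ^+ 2 * u1 ^+ 2 <= m / 2 * Vwave X.
    apply: (@le_trans _ _ (m * expR (- m) * u1 ^+ 2)).
      by rewrite ler_wpM2r ?sqr_ge0// mulrC -ler_pdivlMr.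
    apply: (@le_trans _ _ (m * expR (- m) * (expR m / 2 * Vwave X))).
      by rewrite ler_wpM2l// mulr_ge0 ?expR_ge0// ltW.
    have e1 : expR (- m) * expR m = 1 by rewrite expRN mulVf// gt_eqF// expR_gt0.
    rewrite le_eqVlt; apply/orP; left; apply/eqP.
    transitivity (m * (expR (- m) * expR m) / 2 * Vwave X); first by ring.
    by rewrite e1 mulr1.
  have -> : b * p0 = b * q0 + b * d / c * u1 by rewrite q0E; field; rewrite gt_eqF.
  apply: le_trans (lerD (lexx (F * b ^+ 2 * q0 ^+ 2)) B).
  move: (b * d / c) u1 q0 => x y z.
  have := mulr_ge0 (ltW F0) (sqr_ge0 (b * z - x * y)); lra.
rewrite /Vwave in Z *.
move: FB Z; rewrite FE.
move: (expR m) (expR (- m)) (L2norm _) (L2norm (riem2 X)) (trace (wD u) 0) => e e' x y z.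
move: v1 p0 => v1' p0' FB Z; lra.
Qed.

Let de := expR (- m) * (1 + a) ^+ 2 / 6.
Let K1 := (d / c) ^+ 2 * L2norm psi ^+ 2 / de.

Let de0 : 0 < 1 + a -> 0 < de.
Proof. by move=> a1; rewrite divr_gt0// mulr_gt0 ?expR_gt0// exprn_gt0. Qed.

(** The quasi-stationary profile moves with speed proportional to [u_t(1)]; the
    boundary damping left over in [wave_dissipation] pays for it. *)
Let cross f : 0 < 1 + a -> L2 f ->
  `|2 * (d / c * v1 * ip f psi)| <= de * v1 ^+ 2 + K1 * L2norm f ^+ 2.
Proof.
move=> a1 Lf; have [Lp _ _] := psi_H1; have CS := cauchy_schwarz Lf (H1_L2 Lp).
have {}CS : ip f psi ^+ 2 <= L2norm f ^+ 2 * L2norm psi ^+ 2.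
  rewrite -(real_normK (num_real (ip f psi))) -exprMn.
  by rewrite lerXn2r ?nnegrE ?mulr_ge0 ?L2norm_ge0.
have D0 := de0 a1; rewrite /K1.
have -> : (d / c) ^+ 2 * L2norm psi ^+ 2 / de * L2norm f ^+ 2 =
   (d / c) ^+ 2 * (L2norm f ^+ 2 * L2norm psi ^+ 2) / de by ring.
have := ler_wpM2l (sqr_ge0 (d / c)) CS.
move: (L2norm f ^+ 2 * L2norm psi ^+ 2) (ip f psi) (d / c) => A B k.
move: de D0 v1 => D D0 y h.
have key (s : R) : s ^+ 2 = 1 -> 2 * (k * y * (s * B)) <= D * y ^+ 2 + k ^+ 2 * A / D.
  move=> s1; rewrite -subr_ge0 -(pmulr_rge0 _ D0).
  have -> : D * (D * y ^+ 2 + k ^+ 2 * A / D - 2 * (k * y * (s * B))) =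
     (D * y - k * (s * B)) ^+ 2 + (k ^+ 2 * A - k ^+ 2 * (s ^+ 2 * B ^+ 2)).
    by field; rewrite gt_eqF.
  by rewrite s1 mul1r addr_ge0 ?sqr_ge0// subr_ge0.
rewrite ler_norml; apply/andP; split.
  have := key (-1); rewrite sqrrN expr1n mulN1r mulrN => /(_ erefl); lra.
by have := key 1; rewrite expr1n mul1r; exact.
Qed.

Variable F : R.
Hypotheses (m0 : 0 < m) (a1 : 0 < 1 + a)
  (ha : 3 * expR m * (1 - a) ^+ 2 <= expR (- m) * (1 + a) ^+ 2)
  (FE : F = 6 * expR m + 4 * expR (- m))
  (hb : (b * d / c) ^+ 2 <= m * expR (- m) * F^-1).

Let F0 : 0 < F. Proof. by rewrite FE addr_gt0// mulr_gt0// expR_gt0. Qed.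

Let Fb0 : 0 <= F * b ^+ 2. Proof. exact: (mulr_ge0 (ltW F0) (sqr_ge0 b)). Qed.

Let K10 : 0 <= K1.
Proof. by rewrite divr_ge0 ?(ltW (de0 a1))// mulr_ge0// sqr_ge0. Qed.

Let ip_qst f : L2 f -> ip f (qst (opA eps X)) =
  eps^-1 * ip f (wD (wD p)) - d / c * v1 * ip f psi.
Proof.
move=> Lf; have [Lp _ _] := psi_H1; have Lpxx := L2_wD hpx.
by rewrite /qst ipBr ?ipZr//; [exact: H1_L2|apply: L2Z|apply: L2Z; exact: H1_L2].
Qed.

(** The heat dissipation carries the factor [1/eps]; when [eps] is small it absorbs
    both the boundary value [q(0)] and the motion of the quasi-stationary profile. *)
Lemma energy_L2 : (F * b ^+ 2 + 2 * K1 + m) * (1 / c + 1) <= 2 / eps ->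
  2 * ip (riem1 X) (riem1 (opA eps X)) + 2 * ip (riem2 X) (riem2 (opA eps X)) +
  2 * ip (qst X) (qst (opA eps X)) <= - (m / 2) * (Vwave X + L2norm (qst X) ^+ 2).
Proof.
move=> he; have [hq _ _] := qst_H1; have Lq := H1_L2 hq.
have wd := wave_dissipation m0 ha FE hb.
have := cross a1 Lq; rewrite ler_norml => /andP[cr _].
rewrite (ip_qst Lq) heat_ip.
have Q := qst_le_Wheat; have W0 := Wheat_ge0; have q0W := q0_le_Wheat.
rewrite -/q in Q cr *.
have P1 : F * b ^+ 2 * q0 ^+ 2 <= F * b ^+ 2 * (1 / c + 1) * Wheat X.
  rewrite -[leRHS]mulrA ler_wpM2l//.
  apply: (le_trans q0W).
  have -> : (1 / c + 1) * Wheat X = Wheat X / c + Wheat X by ring.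
  by rewrite lerDl.
have P2 : (K1 + m / 2) * L2norm q ^+ 2 <= (2 * K1 + m) * (1 / c + 1) * Wheat X.
  have -> : (2 * K1 + m) * (1 / c + 1) * Wheat X = (K1 + m / 2) * (2 * (1 / c + 1) * Wheat X).
    by field; rewrite gt_eqF.
  by rewrite ler_wpM2l// addr_ge0// divr_ge0// ltW.
have P3 := ler_wpM2r W0 he.
move: wd cr P1 P2 P3; rewrite -/de.
move: (Vwave X) (Wheat X) (L2norm q) (ip q psi) (ip (riem1 X) _) (ip (riem2 X) _) => V W n i r1 r2.
move: (F * b ^+ 2) (1 / c + 1) (d / c) => G C k.
move: de K1 v1 q0 eps^-1 => D K y z e.
lra.
Qed.

(** One derivative higher than [energy_L2]: the dissipated quantity is now
    [|p_xx|^2 / eps], which dominates [Wheat] by [Wheat_le_pxx]. *)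
Lemma energy_H1 : (F * b ^+ 2 / c + m / 2) * (2 * (1 / c + 1)) + K1 <= 2 / eps ->
  2 * ip (riem1 X) (riem1 (opA eps X)) + 2 * ip (riem2 X) (riem2 (opA eps X)) -
  2 * ip (wD (wD p)) (qst (opA eps X)) <= - (m / 2) * (Vwave X + Wheat X).
Proof.
move=> he; have Lpxx := L2_wD hpx.
have wd := wave_dissipation m0 ha FE hb.
have := cross a1 Lpxx; rewrite ler_norml => /andP[_ cr].
rewrite (ip_qst Lpxx) -L2norm_sqr.
have Q := Wheat_le_pxx; have W0 := Wheat_ge0; have q0W := q0_le_Wheat.
have P1 : F * b ^+ 2 * q0 ^+ 2 <= F * b ^+ 2 / c * Wheat X.
  have -> : F * b ^+ 2 / c * Wheat X = F * b ^+ 2 * (Wheat X / c) by ring.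
  by rewrite ler_wpM2l.
have P2 : (F * b ^+ 2 / c + m / 2) * Wheat X <=
    (F * b ^+ 2 / c + m / 2) * (2 * (1 / c + 1)) * L2norm (wD (wD p)) ^+ 2.
  rewrite -[leRHS]mulrA ler_wpM2l// addr_ge0// divr_ge0//; exact: ltW.
have P3 := ler_wpM2r (sqr_ge0 (L2norm (wD (wD p)))) he.
move: wd cr P1 P2 P3; rewrite -/de.
move: (Vwave X) (Wheat X) (L2norm _) (ip _ psi) (ip (riem1 X) _) (ip (riem2 X) _) => V W n i r1 r2.
move: (F * b ^+ 2 / c) (F * b ^+ 2) (1 / c + 1) (d / c) => G G' C k.
move: de K1 v1 q0 eps^-1 => D K y z e.
lra.
Qed.

End Domain.
End Generator.

(** * Differentiability of curves and Riemann integrals *)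

Section OneSidedCalculus.
Context {R : realType}.

(** Differentiability of a curve relative to the half-line [0, +oo[, for an
    arbitrary function [N] measuring the size of the error. *)
Definition der (V : lmodType R) (N : V -> R) (f : R -> V) (t : R) (g : V) :=
  forall e, 0 < e -> exists2 de : R, 0 < de & forall s, 0 <= s -> `|s - t| < de ->
    N (f s - f t - (s - t) *: g) <= e * `|s - t|.

Implicit Types (f df : R -> R) (k t h : R).

Lemma der_is_derive f t L : 0 < t -> der (fun x : R^o => `|x|) f t L ->
  is_derive t 1 (f : R -> R^o) L.
Proof.
move=> t0 D.
have lim : (fun s => s^-1 *: (f (s *: (1 : R^o) + t) - f t : R^o)) @ 0^' --> (L : R^o).
  apply/cvgrPdist_le => e e0; have [de de0 hde] := D _ e0.
  near=> s.
  have s0 : s != 0 by near: s; exact: nbhs_dnbhs_neq.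
  have st : `|s| < Num.min de t.
    near: s; apply: dnbhs0_lt; rewrite lt_min de0; exact: t0.
  have e1 : s *: (1 : R^o) + t - t = s by rewrite addrK [_ *: _]mulr1.
  move: st; rewrite lt_min => /andP[sd st].
  have p : 0 <= s *: (1 : R^o) + t.
    by rewrite [_ *: _]mulr1; move: st; rewrite ltr_norml => /andP[]; lra.
  have := hde _ p; rewrite e1 => /(_ sd) h.
  set A := f _ - f t in h *.
  have -> : L - s^-1 *: (A : R^o) = - s^-1 * (A - s *: (L : R^o)).
    by rewrite /GRing.scale/=; field.
  by rewrite normrM normrN normfV ler_pdivrMl ?normr_gt0// mulrC.
apply: DeriveDef; first by apply/cvg_ex; exists L.
by apply/cvg_lim.
Unshelve. all: by end_near. Qed.

Lemma der_cvg0 f L : der (fun x : R^o => `|x|) f 0 L -> f x @[x --> 0^'+] --> f 0.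
Proof.
move=> D; apply/cvgrPdist_le => e e0; have [de de0 hde] := D 1 ltr01.
near=> s.
have s0 : 0 < s by near: s; exact: nbhs_right_gt.
have sd : s < de by near: s; exact: nbhs_right_lt.
have sL : s < e / (1 + `|L|).
  by near: s; apply: nbhs_right_lt; rewrite divr_gt0// ltr_pwDl.
have := hde s (ltW s0); rewrite subr0 gtr0_norm// mul1r => /(_ sd) h.
have L0 : 0 < 1 + `|L| by rewrite ltr_pwDl.
have sL' : s * (1 + `|L|) <= e by rewrite -ler_pdivlMr// ltW.
rewrite distrC (_ : f s - f 0 = (f s - f 0 - s *: (L : R^o)) + s * L); last by rewrite subrK.
apply: (le_trans (ler_normD _ _)); rewrite normrM (gtr0_norm s0).
by apply: le_trans sL'; rewrite mulrDr mulr1 lerD2r.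
Unshelve. all: by end_near. Qed.

Lemma der_MVT f df h : 0 < h -> (forall t, 0 <= t -> der (fun x : R^o => `|x|) f t (df t)) ->
  exists2 x, 0 < x < h & f h - f 0 = df x * h.
Proof.
move=> h0 D.
have id t : 0 < t -> is_derive t 1 (f : R -> R^o) (df t).
  by move=> t0; apply: der_is_derive => //; apply: D; exact: ltW.
have ct t : 0 < t -> {for t, continuous f}.
  by move=> t0; apply: differentiable_continuous; apply/derivable1_diffP; have [] := id t t0.
have [x||x xh E] := @MVT R f df 0 h h0.
- by rewrite in_itv/= => /andP[x0 _]; exact: id.
- apply/(continuous_within_itvP _ h0); split.
  + by move=> x; rewrite in_itv/= => /andP[x0 _]; exact: ct.
  + exact: (der_cvg0 (D 0 (lexx 0))).
  + by apply: cvg_at_left_filter; exact: ct.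
- by exists x; [move: xh; rewrite in_itv|rewrite E subr0].
Qed.

Lemma gronwall f df k : (forall t, 0 <= t -> der (fun x : R^o => `|x|) f t (df t)) ->
  (forall t, 0 <= t -> df t <= - k * f t) ->
  forall t, 0 <= t -> f t <= expR (- k * t) * f 0.
Proof.
move=> D H t; rewrite le_eqVlt => /predU1P[<-|t0]; first by rewrite mulr0 expR0 mul1r.
pose g x := expR (k * x) * f x.
have id (x : R) : 0 < x -> is_derive x 1 (g : R -> R^o) (expR (k * x) * (k * f x + df x)).
  move=> x0; have h1 : is_derive x 1 (f : R -> R^o) (df x).
    by apply: der_is_derive => //; apply: D; exact: ltW.
  have h0 : is_derive x (1 : R) (fun y : R => k * y) k.
    by apply: (@is_derive_quad _ _ _ _ 0) => y; rewrite -mulrBr subrr normr0 mul0r.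
  have h2 := is_derive1_comp (is_derive_expR (k * x)) h0.
  apply: (@is_derive_eq _ _ _ _ _ _ _ _ (is_deriveM h2 h1)).
  by rewrite /GRing.scale/=; ring.
have ct (x : R) : 0 < x -> {for x, continuous g}.
  by move=> x0; apply: differentiable_continuous; apply/derivable1_diffP; have [] := id x x0.
have [x||x xt E] := @MVT R g (fun x => expR (k * x) * (k * f x + df x)) 0 t t0.
- by rewrite in_itv/= => /andP[x0 _]; exact: id.
- apply/(continuous_within_itvP _ t0); split.
  + by move=> x; rewrite in_itv/= => /andP[x0 _]; exact: ct.
  + apply: (@cvgM _ R); last exact: (der_cvg0 (D 0 (lexx 0))).
    by apply: cvg_at_right_filter; exact: expw_continuous.
  + by apply: cvg_at_left_filter; exact: ct.
have gt0 : g t <= g 0.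
  rewrite -subr_le0 E subr0 pmulr_lle0// pmulr_rle0 ?expR_gt0//.
  move: xt; rewrite in_itv/= => /andP[x0 _].
  by have := H x (ltW x0); lra.
move: gt0; rewrite /g mulr0 expR0 mul1r => gt0.
by rewrite mulNr expRN ler_pdivlMl ?expR_gt0.
Qed.

End OneSidedCalculus.

(** The norms of states obey the axioms of a seminorm only on the elements of finite
    norm, whence the restriction to a subspace [D]. *)
Definition seminorm_on (R : realType) (V : lmodType R) (D : V -> Prop) (N : V -> R) :=
  [/\ D 0, forall a x y, D x -> D y -> D (a *: x + y),
      forall x y, D x -> D y -> N (x + y) <= N x + N y &
      forall a x, D x -> N (a *: x) = `|a| * N x].

Section SeminormedCurves.
Context {R : realType} {V : lmodType R} (D : V -> Prop) (N : V -> R).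
Hypothesis DN : seminorm_on D N.
Implicit Types (x y z : V) (a e t : R).

Lemma sn_Z a x : D x -> D (a *: x).
Proof. by have [h0 hl _ _] := DN => dx; rewrite -[_ *: _]addr0; exact: hl. Qed.

Lemma sn_D x y : D x -> D y -> D (x + y).
Proof. by have [_ hl _ _] := DN => dx dy; rewrite -[x]scale1r; exact: hl. Qed.

Lemma sn_B x y : D x -> D y -> D (x - y).
Proof. by move=> dx dy; rewrite -scaleN1r; apply: sn_D => //; exact: sn_Z. Qed.

Lemma sn_N0 : N 0 = 0.
Proof. by have [h0 _ _ hs] := DN; rewrite -(scale0r 0) hs// normr0 mul0r. Qed.

Lemma sn_BN x y : D x -> D y -> N (x - y) <= N x + N y.
Proof.
have [_ _ ht hs] := DN => dx dy.
have := ht x (- 1 *: y) dx (sn_Z _ dy).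
by rewrite hs// normrN1 mul1r scaleN1r.
Qed.

Lemma sn_dist x y z : D x -> D y -> D z -> N (x - z) <= N (x - y) + N (y - z).
Proof.
have [_ _ ht _] := DN => dx dy dz.
by have := ht (x - y) (y - z) (sn_B dx dy) (sn_B dy dz); rewrite addrA subrK.
Qed.

Lemma sn_sum n (F : 'I_n -> V) e : (forall i, D (F i)) -> (forall i, N (F i) <= e) ->
  D (\sum_(i < n) F i) /\ N (\sum_(i < n) F i) <= n%:R * e.
Proof.
have [h0 _ ht _] := DN.
elim: n F => [|n ih] F dF NF; first by rewrite big_ord0 sn_N0 mul0r.
rewrite big_ord_recr/=; have [d1 n1] := ih _ (fun i => dF (widen_ord (leqnSn n) i))
  (fun i => NF (widen_ord (leqnSn n) i)).
split; first exact: sn_D.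
by apply: (le_trans (ht _ _ _ _)) => //; rewrite -natr1 mulrDl mul1r lerD.
Qed.

(** Refining a partition of [0,t] by one of [t,t'] splits the Riemann sum, so
    the increment of the integral is controlled by the values of the curve on
    [t,t'] alone. *)
Lemma Riemann_increment (Y : R -> V) t t' I I' z e :
  0 <= t -> t <= t' -> (forall s, 0 <= s -> D (Y s)) -> D I -> D I' -> D z ->
  is_Riemann_integral N Y t I -> is_Riemann_integral N Y t' I' ->
  (forall s, t <= s <= t' -> N (Y s - z) <= e) ->
  N (I' - I - (t' - t) *: z) <= (t' - t) * e.
Proof.
have [h0 hl ht hs] := DN.
move=> t0 tt' dY dI dI' dz RI RI' Yz.
apply/ler_addgt0Pr => e0 e00.
have e2 : 0 < e0 / 2 by lra.
have [d1 d10 H1] := RI _ e2; have [d2 d20 H2] := RI' _ e2.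
pose d := Num.min d1 d2; have d0 : 0 < d by rewrite lt_min d10.
pose n := (Num.bound (t' / d)).+1.
have n0 : 0 < n%:R :> R by rewrite ltr0n.
have nd : t' / n%:R < d.
  rewrite ltr_pdivrMr// mulrC -ltr_pdivrMr//.
  apply: (lt_trans (archi_boundP _)); last by rewrite ltr_nat.
  by rewrite divr_ge0 ?(ltW d0)// (le_trans t0).
pose p k := if (k <= n)%N then k%:R * (t / n%:R) else t + (k - n)%:R * ((t' - t) / n%:R).
have pl k : (k <= n)%N -> p k = k%:R * (t / n%:R) by rewrite /p => ->.
have pr k : p (n + k)%N = t + k%:R * ((t' - t) / n%:R).
  rewrite /p addKn; case: k => [|k]; last by rewrite addnS ltnNge leq_addr.
  by rewrite addn0 leqnn mulrC divfK ?gt_eqF// mul0r addr0.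
have p0 : p 0%N = 0 by rewrite pl// mul0r.
have pn : p n = t by have := pr 0%N; rewrite addn0 mul0r addr0.
have pnn : p (n + n)%N = t' by rewrite pr mulrC divfK ?gt_eqF// addrC subrK.
have dl k : (k < n)%N -> p k.+1 - p k = t / n%:R.
  by move=> kn; rewrite (pl _ kn) (pl _ (ltnW kn)) -mulrBl -natrB// subSnn mul1r.
have dr k : p (n + k).+1 - p (n + k)%N = (t' - t) / n%:R.
  by rewrite -addnS !pr -natr1 mulrDl mul1r opprD addrACA subrr add0r addrAC subrr add0r.
have mesh k : (k < n + n)%N -> 0 <= p k.+1 - p k < d.
  move=> kn; have [k1|k1] := ltnP k n.
    rewrite dl// divr_ge0 ?(ltW n0)//= (le_lt_trans _ nd)//.
    by rewrite ler_pM2r ?invr_gt0.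
  rewrite -(subnKC k1) dr divr_ge0 ?subr_ge0 ?(ltW n0)//= (le_lt_trans _ nd)//.
  by rewrite ler_pM2r ?invr_gt0// lerBlDr lerDl.
have K1 := H1 n p p p0 pn; have K2 := H2 (n + n)%N p p p0 pnn.
have {}K1 : N (\sum_(k < n) (p k.+1 - p k) *: Y (p k) - I) < e0 / 2.
  apply: K1 => k kn; have /andP[m1 m2] := mesh k (ltn_addr _ kn).
  by rewrite lexx -subr_ge0 m1/= (lt_le_trans m2)// ge_min lexx.
have {}K2 : N (\sum_(k < n + n) (p k.+1 - p k) *: Y (p k) - I') < e0 / 2.
  apply: K2 => k kn; have /andP[m1 m2] := mesh k kn.
  by rewrite lexx -subr_ge0 m1/= (lt_le_trans m2)// ge_min lexx orbT.
have pk0 k : (k <= n + n)%N -> 0 <= p k.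
  elim: k => [|k ih] kn; first by rewrite p0.
  by have /andP[m1 _] := mesh k kn; have := ih (ltnW kn); lra.
rewrite big_split_ord/= in K2.
set S1 := \sum_(k < n) _ in K1 K2; set S2 := (X in _ + X - _) in K2.
have dS1 : D S1.
  have [] // := @sn_sum _ (fun k : 'I_n => (p k.+1 - p k) *: Y (p k))
    (\big[Num.max/0]_(k < n) N ((p k.+1 - p k) *: Y (p k))).
  - by move=> k; apply: sn_Z; apply: dY; apply: pk0; rewrite (leq_trans (ltnW (ltn_ord k)))// leq_addr.
  - by move=> k; exact: (le_bigmax _ (fun k : 'I_n => N ((p k.+1 - p k) *: Y (p k)))).
have S2E : S2 - (t' - t) *: z = \sum_(k < n) ((t' - t) / n%:R) *: (Y (p (n + k)%N) - z).
  rewrite [RHS](eq_bigr (fun k : 'I_n => ((t' - t) / n%:R) *: Y (p (n + k)%N) -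
    ((t' - t) / n%:R) *: z)); last by move=> k _; rewrite scalerBr.
  rewrite sumrB sumr_const card_ord -(scaler_nat n (_ *: z)) scalerA (mulrC n%:R) divfK ?gt_eqF//.
  by congr (_ - _); apply: eq_bigr => k _; rewrite dr.
have [dS2 NS2] : D (S2 - (t' - t) *: z) /\ N (S2 - (t' - t) *: z) <= (t' - t) * e.
  rewrite S2E; have tn : 0 <= (t' - t) / n%:R by rewrite divr_ge0 ?subr_ge0 ?(ltW n0).
  have dk (k : 'I_n) : D (Y (p (n + k)%N) - z).
    by apply: sn_B => //; apply: dY; apply: pk0; rewrite leq_add2l ltnW.
  have Nk (k : 'I_n) : N (((t' - t) / n%:R) *: (Y (p (n + k)%N) - z)) <= (t' - t) / n%:R * e.
    rewrite hs// ger0_norm// ler_wpM2l//; apply: Yz; rewrite pr.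
    have kn : k%:R <= n%:R :> R by rewrite ler_nat ltnW.
    rewrite lerDl mulr_ge0//= -lerBrDl.
    by rewrite mulrA ler_pdivrMr// mulrC ler_wpM2l// subr_ge0.
  have [dd nn] := sn_sum (fun k => sn_Z _ (dk k)) Nk.
  split; first exact: dd.
  by apply: (le_trans nn); rewrite mulrA [n%:R * _]mulrC divfK ?gt_eqF.
have dS2' : D S2 by rewrite -[S2](subrK ((t' - t) *: z)); apply: sn_D => //; exact: sn_Z.
have -> : I' - I - (t' - t) *: z = (S2 - (t' - t) *: z) + ((S1 - I) - (S1 + S2 - I')).
  rewrite (opprB _ I') opprD [RHS](AC (2*(2*(1*2))) ((5*4*2)*((3*6)*(1*7)))).
  by rewrite /= !subrr !addr0.
apply: (le_trans (ht _ _ dS2 _)).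
  by apply: sn_B; apply: sn_B => //; exact: sn_D.
apply: lerD => //; apply: (le_trans (sn_BN _ _)); [exact: sn_B|by apply: sn_B => //; exact: sn_D|].
by have := ltW K1; have := ltW K2; lra.
Qed.

End SeminormedCurves.

(** * The energy space *)

Section StateSpace.
Context {R : realType}.
Notation mu := (@leb01 R).
Notation N := (@norm_H1L2L2 R).
Implicit Types (X : state R) (f g u w : R -> R^o) (k : R).

Lemma H1_0 : H1 (0 : R -> R^o). Proof. exact: (H1_cst 0). Qed.

Lemma trace_0 x : 0 <= x <= 1 -> trace (0 : R -> R^o) x = 0.
Proof.
move=> x01; have := trace_lin 1 H1_0 H1_0 x01; rewrite scale1r addr0 mul1r.
by move: (trace _ _) => y; lra.
Qed.

Lemma H1norm_ge0 u : 0 <= H1norm u. Proof. exact: sqrtr_ge0. Qed.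

Lemma minkowski2 (x y x' y' : R) : 0 <= x -> 0 <= y -> 0 <= x' -> 0 <= y' ->
  Num.sqrt ((x + x') ^+ 2 + (y + y') ^+ 2) <=
  Num.sqrt (x ^+ 2 + y ^+ 2) + Num.sqrt (x' ^+ 2 + y' ^+ 2).
Proof.
move=> x0 y0 x0' y0'.
have q1 := sqr_sqrtr (addr_ge0 (sqr_ge0 x) (sqr_ge0 y)).
have q2 := sqr_sqrtr (addr_ge0 (sqr_ge0 x') (sqr_ge0 y')).
have s1 := sqrtr_ge0 (x ^+ 2 + y ^+ 2); have s2 := sqrtr_ge0 (x' ^+ 2 + y' ^+ 2).
rewrite -ler_sqr ?nnegrE ?addr_ge0 ?sqrtr_ge0// sqr_sqrtr ?addr_ge0 ?sqr_ge0//.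
move: q1 q2 s1 s2; move: (Num.sqrt _) (Num.sqrt (x' ^+ 2 + y' ^+ 2)) => s s' q1 q2 s1 s2.
have CS : x * x' + y * y' <= s * s'.
  rewrite -ler_sqr ?nnegrE ?addr_ge0 ?mulr_ge0// exprMn q1 q2.
  by have := sqr_ge0 (x * y' - y * x'); lra.
by lra.
Qed.

Lemma sqrt_sum_mono (x y x' y' : R) : 0 <= x <= x' -> 0 <= y <= y' ->
  Num.sqrt (x ^+ 2 + y ^+ 2) <= Num.sqrt (x' ^+ 2 + y' ^+ 2).
Proof.
move=> /andP[x0 xx] /andP[y0 yy]; rewrite ler_wsqrtr// lerD// lerXn2r ?nnegrE//.
  exact: le_trans xx.
exact: le_trans yy.
Qed.

Lemma L2norm_wDD u w : H1 u -> H1 w -> L2norm (wD (u + w)) <= L2norm (wD u) + L2norm (wD w).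
Proof.
move=> hu hw; have Lu := L2_wD hu; have Lw := L2_wD hw.
have hs : H1 (u + w) by rewrite -[u]scale1r; exact: H1_lin.
rewrite (@ae_L2norm _ _ (wD u + wD w)); last 1 first.
- by have := wD_lin 1 hu hw; rewrite !scale1r.
- exact: L2normD.
- exact: L2_wD.
- exact: L2D.
Qed.

Lemma H1Z k u : H1 u -> H1 (k *: u).
Proof. by move=> hu; rewrite -[k *: u]addr0; exact: H1_lin H1_0. Qed.

Lemma wDZ k u : H1 u -> wD (k *: u) = k *: wD u %[ae mu].
Proof.
move=> hu; apply: wD_eq; first by apply: L2Z; exact: H1_L2.
have w0 : weak_deriv (0 : R -> R^o) 0.
  split; first exact: L2_0.
  move=> phi tp; have [Lp Ldp] := test_L2 tp.
  have z f : L2 f -> ip (0 : R -> R^o) f = 0.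
    by move=> Lf; rewrite -(scale0r (0 : R -> R^o)) ipZl ?mul0r//; exact: L2_0.
  by have := z _ Lp; have := z _ Ldp; rewrite /ip => -> ->; rewrite oppr0.
rewrite -[k *: u]addr0 -[k *: wD u]addr0; apply: weak_deriv_lin => //.
- exact: H1_L2.
- exact: L2_0.
- exact: H1_wD.
Qed.

#[local] Opaque ip trace wD L2norm.

Lemma L2norm_wDZ k u : H1 u -> L2norm (wD (k *: u)) = `|k| * L2norm (wD u).
Proof.
move=> hu; rewrite -L2normZ; last exact: L2_wD.
apply: ae_L2norm; [by apply: L2_wD; exact: H1Z|by apply: L2Z; exact: L2_wD|exact: wDZ].
Qed.

Lemma H1norm_tri u w : H1 u -> H1 w -> H1norm (u + w) <= H1norm u + H1norm w.
Proof.
move=> hu hw; have Lu := H1_L2 hu; have Lw := H1_L2 hw.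
apply: le_trans (minkowski2 _ _ _ _); rewrite ?L2norm_ge0//.
by apply: sqrt_sum_mono; rewrite L2norm_ge0 ?L2normD// L2norm_wDD.
Qed.

Lemma H1normZ k u : H1 u -> H1norm (k *: u) = `|k| * H1norm u.
Proof.
move=> hu; rewrite /H1norm L2norm_wDZ// L2normZ; last exact: H1_L2.
by rewrite !exprMn -mulrDr sqrtrM ?sqr_ge0// sqrtr_sqr normr_id.
Qed.

Lemma norm_HE X : N X = Num.sqrt (Num.sqrt (H1norm (cu X) ^+ 2 + L2norm (cv X) ^+ 2) ^+ 2
  + L2norm (cp X) ^+ 2).
Proof. by rewrite sqr_sqrtr// addr_ge0 ?sqr_ge0. Qed.

Lemma N_sqr X : N X ^+ 2 = L2norm (cu X) ^+ 2 + L2norm (wD (cu X)) ^+ 2 +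
  L2norm (cv X) ^+ 2 + L2norm (cp X) ^+ 2.
Proof.
rewrite /norm_H1L2L2 sqr_sqrtr; last by rewrite !addr_ge0 ?sqr_ge0.
by rewrite /H1norm sqr_sqrtr// addr_ge0 ?sqr_ge0.
Qed.

Lemma N_ge0 X : 0 <= N X. Proof. exact: sqrtr_ge0. Qed.

Lemma N_components X : [/\ L2norm (cu X) <= N X, L2norm (wD (cu X)) <= N X,
  L2norm (cv X) <= N X & L2norm (cp X) <= N X].
Proof.
have := N_sqr X.
have h1 := sqr_ge0 (L2norm (cu X)); have h2 := sqr_ge0 (L2norm (wD (cu X))).
have h3 := sqr_ge0 (L2norm (cv X)); have h4 := sqr_ge0 (L2norm (cp X)).
move=> E; split; rewrite -ler_sqr ?nnegrE ?L2norm_ge0 ?N_ge0// E;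
  move: h1 h2 h3 h4; move: (L2norm _) (L2norm (wD _)) (L2norm (cv X)) (L2norm (cp X)) => *; lra.
Qed.

Lemma inH_L2 X : inH X -> [/\ H1 (cu X), L2 (wD (cu X)), L2 (cv X) & L2 (cp X)].
Proof. by move=> [[hu _] Lv Lp]; split => //; exact: L2_wD. Qed.

Lemma seminorm_H : seminorm_on (@inH R) N.
Proof.
split.
- by split; [split; [exact: H1_0|rewrite trace_0// lexx ler01]|exact: L2_0|exact: L2_0].
- move=> k X X' [[hu tu] Lv Lp] [[hu' tu'] Lv' Lp'].
  rewrite /inH -[cu _]/(k *: cu X + cu X') -[cv _]/(k *: cv X + cv X').
  rewrite -[cp _]/(k *: cp X + cp X').
  have t0 : (0 : R) <= (0 : R) <= 1 by apply/andP; split.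
  split; [split; first exact: (H1_lin k hu hu')|exact: (L2_lin k Lv Lv')|exact: (L2_lin k Lp Lp')].
  by rewrite (trace_lin k hu hu' t0) tu tu' mulr0 addr0.
- move=> X X' [[hu tu] Lv Lp] [[hu' tu'] Lv' Lp'].
  rewrite !norm_HE.
  apply: le_trans (minkowski2 _ _ _ _); rewrite ?L2norm_ge0 ?sqrtr_ge0//.
  apply: sqrt_sum_mono; rewrite ?sqrtr_ge0 ?L2norm_ge0 ?L2normD//=.
  apply: le_trans (minkowski2 _ _ _ _); rewrite ?L2norm_ge0 ?H1norm_ge0//.
  by apply: sqrt_sum_mono; rewrite ?H1norm_ge0 ?L2norm_ge0 ?L2normD//= H1norm_tri.
- move=> k X [[hu tu] Lv Lp].
  rewrite /norm_H1L2L2 -[cu (k *: X)]/(k *: cu X) -[cv (k *: X)]/(k *: cv X)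
    -[cp (k *: X)]/(k *: cp X) H1normZ// !L2normZ// !exprMn -!mulrDr.
  by rewrite sqrtrM ?sqr_ge0// sqrtr_sqr normr_id.
Qed.

Let DN := seminorm_H.

Lemma ae_wD_sub u w : H1 u -> H1 w -> wD (u - w) = wD u - wD w %[ae mu].
Proof.
by move=> hu hw; have := wD_lin (-1) hw hu; rewrite !scaleN1r ![- _ + _]addrC.
Qed.

Lemma L2norm_ae0 f : L2 f -> f = 0 %[ae mu] -> L2norm f = 0.
Proof. by move=> Lf f0; rewrite (ae_L2norm Lf (@L2_0 R) f0) L2norm0. Qed.

Lemma ae_sub0 f g : f = g %[ae mu] -> f - g = 0 %[ae mu].
Proof.
apply: ae_sub => x h xT.
by rewrite (_ : (f - g) x = f x - g x)// h// subrr.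
Qed.

Lemma eqH_N0 X X' : inH X -> inH X' -> eqH X X' -> N (X - X') = 0.
Proof.
move=> iX iX' [e1 e2 e3].
have [hu Lux Lv Lp] := inH_L2 iX; have [hu' Lux' Lv' Lp'] := inH_L2 iX'.
have [_ wE _] := ae_H1 hu (H1_L2 hu') e1.
have Lu := H1_L2 hu; have Lu' := H1_L2 hu'.
apply/eqP; rewrite -sqrf_eq0 N_sqr.
rewrite -[cu _]/(cu X - cu X') -[cv _]/(cv X - cv X') -[cp _]/(cp X - cp X').
rewrite !L2norm_ae0 ?expr0n ?addr0//; do ?[exact: L2B|exact: ae_sub0].
- apply: L2_wD; rewrite addrC -scaleN1r; exact: H1_lin.
- have := ae_wD_sub hu hu'; rewrite wE subrr; exact.
Qed.

(** Linearity holds only up to null functions because [wD] chooses representatives.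
    [Vwave X] and [|qst X|^2] are sums of squared norms of such maps, so that their
    behaviour along a curve of states reduces to that of the curve. *)
Definition blin (L : state R -> R -> R^o) :=
  [/\ forall X, inH X -> L2 (L X),
      forall k X X', inH X -> inH X' -> L (k *: X + X') = k *: L X + L X' %[ae mu] &
      exists2 K, 0 <= K & forall X, inH X -> L2norm (L X) <= K * N X].

Lemma blin_cv : blin (@cv R).
Proof.
split; [by move=> X []|by move=> k X X' _ _; exact: aeW|].
by exists 1 => // X _; rewrite mul1r; have [] := N_components X.
Qed.

Lemma blin_cp : blin (@cp R).
Proof.
split; [by move=> X []|by move=> k X X' _ _; exact: aeW|].
by exists 1 => // X _; rewrite mul1r; have [] := N_components X.
Qed.

Lemma blin_ux : blin (fun X => wD (cu X)).
Proof.
split.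
- by move=> X [[hu _] _ _]; exact: L2_wD.
- move=> k X X' [[hu _] _ _] [[hu' _] _ _].
  by rewrite -[cu (_ + _)]/(k *: cu X + cu X'); exact: (wD_lin k hu hu').
- by exists 1 => // X _; rewrite mul1r; have [] := N_components X.
Qed.

Lemma blin_comb (k : R) L L' : blin L -> blin L' -> blin (fun X => L X + k *: L' X).
Proof.
move=> [h1 h2 [K K0 hK]] [h1' h2' [K' K0' hK']]; split.
- by move=> X iX; apply: L2D; [exact: h1|apply: L2Z; exact: h1'].
- move=> l X X' iX iX'; apply: ae_sub (ae_and (h2 l _ _ iX iX') (h2' l _ _ iX iX')).
  move=> x [e e'] xT.
  rewrite (_ : (L _ + k *: _) x = L (l *: X + X') x + k * L' (l *: X + X') x)// e// e'//.
  rewrite (_ : (l *: L X + _) x = l * L X x + L X' x)//.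
  rewrite (_ : (l *: L' X + _) x = l * L' X x + L' X' x)//.
  rewrite (_ : (l *: (_ + _) + _) x = l * (L X x + k * L' X x) + (L X' x + k * L' X' x))//.
  move: (L X x) (L' X x) (L X' x) (L' X' x) => *; ring.
- exists (K + `|k| * K'); first by rewrite addr_ge0// mulr_ge0.
  move=> X iX; apply: (le_trans (L2normD (h1 _ iX) (L2Z _ (h1' _ iX)))).
  rewrite L2normZ; last exact: h1'.
  by rewrite mulrDl lerD ?hK// -mulrA ler_wpM2l// hK'.
Qed.

Lemma blin_expw k L : blin L -> blin (fun X => expw k (L X)).
Proof.
move=> [h1 h2 [K K0 hK]]; split.
- by move=> X iX; apply: L2_expw; exact: h1.
- move=> l X X' iX iX'; apply: ae_sub (h2 l _ _ iX iX') => x e xT.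
  by rewrite -expw_lin /expw e.
- exists (expR `|k| * K); first by rewrite mulr_ge0// expR_ge0.
  move=> X iX; have b : `|k + k| <= 2 * `|k|.
    by rewrite -mulr2n normrMn mulr_natl.
  have := expw_norm b (h1 _ iX) => /andP[_ h].
  have e : expR (2 * `|k|) = expR `|k| ^+ 2.
    by rewrite expr2 -expRD; congr expR; ring.
  apply: (@le_trans _ _ (expR `|k| * L2norm (L X))).
    rewrite -ler_sqr ?nnegrE ?mulr_ge0 ?L2norm_ge0 ?expR_ge0//.
    by rewrite exprMn -e.
  by rewrite -mulrA ler_wpM2l ?expR_ge0// hK.
Qed.

Lemma trace1_bound X : inH X -> `|trace (cu X) 1| <= N X.
Proof.
move=> [[hu tu] _ _]; rewrite H1_trace ?ler01 ?lexx// tu add0r.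
apply: (le_trans (prim_bound _ (L2_wD hu))); have [] := N_components X.
by [].
Qed.

Lemma blin_qst (c d : R) : blin (qst c d).
Proof.
have [hs _ _] := psi_H1 c; have Ls := H1_L2 hs.
split.
- by move=> X [[hu _] _ Lp]; apply: L2B => //; exact: L2Z.
- move=> k X X' [[hu _] _ Lp] [[hu' _] _ Lp']; apply: aeW => x _.
  have t := trace_lin k hu hu' (_ : 0 <= 1 <= 1); rewrite ler01 lexx in t.
  rewrite (_ : qst c d (k *: X + X') x = (k * cp X x + cp X' x) -
    d / c * trace (k *: cu X + cu X') 1 * psi c x)// t//.
  rewrite (_ : (k *: _ + _) x = k * (cp X x - d / c * trace (cu X) 1 * psi c x) +
    (cp X' x - d / c * trace (cu X') 1 * psi c x))//.
  move: (psi c x) (trace _ _) (trace (cu X') 1) (cp X x) (cp X' x) => *; ring.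
- exists (1 + `|d / c| * L2norm (psi c)); first by rewrite addr_ge0 ?mulr_ge0 ?L2norm_ge0.
  move=> X iX; have [_ _ _ Lp] := inH_L2 iX.
  apply: (le_trans (L2normB Lp (L2Z _ Ls))).
  rewrite L2normZ// mulrDl mul1r lerD//; first by have [] := N_components X.
  rewrite normrM -!mulrA ler_wpM2l// mulrC ler_wpM2l ?L2norm_ge0//.
  exact: trace1_bound.
Qed.

Lemma blin_riem1 m : blin (riem1 m).
Proof.
apply: blin_expw; have := blin_comb 1 blin_cv blin_ux.
by congr blin; apply/funext => X; rewrite scale1r.
Qed.

Lemma blin_riem2 m : blin (riem2 m).
Proof.
apply: blin_expw; have := blin_comb (-1) blin_cv blin_ux.
by congr blin; apply/funext => X; rewrite scaleN1r.
Qed.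

Lemma blin_sub L X X' : blin L -> inH X -> inH X' -> L (X - X') = L X - L X' %[ae mu].
Proof.
move=> [_ h2 _] iX iX'; have := h2 (-1) _ _ iX' iX.
by rewrite !scaleN1r ![- _ + _]addrC.
Qed.

Lemma blin_dist L : blin L -> exists2 K, 0 <= K & forall X X', inH X -> inH X' ->
  L2norm (L X - L X') <= K * N (X - X').
Proof.
move=> gL; have [h1 _ [K K0 hK]] := gL; exists K => // X X' iX iX'.
rewrite -(@ae_L2norm _ (L (X - X'))); [exact/hK/(sn_B DN)| | |].
- exact/h1/(sn_B DN).
- by apply: L2B; exact: h1.
- exact: blin_sub.
Qed.

Lemma blin_eqH L X X' : blin L -> inH X -> inH X' -> eqH X X' -> L X = L X' %[ae mu].
Proof.
move=> gL iX iX' e; have [K K0 hK] := blin_dist gL; have [h1 _ _] := gL.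
have n0 : L2norm (L X - L X') = 0.
  apply/eqP; rewrite eq_le L2norm_ge0 andbT (le_trans (hK _ _ iX iX'))//.
  by rewrite eqH_N0// mulr0.
have := L2norm0_ae (L2B (h1 _ iX) (h1 _ iX')) n0.
apply: ae_sub => x h xT; apply/eqP; rewrite -subr_eq0; apply/eqP; exact: h.
Qed.

(** The first-order remainder of the image curve is the image of the remainder. *)
Lemma blin_der L (Z : R -> state R) t X : blin L -> 0 <= t ->
  (forall s, 0 <= s -> inH (Z s)) -> inH X -> der N Z t X ->
  der (@L2norm R) (fun s => L (Z s)) t (L X).
Proof.
move=> gL t0 iZ iX D e e0; have [h1 h2 [K K0 hK]] := gL.
have [de de0 hde] := D (e / (K + 1)) (divr_gt0 e0 (ltr_wpDl K0 ltr01)).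
exists de => // s s0 sd.
have iD : inH (Z s - Z t - (s - t) *: X).
  by apply: (sn_B DN); [apply: (sn_B DN); exact: iZ|exact: (sn_Z DN)].
rewrite (@ae_L2norm _ _ (L (Z s - Z t - (s - t) *: X))); last 1 first.
- have e1 := blin_sub gL (iZ _ s0) (iZ _ t0).
  have e2 := h2 (- (s - t)) _ _ iX (sn_B DN (iZ _ s0) (iZ _ t0)).
  apply: ae_sub (ae_and e1 e2) => x [{}e1 {}e2] xT.
  have -> : Z s - Z t - (s - t) *: X = - (s - t) *: X + (Z s - Z t) by rewrite addrC scaleNr.
  rewrite e2//.
  rewrite (_ : (- (s - t) *: _ + _) x = - (s - t) * L X x + L (Z s - Z t) x)// e1//.
  rewrite (_ : (_ - _) x = L (Z s) x - L (Z t) x - (s - t) * L X x)//.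
  by rewrite (_ : (L (Z s) - _) x = L (Z s) x - L (Z t) x)// mulNr addrC.
- apply: (le_trans (hK _ iD)); apply: (le_trans (ler_wpM2l K0 (hde _ s0 sd))).
  rewrite mulrA ler_wpM2r// mulrC mulrAC ler_pdivrMr ?ltr_wpDl//.
  by rewrite ler_wpM2l ?(ltW e0)// lerDl.
- by apply: L2B; [apply: L2B; apply: h1; exact: iZ|apply: L2Z; exact: h1].
- exact: h1.
Qed.

Lemma der_L2norm_sqr (f : R -> R -> R^o) t g : 0 <= t -> (forall s, 0 <= s -> L2 (f s)) -> L2 g ->
  der (@L2norm R) f t g ->
  der (fun x : R^o => `|x|) (fun s => L2norm (f s) ^+ 2) t (2 * ip (f t) g).
Proof.
move=> t0 Lf Lg D e e0.
pose A := L2norm (f t); pose B := L2norm g.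
have A0 : 0 <= A by exact: L2norm_ge0.
have B0 : 0 <= B by exact: L2norm_ge0.
pose C := B ^+ 2 + 1 + 2 * A + 2 * B.
have C0 : 0 < C by rewrite /C; have := sqr_ge0 B; lra.
pose e' := Num.min 1 (e / C).
have e'0 : 0 < e' by rewrite lt_min ltr01 divr_gt0.
have e'1 : e' <= 1 by rewrite ge_min lexx.
have e'C : e' * C <= e by rewrite -ler_pdivlMr// ge_min lexx orbT.
have [de de0 hde] := D _ e'0.
exists (Num.min de e'); first by rewrite lt_min de0.
move=> s s0; rewrite lt_min => /andP[sd se]; have := hde _ s0 sd.
set h := s - t in se *; set r := f s - f t - h *: g => nr.
have Lr : L2 r by apply: L2B; [apply: L2B; exact: Lf|exact: L2Z].
have Lft := Lf _ t0.
have fE : f s = f t + (h *: g + r).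
  by rewrite /r [h *: g + _]addrC subrK addrC subrK.
rewrite fE L2norm_sqrD//; last by apply: L2D => //; exact: L2Z.
rewrite L2norm_sqrD//; last exact: L2Z.
rewrite ipDr ?ipZr ?ipZl//; last exact: L2Z.
rewrite L2normZ// -/A -/B /GRing.scale/=.
have -> : A ^+ 2 + 2 * (h * ip (f t) g + ip (f t) r) +
   ((`|h| * B) ^+ 2 + 2 * (h * ip g r) + L2norm r ^+ 2) - A ^+ 2 - h * (2 * ip (f t) g) =
   2 * ip (f t) r + (`|h| * B) ^+ 2 + 2 * (h * ip g r) + L2norm r ^+ 2 by ring.
have c1 := cauchy_schwarz Lft Lr; have c2 := cauchy_schwarz Lg Lr.
rewrite -/A -/B in c1 c2.
have n0 := L2norm_ge0 r.
have h0 := normr_ge0 h.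
apply: (@le_trans _ _ (2 * `|ip (f t) r| + (`|h| * B) ^+ 2 + 2 * (`|h| * `|ip g r|) + L2norm r ^+ 2)).
  rewrite (le_trans (ler_normD _ _))// lerD//; last by rewrite ger0_norm ?sqr_ge0.
  rewrite (le_trans (ler_normD _ _))// lerD//; last by rewrite normrM ger0_norm// normrM.
  rewrite (le_trans (ler_normD _ _))// lerD//; last by rewrite ger0_norm ?sqr_ge0.
  by rewrite normrM ger0_norm.
apply: (@le_trans _ _ (e' * C * `|h|)); last by rewrite ler_wpM2r.
have hde' : `|h| <= e' by exact: ltW.
move: c1 c2 nr; move: (`|ip (f t) r|) (`|ip g r|) (L2norm r) n0 (`|h|) h0 hde' => i j n n0 h' h0 he c1 c2 nr.
have n1 : n <= e' by apply: (le_trans nr); rewrite ler_piMr ?(ltW e'0)// (le_trans he).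
have p1 : i <= A * (e' * h') by apply: (le_trans c1); rewrite ler_wpM2l.
have p2 : h' * j <= h' * (B * e') by rewrite ler_wpM2l// (le_trans c2)// ler_wpM2l.
have p3 : n ^+ 2 <= e' * h' * 1.
  by rewrite expr2 ler_pM// (le_trans n1).
have p4 : (h' * B) ^+ 2 <= e' * h' * B ^+ 2.
  by rewrite exprMn ler_wpM2r ?sqr_ge0// expr2 ler_wpM2r.
rewrite /C; lra.
Qed.

End StateSpace.

(** * Mild solutions and their time averages *)

Section MildSolutions.
Context {R : realType}.
Notation mu := (@leb01 R).
Notation N := (@norm_H1L2L2 R).
Variables (a b c d eps : R).
Implicit Types (X : state R).
#[local] Opaque ip trace wD L2norm norm_H1L2L2.

Let DN := @seminorm_H R.

Lemma wD_ae_lin k (u w f : R -> R^o) : H1 u -> H1 w -> L2 f -> f = k *: u + w %[ae mu] ->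
  H1 f /\ wD f = k *: wD u + wD w %[ae mu].
Proof.
move=> hu hw Lf fe.
have e' : k *: u + w = f %[ae mu] by apply: ae_sub fe => x h xT; rewrite h.
have [hf wf _] := ae_H1 (H1_lin k hu hw) Lf e'.
by split => //; rewrite wf; exact: wD_lin.
Qed.

Lemma ae_lin k (f f' g g' : R -> R^o) : f = f' %[ae mu] -> g = g' %[ae mu] ->
  k *: f + g = k *: f' + g' %[ae mu].
Proof.
move=> e e'; apply: ae_sub (ae_and e e') => x [{}e {}e'] xT.
rewrite (_ : (k *: f + g) x = k * f x + g x)//.
by rewrite (_ : (k *: f' + g') x = k * f' x + g' x)// e// e'.
Qed.

Lemma ae_scale k (f f' : R -> R^o) : f = f' %[ae mu] -> k *: f = k *: f' %[ae mu].
Proof. by apply: ae_sub => x e xT; rewrite (_ : (k *: f) x = k * f x)// e. Qed.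

Lemma ae_subf (f f' g g' : R -> R^o) : f = f' %[ae mu] -> g = g' %[ae mu] ->
  f - g = f' - g' %[ae mu].
Proof. by move=> e e'; have h := ae_lin (-1) e' e; rewrite !scaleN1r ![- _ + _]addrC in h. Qed.

Lemma eqH_lin k X1 X1' X2 X2' : eqH X1 X1' -> eqH X2 X2' ->
  eqH (k *: X1 + X2) (k *: X1' + X2').
Proof.
by move=> [e1 e2 e3] [f1 f2 f3]; split; [exact: ae_lin e1 f1|exact: ae_lin e2 f2|exact: ae_lin e3 f3].
Qed.

Lemma ae_trans (f g h : R -> R^o) : f = g %[ae mu] -> g = h %[ae mu] -> f = h %[ae mu].
Proof. by move=> e e'; apply: ae_sub (ae_and e e') => x [{}e {}e'] xT; rewrite e// e'. Qed.

Lemma ae_symm (f g : R -> R^o) : f = g %[ae mu] -> g = f %[ae mu].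
Proof. by apply: ae_sub => x e xT; rewrite e. Qed.

Lemma eqH_refl X : eqH X X. Proof. by split; exact: aeW. Qed.

Lemma eqH_trans X1 X2 X3 : eqH X1 X2 -> eqH X2 X3 -> eqH X1 X3.
Proof.
by move=> [e1 e2 e3] [f1 f2 f3]; split; [exact: ae_trans e1 f1|exact: ae_trans e2 f2|exact: ae_trans e3 f3].
Qed.

Lemma eqH_sym X1 X2 : eqH X1 X2 -> eqH X2 X1.
Proof. by move=> [e1 e2 e3]; split; exact: ae_symm. Qed.

Lemma eqH_scale k X X' : eqH X X' -> eqH (k *: X) (k *: X').
Proof. by move=> e; have h := eqH_lin k e (eqH_refl 0); rewrite !addr0 in h. Qed.

Lemma eqH_sub X1 X1' X2 X2' : eqH X1 X1' -> eqH X2 X2' -> eqH (X1 - X2) (X1' - X2').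
Proof.
move=> e f; have h := eqH_lin (-1) f e.
have E Z Z' : -1 *: Z + Z' = Z' - Z :> state R by rewrite scaleN1r addrC.
by rewrite !E in h.
Qed.

Lemma domA_inH X : domA a b c d X -> inH X.
Proof. by move=> [[[_ hu] [[Lv _] _] [[Lp _] _]] _]. Qed.

Lemma opA_inH X : domA a b c d X -> inH (opA eps X).
Proof.
move=> [[[[_ hux] _] hv [_ hpx]] _]; split => //; first exact: L2_wD.
by apply: L2Z; exact: L2_wD.
Qed.

Lemma domA_lin k X X' : domA a b c d X -> domA a b c d X' -> domA a b c d (k *: X + X').
Proof.
move=> dX dX'; have [_ hl _ _] := DN.
have [[hu tu] Lv Lp] := hl k _ _ (domA_inH dX) (domA_inH dX').
move: dX dX' => [[[[hu1 hux1] [_ _]] [hv1 tv1] [hp1 hpx1]] [e1 e2 e3]].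
move=> [[[[hu2 hux2] [_ _]] [hv2 tv2] [hp2 hpx2]] [e1' e2' e3']].
have t1 : (0 : R) <= (1 : R) <= 1 by apply/andP; split.
have t0 : (0 : R) <= (0 : R) <= 1 by apply/andP; split.
have hp : H1 (cp (k *: X + X')) by exact: H1_lin.
have [hux wux] := wD_ae_lin hux1 hux2 (L2_wD hu) (wD_lin k hu1 hu2).
have [hpx wpx] := wD_ae_lin hpx1 hpx2 (L2_wD hp) (wD_lin k hp1 hp2).
have T (f g h : R -> R^o) x : H1 f -> H1 g -> L2 h -> h = k *: f + g %[ae mu] ->
    0 <= x <= 1 -> trace h x = k * trace f x + trace g x.
  move=> hf hg Lh he x01; rewrite -trace_lin//.
  have he' : k *: f + g = h %[ae mu] by apply: ae_sub he => z -> .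
  by have [_ _ ->] := ae_H1 (H1_lin k hf hg) Lh he'.
split; split.
- exact: (conj (conj hu hux) (conj hu tu)).
- split; first exact: (H1_lin k hv1 hv2).
  by rewrite -[cv (k *: X + X')]/(k *: cv X + cv X') trace_lin// tv1 tv2 mulr0 addr0.
- exact: (conj hp hpx).
- rewrite (T _ _ _ _ hux1 hux2 (L2_wD hu) (wD_lin k hu1 hu2) t1).
  rewrite -[cv (k *: X + X')]/(k *: cv X + cv X') -[cp (k *: X + X')]/(k *: cp X + cp X') !trace_lin// e1 e1'.
  ring.
- rewrite (T _ _ _ _ hpx1 hpx2 (L2_wD hp) (wD_lin k hp1 hp2) t0).
  rewrite -[cp (k *: X + X')]/(k *: cp X + cp X') !trace_lin// e2 e2'; ring.
- rewrite (T _ _ _ _ hpx1 hpx2 (L2_wD hp) (wD_lin k hp1 hp2) t1).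
  rewrite -[cu (k *: X + X')]/(k *: cu X + cu X') !trace_lin// e3 e3'; ring.
Qed.

Lemma opA_lin k X X' : domA a b c d X -> domA a b c d X' ->
  eqH (opA eps (k *: X + X')) (k *: opA eps X + opA eps X').
Proof.
move=> dX dX'; have [_ hl _ _] := DN.
have [[hu tu] Lv Lp] := hl k _ _ (domA_inH dX) (domA_inH dX').
move: dX dX' => [[[[hu1 hux1] [_ _]] [hv1 tv1] [hp1 hpx1]] [e1 e2 e3]].
move=> [[[[hu2 hux2] [_ _]] [hv2 tv2] [hp2 hpx2]] [e1' e2' e3']].
have hp : H1 (cp (k *: X + X')) by exact: H1_lin.
have [hux wux] := wD_ae_lin hux1 hux2 (L2_wD hu) (wD_lin k hu1 hu2).
have [hpx wpx] := wD_ae_lin hpx1 hpx2 (L2_wD hp) (wD_lin k hp1 hp2).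
split; [exact: aeW|exact: wux|apply: ae_sub wpx => x h xT].
rewrite (_ : cp (opA _ _) x = eps^-1 * wD (wD (cp (k *: X + X'))) x)// h//.
rewrite (_ : cp (k *: _ + _) x = k * (eps^-1 * wD (wD (cp X)) x) + eps^-1 * wD (wD (cp X')) x)//.
rewrite (_ : (k *: _ + _) x = k * wD (wD (cp X)) x + wD (wD (cp X')) x)//.
by rewrite mulrDr mulrCA.
Qed.

Lemma opA_scale k X : domA a b c d X ->
  domA a b c d (k *: X) /\ eqH (opA eps (k *: X)) (k *: opA eps X).
Proof.
move=> dX; have h1 := domA_lin (k - 1) dX dX; have h2 := opA_lin (k - 1) dX dX.
have e Z : (k - 1) *: Z + Z = k *: Z :> state R by rewrite scalerBl scale1r subrK.
by rewrite (e X) in h1 h2; rewrite (e (opA eps X)) in h2; exact: (conj h1 h2).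
Qed.

Lemma opA_sub X X' : domA a b c d X -> domA a b c d X' ->
  domA a b c d (X - X') /\ eqH (opA eps (X - X')) (opA eps X - opA eps X').
Proof.
move=> dX dX'; have h1 := domA_lin (-1) dX' dX; have h2 := opA_lin (-1) dX' dX.
have e Z Z' : -1 *: Z + Z' = Z' - Z :> state R by rewrite scaleN1r addrC.
rewrite (e X' X) in h1 h2; rewrite (e (opA eps X') (opA eps X)) in h2.
exact: (conj h1 h2).
Qed.

Section Curve.
Variables (X0 : state R) (Y : R -> state R).
Hypothesis hY : mild_solution a b c d eps X0 Y.

Let iY t : 0 <= t -> inH (Y t). Proof. by have [h _ _ _] := hY; exact: h. Qed.

Lemma mild_continuous t e : 0 <= t -> 0 < e -> exists2 de : R, 0 < de &
  forall s, 0 <= s -> `|s - t| < de -> N (Y s - Y t) <= e.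
Proof.
move=> t0 e0; have [_ h _ _] := hY.
have /cvgrPdist_le /(_ _ e0) := h t t0.
rewrite near_withinE => /nbhs_ballP[de /= de0 hde]; exists de => // s s0 st.
have := hde s; rewrite /ball/= distrC => /(_ st s0).
by rewrite sub0r normrN ger0_norm// N_ge0.
Qed.

Lemma mild_primitive : exists J : R -> state R, forall t, 0 <= t ->
  [/\ is_Riemann_integral N Y t (J t), domA a b c d (J t) &
      eqH (Y t) (Y 0 + opA eps (J t))].
Proof.
have [_ _ _ h] := hY.
have : forall t, exists I : state R, 0 <= t -> [/\ is_Riemann_integral N Y t I, domA a b c d I &
      eqH (Y t) (Y 0 + opA eps I)].
  move=> t; have [t0|t0] := leP 0 t; last by exists 0.
  by have [I hI] := h t t0; exists I.
by move=> /choice[J hJ]; exists J.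
Qed.

Variable J : R -> state R.
Hypothesis hJ : forall t, 0 <= t ->
  [/\ is_Riemann_integral N Y t (J t), domA a b c d (J t) &
      eqH (Y t) (Y 0 + opA eps (J t))].

Let dJ t : 0 <= t -> domA a b c d (J t). Proof. by move=> /hJ[]. Qed.

Let iJ t : 0 <= t -> inH (J t). Proof. by move=> /dJ /domA_inH. Qed.

(** The Riemann integral of [Y] enters only through this bound on its increments and
    through its vanishing at 0. *)
Let incr t t' z e : 0 <= t -> t <= t' -> inH z ->
  (forall s, t <= s <= t' -> N (Y s - z) <= e) ->
  N (J t' - J t - (t' - t) *: z) <= (t' - t) * e.
Proof.
move=> t0 tt' iz h; have t'0 := le_trans t0 tt'.
have [R1 _ _] := hJ t0; have [R2 _ _] := hJ t'0.
apply: (Riemann_increment DN t0 tt' _ _ _ _ R1 R2) => //.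
- exact: iJ.
- exact: iJ.
Qed.

Lemma J_bound B t : (forall s, 0 <= s -> N (Y s) <= B) -> 0 <= t -> N (J t - J 0) <= t * B.
Proof.
move=> YB t0; have [i0 _ _ _] := DN.
have := @incr 0 t 0 B (lexx _) t0 i0; rewrite scaler0 !subr0; apply=> s /andP[s0 _].
by rewrite subr0; exact: YB.
Qed.

Lemma J0_null : N (J 0) = 0.
Proof.
have [i0 _ _ _] := DN; have [RI _ _] := hJ (lexx 0).
apply/eqP; rewrite eq_le N_ge0 andbT; apply/ler_addgt0Pr => e e0; rewrite add0r.
have [de de0 /(_ 0%N (fun=> 0) (fun=> 0) erefl erefl)] := RI _ e0.
rewrite big_ord0 (sub0r (J 0)) -(scaleN1r (J 0)) => h.
have [_ _ _ hs] := DN; rewrite -[N _]mul1r -(@normrN1 R) -hs; last exact: iJ.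
by apply: ltW; apply: h.
Qed.

Lemma J_der t : 0 <= t -> der N J t (Y t).
Proof.
move=> t0 e e0; have [de de0 hde] := mild_continuous t0 e0; exists de => // s s0 sd.
have [ts|st] := leP t s.
  rewrite ger0_norm ?subr_ge0// mulrC; apply: incr => //; first exact: iY.
  move=> r /andP[tr rs]; apply: hde; first exact: le_trans tr.
  apply: le_lt_trans sd; rewrite !ger0_norm ?subr_ge0//; lra.
have -> : J s - J t - (s - t) *: Y t = - (J t - J s - (t - s) *: Y t).
  by rewrite [RHS]opprD [- (J t - J s)]opprB opprK -scaleNr opprB.
have [_ _ _ hs] := DN.
rewrite -scaleN1r hs; last first.
  by apply: (sn_B DN); [apply: (sn_B DN); exact: iJ|apply: (sn_Z DN); exact: iY].
rewrite normrN1 mul1r distrC ger0_norm ?subr_ge0 ?(ltW st)// mulrC.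
apply: incr => //; [exact: ltW|exact: iY|].
move=> r /andP[sr rt]; apply: hde; first exact: le_trans sr.
apply: le_lt_trans sd; rewrite distrC [leRHS]distrC !ger0_norm ?subr_ge0 ?(ltW st)//; lra.
Qed.

(** The time averages of the solution over windows of length [h]: a strong
    solution, differentiable in time with values in the domain. *)
Definition avg h t : state R := h^-1 *: (J (t + h) - J t).
Definition davg h t : state R := h^-1 *: (Y (t + h) - Y t).

Section Window.
Variable h : R.
Hypothesis h0 : 0 < h.

Let th0 t : 0 <= t -> 0 <= t + h. Proof. by move=> t0; exact: addr_ge0 t0 (ltW h0). Qed.

Lemma avg_domA t : 0 <= t -> domA a b c d (avg h t).
Proof.
move=> t0; have [d1 _] := opA_sub (dJ (th0 t0)) (dJ t0).
by have [] := opA_scale h^-1 d1.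
Qed.

Lemma avg_inH t : 0 <= t -> inH (avg h t).
Proof. by move=> /avg_domA /domA_inH. Qed.

Lemma davg_inH t : 0 <= t -> inH (davg h t).
Proof. by move=> t0; apply: (sn_Z DN); apply: (sn_B DN); apply: iY => //; exact: th0. Qed.

Lemma avg_eq t : 0 <= t -> eqH (davg h t) (opA eps (avg h t)).
Proof.
move=> t0; have [_ d1 e1] := hJ (th0 t0); have [_ d2 e2] := hJ t0.
have [d3 e3] := opA_sub d1 d2; have [_ e4] := opA_scale h^-1 d3.
apply: eqH_trans (eqH_sym e4); apply: eqH_scale; apply: eqH_trans (eqH_sym e3).
have := eqH_sub e1 e2.
by rewrite opprD addrACA subrr add0r.
Qed.

Lemma avg_der t : 0 <= t -> der N (avg h) t (davg h t).
Proof.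
move=> t0 e e0; have he : 0 < h * e / 2 by rewrite !mulr_gt0.
have [d1 d10 H1] := J_der t0 he; have [d2 d20 H2] := J_der (th0 t0) he.
exists (Num.min d1 d2); first by rewrite lt_min d10.
move=> s s0; rewrite lt_min => /andP[sd1 sd2].
have shE : (s + h) - (t + h) = s - t by ring.
have K1 := H1 _ s0 sd1; have := H2 (s + h) (th0 s0); rewrite shE => /(_ sd2) K2.
have -> : avg h s - avg h t - (s - t) *: davg h t =
  h^-1 *: ((J (s + h) - J (t + h) - (s - t) *: Y (t + h)) - (J s - J t - (s - t) *: Y t)).
  rewrite /avg /davg scalerA (mulrC (s - t)) -scalerA -!scalerBr; congr (_ *: _).
  rewrite scalerBr; move: (_ *: Y t) (_ *: Y (t + h)) (J _) (J (s + h)) (J t) (J (t + h)) => A B C D' E F'.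
  by rewrite !opprB [LHS](AC (2*2*2) ((1*4*6)*(5*(3*2)))).
have [_ _ _ hs] := DN.
have iA : inH (J (s + h) - J (t + h) - (s - t) *: Y (t + h)).
  apply: (sn_B DN); first by apply: (sn_B DN); apply: iJ; exact: th0.
  by apply: (sn_Z DN); apply: iY; exact: th0.
have iB : inH (J s - J t - (s - t) *: Y t).
  by apply: (sn_B DN); [apply: (sn_B DN); exact: iJ|apply: (sn_Z DN); exact: iY].
rewrite hs; last exact: (sn_B DN).
rewrite ger0_norm ?invr_ge0 ?(ltW h0)// ler_pdivrMl//.
apply: (le_trans (sn_BN DN iA iB)); apply: (le_trans (lerD K2 K1)).
by rewrite -mulrDl -splitr mulrA.
Qed.

End Window.

Lemma avg_cvg t e : 0 <= t -> 0 < e -> exists2 de : R, 0 < de &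
  forall h, 0 < h < de -> N (avg h t - Y t) <= e.
Proof.
move=> t0 e0; have [de de0 hde] := mild_continuous t0 e0; exists de => // h /andP[h0 hd].
have th : t <= t + h by lra.
have -> : avg h t - Y t = h^-1 *: (J (t + h) - J t - (t + h - t) *: Y t).
  rewrite scalerBr scalerA (addrC t h) addrK mulVf ?gt_eqF// scale1r.
  by rewrite /avg addrC.
have [_ _ _ hs] := DN.
rewrite hs; last first.
  apply: (sn_B DN); first by apply: (sn_B DN); apply: iJ => //; exact: le_trans th.
  by apply: (sn_Z DN); exact: iY.
rewrite ger0_norm ?invr_ge0 ?(ltW h0)// ler_pdivrMl//.
have -> : h * e = (t + h - t) * e by rewrite [t + h]addrC addrK.
apply: incr => //; first exact: iY.
move=> s /andP[ts sh]; apply: hde; first exact: le_trans ts.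
by rewrite ger0_norm ?subr_ge0//; lra.
Qed.

Lemma blin_avg_cvg L t : blin L -> 0 <= t ->
  L2norm (L (avg h t)) @[h --> 0^'+] --> L2norm (L (Y t)).
Proof.
move=> gL t0; have [h1 _ _] := gL; have [K K0 hK] := blin_dist gL.
apply/cvgrPdist_le => e e0.
have [de de0 hde] := avg_cvg t0 (divr_gt0 e0 (ltr_wpDl K0 ltr01)).
near=> h.
have h0 : 0 < h by near: h; exact: nbhs_right_gt.
have hd : h < de by near: h; exact: nbhs_right_lt.
have iZ := avg_inH h0 t0.
have LZ := h1 _ iZ; have LY := h1 _ (iY t0).
have D : L2norm (L (avg h t) - L (Y t)) <= e.
  apply: (le_trans (hK _ _ iZ (iY t0))).
  apply: (@le_trans _ _ (K * (e / (K + 1)))); first by rewrite ler_wpM2l// hde// h0.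
  by rewrite mulrA ler_pdivrMr ?ltr_wpDl// mulrC ler_wpM2l ?(ltW e0)// lerDl.
have T1 := L2normD (L2B LZ LY) LY; rewrite subrK in T1.
have T2 := L2normD (L2B LY LZ) LZ; rewrite subrK (L2norm_distC LY LZ) in T2.
by rewrite ler_norml; apply/andP; split; lra.
Unshelve. all: by end_near. Qed.

Lemma avg_energy_der L h t : blin L -> 0 < h -> 0 <= t ->
  der (fun x : R^o => `|x|) (fun s => L2norm (L (avg h s)) ^+ 2) t
    (2 * ip (L (avg h t)) (L (opA eps (avg h t)))).
Proof.
move=> gL h0 t0; have [h1 _ _] := gL.
have iZ s : 0 <= s -> inH (avg h s) by move=> s0; exact: avg_inH.
have iD := davg_inH h0 t0.
have -> : ip (L (avg h t)) (L (opA eps (avg h t))) = ip (L (avg h t)) (L (davg h t)).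
  have iO := opA_inH (avg_domA h0 t0).
  apply/esym/ae_ipr; [exact: h1|exact: h1|by apply: h1; exact: iZ|].
  exact: (blin_eqH gL iD iO (avg_eq h0 t0)).
apply: (@der_L2norm_sqr _ (fun s => L (avg h s))) => //.
- by move=> s s0; apply: h1; exact: iZ.
- exact: h1.
- exact: (blin_der gL t0 iZ iD (avg_der h0 t0)).
Qed.

End Curve.
End MildSolutions.

(** * Completeness of L^2 and lower semicontinuity of the Dirichlet energy *)

Section Completeness.
Context {R : realType}.
Notation mu := (@leb01 R).
Implicit Types (f h : R -> R^o) (g : nat -> R -> R^o).

Lemma L2_of_integral h (r : R) : measurable_fun setT (h : R -> R) -> 0 <= r ->
  (\int[mu]_x ((h x) ^+ 2)%:E <= (r ^+ 2)%:E)%E -> L2 h /\ L2norm h <= r.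
Proof.
move=> mh r0 ih.
have iE : (\int[mu]_x ((h x) ^+ 2)%:E = \int[mu]_x (`|(h x)%:E| `^ 2))%E.
  by apply: eq_integral => x _; rewrite /= powR_mulrn// real_normK ?num_real.
split.
  rewrite /L2 inE/=; apply/andP; split; rewrite inE//=.
  rewrite /finite_norm unlock; apply: poweR_lty.
  by rewrite -iE (le_lt_trans ih)// ltry.
rewrite L2normE -[leRHS]ger0_norm// -sqrtr_sqr ler_wsqrtr// /ip /Rintegral.
have -> : (\int[mu]_x (h x * h x)%:E = \int[mu]_x ((h x) ^+ 2)%:E)%E.
  by apply: eq_integral => x _; rewrite expr2.
rewrite -lee_fin fineK// ge0_fin_numE ?(le_lt_trans ih) ?ltry//.
by apply: integral_ge0 => x _; rewrite lee_fin sqr_ge0.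
Qed.

Lemma L1_le_L2 h : L2 h -> (\int[mu]_x `|h x|%:E <= (L2norm h)%:E)%E.
Proof.
move=> Lh.
pose k : R -> R^o := fun x => `|h x|.
have mk : measurable_fun setT (k : R -> R) by apply: measurableT_comp => //; exact: L2_mfun.
have Lk : L2 k by apply: (L2_dom mk Lh); apply: aeW => x; rewrite /k normr_id.
have nk : L2norm k <= L2norm h by apply: L2norm_le => //; apply: aeW => x; rewrite /k normr_id.
have L1 := @L2_cst R 1; have I := L2_integrable Lk L1.
have -> : (\int[mu]_x `|h x|%:E = (ip k (cst 1))%:E)%E.
  rewrite /ip /Rintegral fineK; last exact: (integrable_fin_num measurableT I).
  by apply: eq_integral => x _; rewrite /k /= mulr1.
rewrite lee_fin (le_trans (ler_norm _))// (le_trans (cauchy_schwarz Lk L1))//.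
by rewrite L2norm_cst normr1 mulr1.
Qed.

(** The increments of a fast Cauchy sequence are summable in
    L^1, so the sequence converges a.e., and Fatou's lemma identifies its
    L^2 limit. *)
Lemma L2_complete g : (forall n, L2 (g n)) ->
  (forall n, L2norm (g n.+1 - g n) <= 1 / (2 ^ n.+1)%:R) ->
  exists2 f, L2 f & forall n, L2norm (f - g n) <= 1 / (2 ^ n)%:R.
Proof.
move=> Lg hg.
pose u n : R -> R^o := g n.+1 - g n.
have Lu n : L2 (u n) by exact: L2B.
have mu_ n : measurable_fun setT (fun x => (`|u n x|)%:E : \bar R).
  by apply/measurable_EFinP; apply: measurableT_comp => //; exact: L2_mfun.
pose G x : \bar R := (\sum_(0 <= n <oo) (`|u n x|)%:E)%E.
have G0 x : (0 <= G x)%E by apply: nneseries_ge0 => n _ _; rewrite lee_fin.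
have mG : measurable_fun setT G.
  by apply: ge0_emeasurable_sum => // n x _ _; rewrite lee_fin.
have iG : (\int[mu]_x G x <= 1%:E)%E.
  rewrite integral_nneseries//.
  apply: le_trans (@epsilon_trick0 R 1 xpredT ler01).
  apply: lee_nneseries => [n _ _|n _]; first by apply: integral_ge0 => x _; rewrite lee_fin.
  by apply: (le_trans (L1_le_L2 (Lu n))); rewrite lee_fin; exact: hg.
have fG : mu.-integrable setT G.
  apply/integrableP; split => //.
  under eq_integral => x _ do rewrite gee0_abs//.
  by rewrite (le_lt_trans iG)// ltry.
have aeG := integrable_ae measurableT fG.
have cvg x : G x \is a fin_num -> cvgn (fun n => g n x : R).
  move=> Gx.
  have cs : cvgn (series (fun n => u n x : R^o)).
    apply: normed_cvg; apply: nondecreasing_is_cvgn.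
      by apply/nondecreasing_seqP => n; rewrite /= [leRHS]big_nat_recr//= lerDl.
    exists (fine (G x)) => _ [n _ <-]; rewrite -lee_fin fineK// /series/= -sumEFin.
    by apply: nneseries_lim_ge => k _ _; rewrite lee_fin.
  have sE n : g n x = g 0%N x + series (fun k => u k x : R^o) n.
    elim: n => [|n ih]; first by rewrite /series/= big_geq// addr0.
    by rewrite seriesSr addrA -ih /u addrC subrK.
  have -> : (fun n => g n x : R) = (fun n => (g 0%N x : R^o) + series (fun k => u k x : R^o) n).
    exact/funext.
  by apply: is_cvgD => //; exact: is_cvg_cst.
pose f : R -> R^o := fun x => fine (limn_esup (fun n => (g n x)%:E)).
have mf : measurable_fun setT (f : R -> R).
  apply: (measurableT_comp (fine_measurable measurableT)).
  apply: measurable_fun_limn_esup => n; apply/measurable_EFinP; exact: L2_mfun.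
have fl x : G x \is a fin_num -> (fun n => g n x : R) @ \oo --> (f x : R).
  move=> /cvg /cvg_ex[l /= gl].
  have gl' : (fun n => (g n x)%:E) @ \oo --> l%:E by apply: cvg_EFin => //; exact: nearW.
  by have [_ e] := cvg_limn_einf_sup gl'; rewrite /f e.
have gB m n : L2norm (g (m + n)%N - g m) <= 1 / (2 ^ m)%:R.
  have : L2norm (g (m + n)%N - g m) <= 1 / (2 ^ m)%:R - 1 / (2 ^ (m + n))%:R.
    elim: n => [|n ih]; first by rewrite addn0 !subrr L2norm0.
    have := L2normD (Lu (m + n)%N) (L2B (Lg (m + n)%N) (Lg m)).
    rewrite addnS /u addrA subrK => /le_trans; apply.
    apply: (le_trans (lerD (hg _) ih)).
    have -> : 1 / (2 ^ (m + n))%:R = 2 * (1 / (2 ^ (m + n).+1)%:R) :> R.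
      by rewrite expnS natrM; field; rewrite pnatr_eq0 expn_eq0.
    by move: (1 / (2 ^ m)%:R) (1 / (2 ^ (m + n).+1)%:R) => A B; lra.
  move/le_trans; apply; rewrite lerBlDr lerDl divr_ge0//.
have key m : L2 (f - g m) /\ L2norm (f - g m) <= 1 / (2 ^ m)%:R.
  apply: L2_of_integral; [|by rewrite divr_ge0|].
    by apply: measurable_funB => //; exact: L2_mfun.
  pose F n x : \bar R := (((g (m + n)%N - g m) x) ^+ 2)%:E.
  have mF n : measurable_fun setT (F n).
    apply/measurable_EFinP; apply: measurable_funX; apply: L2_mfun; exact: L2B.
  have F0 n x : setT x -> (0 <= F n x)%E by move=> _; rewrite lee_fin sqr_ge0.
  have := @fatou _ _ _ mu setT measurableT F mF F0.
  have -> : (\int[mu]_x limn_einf (F ^~ x) = \int[mu]_x ((f - g m) x ^+ 2)%:E)%E.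
    apply: ae_eq_integral => //.
    - rewrite /limn_einf; apply: measurableT_comp => //.
      apply: (@measurable_fun_limn_esup _ _ _ setT (fun n x => - F n x)%E) => n.
      by apply: measurableT_comp => //; exact: mF.
    - by apply/measurable_EFinP; apply: measurable_funX; apply: measurable_funB => //; exact: L2_mfun.
    apply: ae_sub aeG => x Gx xT; have l := fl x (Gx xT).
    have : (F ^~ x) @ \oo --> ((f - g m) x ^+ 2)%:E.
      apply: cvg_EFin; first exact: nearW.
      have d : (fun n => (g (m + n)%N - g m) x : R) @ \oo --> ((f - g m) x : R).
        apply: (@cvgB _ R^o); last exact: cvg_cst.
        exact: (cvg_comp (addn m) (fun n => g n x) (cvg_addnl m) l).
      exact: (cvgM d d).
    by move=> /cvg_limn_einf_sup[->].
  move=> /le_trans; apply.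
  rewrite limn_einf_lim; apply: lime_le; first exact: is_cvg_einfs.
  apply: nearW => n; apply: (@le_trans _ _ (\int[mu]_x F n x)%E).
    by apply: ereal_inf_lbound; exists n => //=.
  have Ld := L2B (Lg (m + n)%N) (Lg m); have I := L2_integrable Ld Ld.
  have -> : (\int[mu]_x F n x = (L2norm (g (m + n)%N - g m) ^+ 2)%:E)%E.
    rewrite L2norm_sqr /ip /Rintegral fineK; last exact: (integrable_fin_num measurableT I).
    by apply: eq_integral => x _; rewrite /F expr2.
  by rewrite lee_fin lerXn2r ?nnegrE ?L2norm_ge0 ?divr_ge0// gB.
exists f.
  by have [L _] := key 0%N; rewrite -[f](subrK (g 0%N)); exact: L2D.
by move=> n; have [] := key n.
Qed.

End Completeness.

Section LowerSemicontinuity.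
Context {R : realType}.
Notation mu := (@leb01 R).

(** Let [dl de] be the infimum of [|y_x|^2] over the [y] that are [de]-close to [p], and
    [D] its limit as [de] tends to 0.  Midpoints of almost minimal approximants are again
    close to [p], so by the parallelogram law their derivatives are a Cauchy sequence,
    whose limit is the weak derivative of [p]. *)
Lemma H1_lsc (p : R -> R^o) (M : R) : L2 p -> 
  (forall de, 0 < de -> exists y, [/\ H1 y, L2norm (y - p) <= de & L2norm (wD y) ^+ 2 <= M]) ->
  H1 p /\ L2norm (wD p) ^+ 2 <= M.
Proof.
move=> Lp hM.
pose E de : set R := [set r | exists y, [/\ H1 y, L2norm (y - p) <= de & r = L2norm (wD y) ^+ 2]].
have E0 de : 0 < de -> has_inf (E de).
  move=> /hM[y [h1 h2 h3]]; split; first by exists (L2norm (wD y) ^+ 2), y.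
  by exists 0 => _ [z [_ _ ->]]; exact: sqr_ge0.
pose dl de := inf (E de).
have dlM de : 0 < de -> dl de <= M.
  move=> de0; have [y [h1 h2 h3]] := hM _ de0.
  by apply: le_trans h3; apply: inf_lbound; [have [] := E0 _ de0|exists y].
pose D := sup [set r | exists2 de, 0 < de & r = dl de].
have hD : has_sup [set r | exists2 de, 0 < de & r = dl de].
  split; first by exists (dl 1), 1.
  by exists M => _ [de de0 ->]; exact: dlM.
have DM : D <= M by apply: sup_le_ub; [have [] := hD|move=> _ [de de0 ->]; exact: dlM].
have dlD de : 0 < de -> dl de <= D.
  by move=> de0; apply: ub_le_sup; [have [] := hD|exists de].
(* the tolerance 4^-(k+1) / 8 makes consecutive derivatives 2^-(k+1)-close *)
pose et k : R := (1 / (2 ^ k.+1)%:R) ^+ 2 / 8.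
have et0 k : 0 < et k by rewrite divr_gt0// exprn_gt0// divr_gt0// ltr0n expn_gt0.
have etS k : et k.+1 <= et k.
  rewrite ler_wpM2r// lerXn2r ?nnegrE ?divr_ge0//.
  by rewrite !div1r lef_pV2 ?posrE ?ltr0n ?expn_gt0// ler_nat leq_exp2l.
have mono de de' : 0 < de -> de <= de' -> dl de' <= dl de.
  move=> de0 dd; apply: lb_le_inf; first by have [] := E0 _ de0.
  move=> _ [y [h1 h2 ->]]; apply: inf_lbound.
    by have [] := E0 _ (lt_le_trans de0 dd).
  by exists y; split => //; exact: le_trans dd.
have ex k : exists y, exists de, [/\ 0 < de, de <= 1 / k.+1%:R, D - et k < dl de &
    [/\ H1 y, L2norm (y - p) <= de & L2norm (wD y) ^+ 2 < D + et k]].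
  have [_ [de de0 ->] hde] := sup_adherent (et0 k) hD.
  pose de' := Num.min de (1 / k.+1%:R).
  have de'0 : 0 < de' by rewrite lt_min de0 divr_gt0.
  have [_ [y [h1 h2 ->]] h3] := inf_adherent (et0 k) (E0 _ de'0).
  exists y, de'; split => //; first by rewrite ge_min lexx orbT.
    by apply: (lt_le_trans hde); apply: mono => //; rewrite ge_min lexx.
  by split => //; apply: (lt_le_trans h3); rewrite lerD2r dlD.
have [y hy] := choice ex.
have hyH k : H1 (y k) by have [de [_ _ _ []]] := hy k.
have Lw k : L2 (wD (y k)) by exact: L2_wD.
(* the midpoint of two approximants is a competitor for the infimum *)
have mid k : D - et k <= L2norm (2^-1 *: (wD (y k.+1) + wD (y k))) ^+ 2.
  have [d1 [d10 _ D1 [_ n1 _]]] := hy k; have [d2 [d20 _ D2 [_ n2 _]]] := hy k.+1.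
  pose de := Num.max d1 d2.
  have hz : H1 (2^-1 *: y k.+1 + 2^-1 *: y k) by apply: H1_lin => //; exact: H1Z.
  have Ly j := H1_L2 (hyH j).
  have nz : L2norm (2^-1 *: y k.+1 + 2^-1 *: y k - p) <= de.
    have -> : 2^-1 *: y k.+1 + 2^-1 *: y k - p = 2^-1 *: (y k.+1 - p) + 2^-1 *: (y k - p).
      have e : p = 2^-1 *: p + 2^-1 *: p by rewrite -scalerDl -[2^-1]mul1r -splitr scale1r.
      by rewrite {1}e !scalerBr opprD addrACA.
    apply: (le_trans (L2normD (L2Z _ (L2B (Ly _) Lp)) (L2Z _ (L2B (Ly _) Lp)))).
    rewrite !L2normZ; [|exact: L2B|exact: L2B].
    have m1 : d1 <= de by rewrite le_max lexx.
    have m2 : d2 <= de by rewrite le_max lexx orbT.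
    by rewrite ger0_norm ?invr_ge0//; lra.
  have lo : D - et k <= dl de.
    rewrite /de; have [_|_] := leP d1 d2; last exact: ltW.
    by apply: le_trans (ltW D2); rewrite lerD2l lerN2.
  apply: (le_trans lo).
  apply: (@le_trans _ _ (L2norm (wD (2^-1 *: y k.+1 + 2^-1 *: y k)) ^+ 2)).
    apply: inf_lbound; first by have [] := E0 de; rewrite ?lt_max ?d10.
    by exists (2^-1 *: y k.+1 + 2^-1 *: y k).
  rewrite (@ae_L2norm _ _ (2^-1 *: (wD (y k.+1) + wD (y k)))) //.
  - exact: L2_wD.
  - by apply: L2Z; exact: L2D.
  - have h1 := wD_lin 2^-1 (hyH k.+1) (H1Z 2^-1 (hyH k)).
    apply: ae_sub (ae_and h1 (wDZ 2^-1 (hyH k))) => x [e1 e2] xT.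
    rewrite e1// (_ : (2^-1 *: _ + _) x = 2^-1 * wD (y k.+1) x + wD (2^-1 *: y k) x)// e2//.
    rewrite (_ : (2^-1 *: wD (y k)) x = 2^-1 * wD (y k) x)//.
    by rewrite (_ : (2^-1 *: (_ + _)) x = 2^-1 * (wD (y k.+1) x + wD (y k) x))// mulrDr.
have fast k : L2norm (wD (y k.+1) - wD (y k)) <= 1 / (2 ^ k.+1)%:R.
  have [d1 [_ _ _ [_ _ n1]]] := hy k; have [d2 [_ _ _ [_ _ n2]]] := hy k.+1.
  have m := mid k; rewrite L2normZ in m; last exact: L2D.
  rewrite exprMn ger0_norm ?invr_ge0// in m.
  have P := parallelogram (Lw k.+1) (Lw k).
  rewrite -ler_sqr ?nnegrE ?L2norm_ge0 ?divr_ge0//.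
  have eE : (1 / (2 ^ k.+1)%:R) ^+ 2 = 8 * et k by rewrite /et [8 * _]mulrC divfK.
  rewrite eE; move: (etS k) (et0 k) n1 n2 m P.
  move: (L2norm _ ^+ 2) (L2norm (_ + _)) (L2norm (wD (y k.+1)) ^+ 2) (L2norm (wD (y k)) ^+ 2).
  move: (et k) (et k.+1) => e e' *; lra.
have [g Lg hg] := L2_complete Lw fast.
have w : weak_deriv p g.
  split => // phi tp; have [Lphi Ldphi] := test_L2 tp.
  suff : ip p (derive1 phi) + ip g phi = 0 by move/eqP; rewrite addr_eq0 => /eqP.
  apply: (@eq0_of_harmonic_bound _ _ (L2norm (derive1 phi) + L2norm phi)) => k.
  have Ly := H1_L2 (hyH k).
  have e : ip (y k) (derive1 phi) = - ip (wD (y k)) phi by exact: (H1_wD (hyH k)).2.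
  have -> : ip p (derive1 phi) + ip g phi =
     ip (g - wD (y k)) phi - ip (y k - p) (derive1 phi).
    by rewrite !ipBl// e; ring.
  have [d1 [_ dk _ [_ n1 _]]] := hy k.
  have c1 := cauchy_schwarz (L2B Lg (Lw k)) Lphi.
  have c2 := cauchy_schwarz (L2B Ly Lp) Ldphi.
  have b1 : L2norm (g - wD (y k)) <= 1 / k.+1%:R.
    apply: (le_trans (hg k)); rewrite !div1r lef_pV2 ?posrE ?ltr0n ?expn_gt0// ler_nat.
    exact: ltn_expl.
  have b2 := le_trans n1 dk.
  apply: (le_trans (ler_normB _ _)); rewrite mulrDl addrC.
  apply: lerD.
    by apply: (le_trans c2); rewrite mulrC ler_wpM2l ?L2norm_ge0// -div1r.
  by apply: (le_trans c1); rewrite mulrC ler_wpM2l ?L2norm_ge0// -div1r.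
have hp : H1 p by split => //; exists g.
split => //; rewrite (ae_L2norm (L2_wD hp) Lg (wD_eq Lp w)).
have D0 : 0 <= D.
  apply: le_trans (dlD 1 ltr01); apply: lb_le_inf; first by have [] := E0 1 ltr01.
  by move=> _ [z [_ _ ->]]; exact: sqr_ge0.
have sD := sqr_sqrtr D0; have sD0 := sqrtr_ge0 D.
suff : L2norm g <= Num.sqrt D.
  move=> h; apply: le_trans DM; rewrite -sD lerXn2r ?nnegrE ?L2norm_ge0//.
rewrite -subr_le0 leNgt; apply/negP => gD.
have : L2norm g - Num.sqrt D = 0; last by move=> e; rewrite e ltxx in gD.
apply: (@eq0_of_harmonic_bound _ _ 2) => k; rewrite gtr0_norm// lerBlDl.
have [d1 [_ _ _ [_ _ n1]]] := hy k.
have i2 : 1 / (2 ^ k)%:R <= 1 / k.+1%:R :> R.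
  by rewrite !div1r lef_pV2 ?posrE ?ltr0n ?expn_gt0// ler_nat; exact: ltn_expl.
have i1 : 1 / (2 ^ k.+1)%:R <= 1 / k.+1%:R :> R.
  rewrite !div1r lef_pV2 ?posrE ?ltr0n ?expn_gt0// ler_nat.
  by apply: ltnW; exact: ltn_expl.
have i0 : 0 <= 1 / (2 ^ k.+1)%:R :> R by rewrite divr_ge0.
have ny : L2norm (wD (y k)) <= Num.sqrt D + 1 / (2 ^ k.+1)%:R.
  rewrite -ler_sqr ?nnegrE ?L2norm_ge0 ?addr_ge0//.
  apply: (le_trans (ltW n1)); rewrite sqrrD sD /et.
  have := sqr_ge0 (1 / (2 ^ k.+1)%:R : R); have := mulr_ge0 sD0 i0.
  by move: (_ / (2 ^ k.+1)%:R) (Num.sqrt D) => A B; lra.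
have := L2normD (L2B Lg (Lw k)) (Lw k); rewrite subrK => ng.
have h2 := hg k; apply: (le_trans ng).
have -> : 2 / k.+1%:R = 1 / k.+1%:R + 1 / k.+1%:R :> R by rewrite -mulrDl.
by rewrite addrCA; apply: lerD; [exact: le_trans i2|apply: (le_trans ny); rewrite lerD2l].
Qed.

End LowerSemicontinuity.

(** * Decay along mild solutions *)

Section Decay.
Context {R : realType}.
Notation mu := (@leb01 R).
Notation N := (@norm_H1L2L2 R).
Notation absR := (fun x : R^o => `|x|).
#[local] Opaque ip trace wD L2norm norm_H1L2L2.

Let DN := @seminorm_H R.

Lemma der_sum (f g : R -> R^o) (df dg : R^o) t : der absR f t df -> der absR g t dg ->
  der absR (fun s => f s + g s) t (df + dg).
Proof.
move=> D1 D2 e e0; have e2 : 0 < e / 2 by rewrite divr_gt0.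
have [d1 d10 H1] := D1 _ e2; have [d2 d20 H2] := D2 _ e2.
exists (Num.min d1 d2); first by rewrite lt_min d10.
move=> s s0; rewrite lt_min => /andP[/(H1 s s0) K1 /(H2 s s0) K2].
have -> : f s + g s - (f t + g t) - (s - t) *: (df + dg) =
   (f s - f t - (s - t) *: df) + (g s - g t - (s - t) *: dg).
  by rewrite scalerDr !opprD [LHS](AC ((2*2)*2) ((1*3*5)*(2*4*6))).
apply: (le_trans (ler_normD _ _)); apply: (le_trans (lerD K1 K2)).
by rewrite -mulrDl -splitr.
Qed.

(** By the expansion of [W], its increment is [- 2 <dq, p> - <dq, dp>] for increments
    [dq] and [dp].  The second term is of second order as soon as [p] is continuous, so
    that [W] is differentiable although [p] may not be. *)
Lemma der_form (q p : R -> R -> R^o) (q' : R -> R^o) (W : R -> R) t : 0 <= t ->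
  (forall s, 0 <= s -> L2 (q s)) -> (forall s, 0 <= s -> L2 (p s)) -> L2 q' ->
  (forall s, 0 <= s -> W s - W t = - 2 * ip (q s - q t) (p t) - ip (q s - q t) (p s - p t)) ->
  der (@L2norm R) q t q' ->
  (forall e, 0 < e -> exists2 de, 0 < de & forall s, 0 <= s -> `|s - t| < de ->
     L2norm (p s - p t) <= e) ->
  der absR W t (- 2 * ip (p t) q').
Proof.
move=> t0 Lq Lp Lq' WE D cp e e0.
pose A := L2norm (p t); pose B := L2norm q'.
have A0 : 0 <= A by exact: L2norm_ge0.
have B0 : 0 <= B by exact: L2norm_ge0.
have C0 : 0 < 2 * A + B + 1 by lra.
pose k := Num.min 1 (e / (2 * A + B + 1)).
have k0 : 0 < k by rewrite lt_min ltr01 divr_gt0.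
have k1 : k <= 1 by rewrite ge_min lexx.
have kC : k * (2 * A + B + 1) <= e by rewrite -ler_pdivlMr// ge_min lexx orbT.
have [d1 d10 H1] := D _ k0; have [d2 d20 H2] := cp _ k0.
exists (Num.min d1 d2); first by rewrite lt_min d10.
move=> s s0; rewrite lt_min => /andP[sd1 sd2].
have Q := H1 s s0 sd1; have P := H2 s s0 sd2; rewrite (WE s s0).
have [Lqs Lqt Lps Lpt] := And4 (Lq s s0) (Lq t t0) (Lp s s0) (Lp t t0).
have Lst := L2Z (s - t) Lq'.
have Lr := L2B (L2B Lqs Lqt) Lst.
have dq : q s - q t = (q s - q t - (s - t) *: q') + (s - t) *: q' by rewrite subrK.
move: Lr Q dq; move: (q s - q t - (s - t) *: q') => r Lr Q ->.
have Lpp := L2B Lps Lpt.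
rewrite (ipDl Lr Lst Lpt) (ipZl _ Lq' Lpt) (ipC (p t)).
have c1 := cauchy_schwarz Lr Lpt.
have c2 := cauchy_schwarz (L2D Lr Lst) Lpp.
have c3 := L2normD Lr Lst; rewrite (L2normZ _ Lq') -/B in c3; rewrite -/A in c1.
have n1 := L2norm_ge0 r; have n2 := L2norm_ge0 (r + (s - t) *: q').
have n3 := L2norm_ge0 (p s - p t).
move: c1 c2 c3 n1 n2 n3 Q P; move: (L2norm (r + _)) (L2norm r) (L2norm (p s - _)) => x y z.
move: (ip r (p t)) (ip q' (p t)) (ip _ (p s - p t)) => i j l c1 c2 c3 n1 n2 n3 Q P.
have -> : - 2 * (i + (s - t) * j) - l - (s - t) *: (- 2 * j : R^o) = - (2 * i + l).
  by rewrite /GRing.scale/=; ring.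
rewrite normrN; apply: (le_trans (ler_normD _ _)).
have h0 := normr_ge0 (s - t).
have b2 : `|2 * i| <= 2 * (k * `|s - t| * A).
  by rewrite normrM ger0_norm// ler_wpM2l//; apply: (le_trans c1); rewrite ler_wpM2r.
have b3 : `|l| <= (k * `|s - t| + `|s - t| * B) * k.
  apply: (le_trans c2); apply: ler_pM => //.
  by apply: (le_trans c3); rewrite lerD2r.
apply: (le_trans (lerD b2 b3)).
apply: (@le_trans _ _ (k * (2 * A + B + 1) * `|s - t|)); last by rewrite ler_wpM2r.
have kk : k * k <= k * 1 by rewrite ler_wpM2l// ltW.
have := ler_wpM2r h0 kk; rewrite mulr1; lra.
Qed.

Lemma small_eps (A : R) : 0 <= A -> exists2 e1 : R, 0 < e1 &
  forall eps, 0 < eps < e1 -> A <= 2 / eps.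
Proof.
move=> A0; have A1 : 0 < A + 1 by lra.
exists (2 / (A + 1)); first by rewrite divr_gt0.
move=> eps /andP[e0]; rewrite ltr_pdivlMr// => e1.
by rewrite ler_pdivlMr//; nra.
Qed.

Lemma blin_sqr_bound (L : state R -> R -> R^o) : blin L -> exists2 K, 0 <= K &
  forall X, inH X -> L2norm (L X) ^+ 2 <= K * N X ^+ 2.
Proof.
move=> [_ _ [K K0 hK]]; exists (K ^+ 2); first exact: sqr_ge0.
move=> X iX; rewrite -exprMn lerXn2r ?nnegrE ?L2norm_ge0 ?mulr_ge0 ?N_ge0//.
exact: hK.
Qed.

Lemma Vwave_upper (m : R) : exists2 K, 0 <= K &
  forall X : state R, inH X -> Vwave m X <= K * N X ^+ 2.
Proof.
have [K1 K10 h1] := blin_sqr_bound (blin_riem1 m).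
have [K2 K20 h2] := blin_sqr_bound (blin_riem2 m).
exists (K1 + K2); first exact: addr_ge0.
by move=> X iX; rewrite /Vwave mulrDl lerD ?h1 ?h2.
Qed.

(** The constant depends on [c], [d] and [m] only, hence the final constants can be
    chosen independently of [eps]. *)
Lemma norm_le_energy (c d m : R) : 0 < m -> exists2 K, 0 <= K &
  forall X : state R, inH X -> N X ^+ 2 <= K * (Vwave m X + L2norm (qst c d X) ^+ 2).
Proof.
move=> m0; pose k := (d / c) ^+ 2 * L2norm (psi c) ^+ 2.
have k0 : 0 <= k by rewrite mulr_ge0// sqr_ge0.
have E0 := expR_ge0 m.
exists ((2 + 2 * k) * expR m + 2); first by rewrite addr_ge0// mulr_ge0// addr_ge0// mulr_ge0.
move=> X iX; have [hu Lux Lv Lp] := inH_L2 iX; have [[_ tu] _ _] := iX.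
have [hs _ _] := psi_H1 c; have Ls := H1_L2 hs.
have [Lq _ _] := blin_qst c d.
rewrite N_sqr.
have nu : L2norm (cu X) ^+ 2 <= L2norm (wD (cu X)) ^+ 2.
  rewrite lerXn2r ?nnegrE ?L2norm_ge0//.
  by have := poincare hu; rewrite tu normr0 add0r.
have np : L2norm (cp X) ^+ 2 <= 2 * L2norm (qst c d X) ^+ 2 + 2 * k * L2norm (wD (cu X)) ^+ 2.
  pose T := trace (cu X) 1.
  have Tb : `|T| <= L2norm (wD (cu X)).
    rewrite /T H1_trace ?ler01 ?lexx// tu add0r; exact: prim_bound.
  have : L2norm (cp X) <= L2norm (qst c d X) + `|d / c * T| * L2norm (psi c).
    rewrite -L2normZ//; have := L2normD (Lq _ iX) (L2Z (d / c * T) Ls).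
    by rewrite /qst subrK.
  have -> : 2 * k * L2norm (wD (cu X)) ^+ 2 = 2 * (`|d / c| * L2norm (wD (cu X)) * L2norm (psi c)) ^+ 2.
    by rewrite !exprMn real_normK ?num_real// /k; ring.
  have : `|d / c * T| * L2norm (psi c) <= `|d / c| * L2norm (wD (cu X)) * L2norm (psi c).
    by rewrite normrM ler_wpM2r ?L2norm_ge0// ler_wpM2l.
  have := L2norm_ge0 (cp X); have := L2norm_ge0 (qst c d X).
  move: (L2norm (cp X)) (L2norm (qst c d X)) (_ * L2norm (psi c)) (_ * L2norm (wD (cu X)) * _).
  move=> x y z w y0 x0 zw xyz.
  have xyw : x <= y + w by lra.
  apply: (@le_trans _ _ ((y + w) ^+ 2)).
    by rewrite lerXn2r ?nnegrE// (le_trans x0).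
  by have := sqr_ge0 (y - w); lra.
have lo := Vwave_lower m0 Lv Lux.
have V0 : 0 <= Vwave m X by rewrite addr_ge0 ?sqr_ge0.
have q0 := sqr_ge0 (L2norm (qst c d X)).
have v0 := sqr_ge0 (L2norm (cv X)); have w0 := sqr_ge0 (L2norm (wD (cu X))).
move: nu np lo q0 v0 w0 E0 k0 V0; move: (L2norm (cu X) ^+ 2) (L2norm (wD (cu X)) ^+ 2).
move: (L2norm (cv X) ^+ 2) (L2norm (cp X) ^+ 2) (L2norm (qst c d X) ^+ 2) (Vwave m X) (expR m) k.
move=> v p q V E k' u w nu np lo q0 v0 w0 E0 k0 V0.
have h1 : (2 + 2 * k') * (2 * (v + w)) <= (2 + 2 * k') * (E * V) by rewrite ler_wpM2l//; lra.
have h2 : 0 <= (2 + 2 * k') * E * q by rewrite !mulr_ge0//; lra.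
have h3 : 0 <= k' * v by rewrite mulr_ge0.
have h4 : 0 <= k' * w by rewrite mulr_ge0.
by lra.
Qed.

Lemma sqrD_le (x y : R) : (x + y) ^+ 2 <= 2 * x ^+ 2 + 2 * y ^+ 2.
Proof. have := sqr_ge0 (x - y); lra. Qed.

(** The energy identity of [heat_start] after Young's inequality in each of its four
    indefinite terms; [A] and [f0] stand for [|f_x|] and [f(0)]. *)
Lemma absorb_boundary (c d A f0 xi i1 i2 T U G B : R) : 0 < c -> 0 <= xi -> 0 <= B ->
  `|i1| <= A * G -> `|i2| <= A -> `|U| <= xi * B ->
  A ^+ 2 + xi * i1 - d * U * i2 + c * f0 * (f0 + xi * T - d / c * U) <= 0 ->
  A ^+ 2 + c * f0 ^+ 2 <= 2 * xi ^+ 2 * (G ^+ 2 + c * T ^+ 2 + d ^+ 2 * (1 + 1 / c) * B ^+ 2).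
Proof.
move=> c0 xi0 B0 h1 h2 hU H.
have A0 : 0 <= A := le_trans (normr_ge0 _) h2.
have k1 : - (xi * i1) <= A ^+ 2 / 4 + xi ^+ 2 * G ^+ 2.
  have : - i1 <= A * G by apply: le_trans h1; rewrite -normrN ler_norm.
  move=> /(ler_wpM2l xi0); have := sqr_ge0 (A / 2 - xi * G); lra.
have k2 : d * U * i2 <= A ^+ 2 / 4 + (d * U) ^+ 2.
  apply: (le_trans (ler_norm _)); rewrite normrM.
  have := ler_wpM2l (normr_ge0 (d * U)) h2; rewrite -[(d * U) ^+ 2]real_normK ?num_real//.
  have := sqr_ge0 (A / 2 - `|d * U|); lra.
have k3 : - (c * f0 * (xi * T)) <= c * f0 ^+ 2 / 4 + c * (xi ^+ 2 * T ^+ 2).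
  have := mulr_ge0 (ltW c0) (sqr_ge0 (f0 / 2 + xi * T)); lra.
have k4 : c * f0 * (d / c * U) <= c * f0 ^+ 2 / 4 + (d * U) ^+ 2 / c.
  have := mulr_ge0 (ltW c0) (sqr_ge0 (f0 / 2 - d * U / c)).
  have -> : c * (f0 / 2 - d * U / c) ^+ 2 =
    c * f0 ^+ 2 / 4 - c * f0 * (d / c * U) + (d * U) ^+ 2 / c by field; rewrite gt_eqF.
  lra.
have k5 : (d * U) ^+ 2 * (1 + 1 / c) <= xi ^+ 2 * (d ^+ 2 * (1 + 1 / c) * B ^+ 2).
  have -> : xi ^+ 2 * (d ^+ 2 * (1 + 1 / c) * B ^+ 2) = (d ^+ 2 * (xi * B) ^+ 2) * (1 + 1 / c) by ring.
  rewrite ler_wpM2r//; first by rewrite addr_ge0// divr_ge0// ltW.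
  rewrite exprMn ler_wpM2l ?sqr_ge0// -[U ^+ 2]real_normK ?num_real//.
  by rewrite lerXn2r ?nnegrE// mulr_ge0.
have -> : 2 * xi ^+ 2 * (G ^+ 2 + c * T ^+ 2 + d ^+ 2 * (1 + 1 / c) * B ^+ 2) =
  2 * (xi ^+ 2 * G ^+ 2 + c * (xi ^+ 2 * T ^+ 2) + xi ^+ 2 * (d ^+ 2 * (1 + 1 / c) * B ^+ 2)) by ring.
move: k4; have -> : (d * U) ^+ 2 / c = (d * U) ^+ 2 * (1 + 1 / c) - (d * U) ^+ 2 by ring.
move: k1 k2 k3 k5 H; move: (xi ^+ 2 * (d ^+ 2 * _ * _)) => z.
lra.
Qed.

Lemma initial_Wheat_sum (x y z g k w : R) :
  x <= 2 * g + 4 * (g + k + w) -> y <= 2 * k + 4 * (g + k + w) -> z <= w ->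
  0 <= w -> 0 <= k -> 0 <= g -> 2 * x + 2 * y + 2 * z <= 20 * (g + k + w).
Proof. lra. Qed.

Section Estimates.
Variables (a b c d m F : R).
Hypotheses (c0 : 0 < c) (m0 : 0 < m) (a1 : 0 < 1 + a)
  (ha : 3 * expR m * (1 - a) ^+ 2 <= expR (- m) * (1 + a) ^+ 2)
  (FE : F = 6 * expR m + 4 * expR (- m))
  (hb : (b * d / c) ^+ 2 <= m * expR (- m) * F^-1).

Let K1 := (d / c) ^+ 2 * L2norm (psi c) ^+ 2 / (expR (- m) * (1 + a) ^+ 2 / 6).

Let K10 : 0 <= K1.
Proof.
apply: divr_ge0; first by apply: mulr_ge0; exact: sqr_ge0.
by apply: divr_ge0 => //; apply: mulr_ge0; [exact: expR_ge0|exact: sqr_ge0].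
Qed.

Let F0 : 0 <= F. Proof. by rewrite FE addr_ge0// mulr_ge0// expR_ge0. Qed.

Lemma heat_sym X X' : domA a b c d X -> domA a b c d X' ->
  ip (qst c d X) (wD (wD (cp X'))) = ip (qst c d X') (wD (wD (cp X))).
Proof.
move=> dX dX'; have [h1 _ _] := qst_H1 c0 dX; have [h2 _ _] := qst_H1 c0 dX'.
rewrite [LHS](heat_form c0 dX' h1) [RHS](heat_form c0 dX h2) ipC.
move: (ip _ _) (trace _ 0) (trace (qst c d X') 0) => x y z; ring.
Qed.

Lemma Wheat_sub X X' : domA a b c d X -> domA a b c d X' ->
  Wheat c d X - Wheat c d X' =
  - 2 * ip (qst c d X - qst c d X') (wD (wD (cp X')))
  - ip (qst c d X - qst c d X') (wD (wD (cp X)) - wD (wD (cp X'))).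
Proof.
move=> dX dX'; have [h1 _ _] := qst_H1 c0 dX; have [h2 _ _] := qst_H1 c0 dX'.
have L1 := H1_L2 h1; have L2' := H1_L2 h2.
have Lp : L2 (wD (wD (cp X))) by have [[_ _ [_ hp]] _] := dX; exact: L2_wD.
have Lp' : L2 (wD (wD (cp X'))) by have [[_ _ [_ hp]] _] := dX'; exact: L2_wD.
have E1 := heat_ip c0 dX; have E2 := heat_ip c0 dX'; have S := heat_sym dX dX'.
move: E1 E2 S L1 L2' Lp Lp'; move: (Wheat c d X) (Wheat c d X').
move: (qst c d X) (qst c d X') (wD (wD (cp X))) (wD (wD (cp X'))) => q q' p p' W W'.
move=> E1 E2 S Lq Lq' Lp Lp'.
rewrite (ipBr Lp Lp' (L2B Lq Lq')) (ipBl Lq Lq' Lp) (ipBl Lq Lq' Lp') E1 E2 S.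
by move: (ip q' p) => x; ring.
Qed.

Lemma L2norm_sqrD_le (f g : R -> R^o) : L2 f -> L2 g ->
  L2norm (f + g) ^+ 2 <= 2 * L2norm f ^+ 2 + 2 * L2norm g ^+ 2.
Proof. by move=> Lf Lg; rewrite -(parallelogram Lf Lg) lerDr sqr_ge0. Qed.

Lemma px_le_Wheat X : domA a b c d X ->
  L2norm (wD (cp X)) ^+ 2 <= 2 * Wheat c d X + d ^+ 2 * expR m * Vwave m X.
Proof.
move=> dX; have [hq wq _] := qst_H1 c0 dX; have U := u1_le_Vwave dX m0.
have [[_ _ [hp _]] _] := dX; have Lq := L2_wD hq.
have Lk := @L2_cst R (d * trace (cu X) 1).
have e : wD (cp X) = wD (qst c d X) + cst (d * trace (cu X) 1) %[ae mu].
  apply: ae_sub wq => x h xT.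
  rewrite (_ : (wD (qst c d X) + _) x = wD (qst c d X) x + d * trace (cu X) 1)// h//.
  by rewrite (_ : (wD (cp X) - _) x = wD (cp X) x - d * trace (cu X) 1)// subrK.
rewrite (ae_L2norm (L2_wD hp) (L2D Lq Lk) e).
apply: (le_trans (L2norm_sqrD_le Lq Lk)).
rewrite L2norm_cst real_normK ?num_real// exprMn /Wheat.
have k1 : 0 <= c * trace (qst c d X) 0 ^+ 2 by rewrite mulr_ge0 ?sqr_ge0// ltW.
have := ler_wpM2l (sqr_ge0 d) U.
move: k1; move: (c * _) (L2norm _ ^+ 2) (trace (cu X) 1) (Vwave m X) (expR m) => x y z V E x0.
lra.
Qed.

Lemma Wheat_upper X : domA a b c d X -> Wheat c d X <=
  2 * L2norm (wD (cp X)) ^+ 2 + 2 * (c * trace (cp X) 0 ^+ 2) +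
  2 * (d ^+ 2 * (1 + 1 / c) * trace (cu X) 1 ^+ 2).
Proof.
move=> dX; have [hq wq tq] := qst_H1 c0 dX.
have [[_ _ [hp _]] _] := dX; have Lp := L2_wD hp.
have Lk := @L2_cst R (- (d * trace (cu X) 1)).
have t01 : (0 : R) <= (0 : R) <= 1 by apply/andP; split.
have n1 : L2norm (wD (qst c d X)) ^+ 2 <=
    2 * L2norm (wD (cp X)) ^+ 2 + 2 * (d ^+ 2 * trace (cu X) 1 ^+ 2).
  have -> : L2norm (wD (qst c d X)) = L2norm (wD (cp X) + cst (- (d * trace (cu X) 1))).
    exact: (ae_L2norm (L2_wD hq) (L2D Lp Lk) wq).
  apply: (le_trans (L2norm_sqrD_le Lp Lk)).
  by rewrite L2norm_cst real_normK ?num_real// sqrrN exprMn.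
have n2 : c * trace (qst c d X) 0 ^+ 2 <=
    2 * (c * trace (cp X) 0 ^+ 2) + 2 * (d ^+ 2 / c * trace (cu X) 1 ^+ 2).
  rewrite (tq 0 t01) mulr0 addr0 mulr1.
  move: (trace (cp X) 0) (trace (cu X) 1) => x y.
  have -> : 2 * (c * x ^+ 2) + 2 * (d ^+ 2 / c * y ^+ 2) =
    c * (2 * x ^+ 2 + 2 * (- (d / c * y)) ^+ 2) by field; rewrite gt_eqF.
  by rewrite ler_wpM2l ?sqrD_le// ltW.
apply: (le_trans (lerD n1 n2)); rewrite le_eqVlt; apply/orP; left; apply/eqP.
by move: (L2norm _) (trace _ 0) (trace _ 1) => x y z; ring.
Qed.

Section OneSolution.
Variables (eps : R) (X0 : state R) (Y J : R -> state R).
Hypotheses (hY : mild_solution a b c d eps X0 Y)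
  (hJ : forall t, 0 <= t -> [/\ is_Riemann_integral N Y t (J t), domA a b c d (J t) &
      eqH (Y t) (Y 0 + opA eps (J t))]).

Let iY t : 0 <= t -> inH (Y t). Proof. by have [h _ _ _] := hY; exact: h. Qed.

Let der_Vwave h t : 0 < h -> 0 <= t -> der absR (fun s => Vwave m (avg J h s)) t
  (2 * ip (riem1 m (avg J h t)) (riem1 m (opA eps (avg J h t))) +
   2 * ip (riem2 m (avg J h t)) (riem2 m (opA eps (avg J h t)))).
Proof.
move=> h0 t0.
exact: (der_sum (avg_energy_der hY hJ (blin_riem1 m) h0 t0)
                (avg_energy_der hY hJ (blin_riem2 m) h0 t0)).
Qed.

Let Vwave_cvg t : 0 <= t -> Vwave m (avg J h t) @[h --> 0^'+] --> Vwave m (Y t).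
Proof.
move=> t0; have C L : blin L -> L2norm (L (avg J h t)) ^+ 2 @[h --> 0^'+] --> L2norm (L (Y t)) ^+ 2.
  by move=> gL; have h := blin_avg_cvg hY hJ gL t0; exact: (cvgM h h).
by apply: (@cvgD _ R^o); apply: C; [exact: blin_riem1|exact: blin_riem2].
Qed.

(** Decay of the Lyapunov function, first for the time averages and then in the
    limit of small windows. *)
Lemma energy_decay : (F * b ^+ 2 + 2 * K1 + m) * (1 / c + 1) <= 2 / eps ->
  forall t, 0 <= t -> Vwave m (Y t) + L2norm (qst c d (Y t)) ^+ 2 <=
    expR (- (m / 2) * t) * (Vwave m (Y 0) + L2norm (qst c d (Y 0)) ^+ 2).
Proof.
move=> he t t0; have gq := blin_qst c d.
have decay h : 0 < h -> Vwave m (avg J h t) + L2norm (qst c d (avg J h t)) ^+ 2 <=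
    expR (- (m / 2) * t) * (Vwave m (avg J h 0) + L2norm (qst c d (avg J h 0)) ^+ 2).
  move=> h0.
  have D s (s0 : 0 <= s) := der_sum (der_Vwave h0 s0) (avg_energy_der hY hJ gq h0 s0).
  apply: (gronwall D) => // s s0.
  exact: (energy_L2 c0 (avg_domA hJ h0 s0) m0 a1 ha FE hb he).
have C s : 0 <= s -> Vwave m (avg J h s) + L2norm (qst c d (avg J h s)) ^+ 2 @[h --> 0^'+] -->
    Vwave m (Y s) + L2norm (qst c d (Y s)) ^+ 2.
  move=> s0; have h := blin_avg_cvg hY hJ gq s0.
  by apply: (@cvgD _ R^o); [exact: Vwave_cvg|exact: (cvgM h h)].
apply: (ler_cvg_to (C t t0)).
  apply: (@cvgM _ R); first exact: cvg_cst.
  exact: (C 0 (lexx 0)).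
by near=> h; apply: decay; near: h; exact: nbhs_right_gt.
Unshelve. all: by end_near. Qed.

Let domX h t : 0 < h -> 0 <= t -> domA a b c d (avg J h t).
Proof. by move=> h0 t0; exact: (avg_domA hJ h0 t0). Qed.

(** [Wheat] involves a derivative of [p] and is not bounded on the energy space;
    it is differentiable along the averages since [p_xx] is a multiple of an
    increment of the continuous curve [Y], up to null functions. *)
Let der_Wheat h t : 0 < eps -> 0 < h -> 0 <= t ->
  der absR (fun s => Wheat c d (avg J h s)) t
    (- 2 * ip (wD (wD (cp (avg J h t)))) (qst c d (opA eps (avg J h t)))).
Proof.
move=> eps0 h0 t0; have gq := blin_qst c d; have [gq1 _ _] := gq.
have gp := @blin_cp R; have [gp1 _ _] := gp.
have iZ s : 0 <= s -> inH (avg J h s) by move=> s0; exact: (domA_inH (domX h0 s0)).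
have iD s : 0 <= s -> inH (davg Y h s) by move=> s0; exact: (davg_inH hY h0 s0).
have iO : inH (opA eps (avg J h t)) := opA_inH eps (domX h0 t0).
have Lpxx s : 0 <= s -> L2 (wD (wD (cp (avg J h s)))).
  by move=> s0; have [[_ _ [_ hp]] _] := domX h0 s0; exact: L2_wD hp.
have -> : ip (wD (wD (cp (avg J h t)))) (qst c d (opA eps (avg J h t))) =
          ip (wD (wD (cp (avg J h t)))) (qst c d (davg Y h t)).
  apply: (ae_ipr (gq1 _ iO) (gq1 _ (iD t t0)) (Lpxx t t0)).
  exact: ae_symm (blin_eqH gq (iD t t0) iO (avg_eq hJ h0 t0)).
apply: (der_form t0 (fun s s0 => gq1 _ (iZ s s0)) Lpxx (gq1 _ (iD t t0))).
- by move=> s s0; exact: (Wheat_sub (domX h0 s0) (domX h0 t0)).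
- exact: (blin_der gq t0 iZ (iD t t0) (avg_der hY hJ h0 t0)).
move=> e e0.
have pe : 0 < e * h / (2 * eps) by rewrite divr_gt0 ?mulr_gt0.
have th s : 0 <= s -> 0 <= s + h by move=> s0; exact: addr_ge0 s0 (ltW h0).
have [d2 d20 H2] := mild_continuous hY t0 pe.
have [d3 d30 H3] := mild_continuous hY (th t t0) pe.
exists (Num.min d2 d3); first by rewrite lt_min d20.
move=> s s0; rewrite lt_min => /andP[sd2 sd3].
have n1 := H2 s s0 sd2.
have n2 : N (Y (s + h) - Y (t + h)) <= e * h / (2 * eps).
  by apply: (H3 _ (th s s0)); rewrite opprD addrACA subrr addr0.
have pE r (r0 : 0 <= r) : wD (wD (cp (avg J h r))) = eps *: cp (davg Y h r) %[ae mu].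
  have [_ _ e3] := avg_eq hJ h0 r0.
  have := ae_scale eps (ae_symm e3).
  by rewrite -[cp (opA _ _)]/(eps^-1 *: _) scalerA divff ?gt_eqF// scale1r.
have ies : L2 (cp (davg Y h s) - cp (davg Y h t)).
  exact: L2B (gp1 _ (iD s s0)) (gp1 _ (iD t t0)).
have -> : L2norm (wD (wD (cp (avg J h s))) - wD (wD (cp (avg J h t)))) =
  eps * L2norm (cp (davg Y h s) - cp (davg Y h t)).
  rewrite -{1}(gtr0_norm eps0) -(L2normZ _ ies).
  apply: (ae_L2norm (L2B (Lpxx s s0) (Lpxx t t0)) (L2Z _ ies)).
  by rewrite scalerBr; exact: ae_subf (pE s s0) (pE t t0).
have pN : L2norm (cp (davg Y h s) - cp (davg Y h t)) <= N (davg Y h s - davg Y h t).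
  by have [_ _ _] := N_components (davg Y h s - davg Y h t).
have dE : davg Y h s - davg Y h t = h^-1 *: ((Y (s + h) - Y (t + h)) - (Y s - Y t)).
  by rewrite /davg -scalerBr; congr (_ *: _); rewrite !opprB [LHS](AC (2*2) ((1*4)*(3*2))).
have [_ _ _ hs] := DN.
have ia : inH (Y (s + h) - Y (t + h)) := sn_B DN (iY (th s s0)) (iY (th t t0)).
have ib : inH (Y s - Y t) := sn_B DN (iY s0) (iY t0).
have nD : N (davg Y h s - davg Y h t) <= h^-1 * (e * h / (2 * eps) + e * h / (2 * eps)).
  rewrite dE (hs _ _ (sn_B DN ia ib)) ger0_norm ?invr_ge0 ?(ltW h0)//.
  rewrite ler_wpM2l ?invr_ge0 ?(ltW h0)//.
  exact: (le_trans (sn_BN DN ia ib) (lerD n2 n1)).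
apply: (le_trans (ler_wpM2l (ltW eps0) (le_trans pN nD))).
by rewrite le_eqVlt; apply/orP; left; apply/eqP; field; rewrite !gt_eqF.
Qed.

Lemma energy_decay_H1 h : 0 < eps -> 0 < h ->
  (F * b ^+ 2 / c + m / 2) * (2 * (1 / c + 1)) + K1 <= 2 / eps ->
  forall t, 0 <= t -> Vwave m (avg J h t) + Wheat c d (avg J h t) <=
    expR (- (m / 2) * t) * (Vwave m (avg J h 0) + Wheat c d (avg J h 0)).
Proof.
move=> eps0 h0 he.
have D s (s0 : 0 <= s) := der_sum (der_Vwave h0 s0) (der_Wheat eps0 h0 s0).
apply: (gronwall D) => s s0.
have := energy_H1 c0 (domX h0 s0) m0 a1 ha FE hb he.
by rewrite mulNr.
Qed.

(** When [p_0] is in [H^1], the averages at time 0 are bounded in [H^1] for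
    arbitrarily small windows.  The difference [f(t)] of [\int_0^t p] and [t p_0]
    satisfies [eps f_t = (\int_0^t p)_xx]. Since [|f|^2] vanishes at 0 and is nonnegative,
    its derivative is nonnegative at some [xi] in ]0,h[; there
    [<f, (\int_0^t p)_xx> >= 0], and the left side is [- |f_x|^2 - c f(0)^2] up to terms
    of order [xi] times these norms.  So [|f_x|] and [f(0)] are [O(xi)], and the average of
    [p] over [0,xi] is [p_0 + f(xi) / xi]. *)
Lemma heat_start (B : R) : 0 < eps -> H1 (cp (Y 0)) ->
  (forall s, 0 <= s -> N (Y s) <= B) ->
  let G := L2norm (wD (cp (Y 0))) in let T := trace (cp (Y 0)) 0 in
  let M := G ^+ 2 + c * T ^+ 2 + d ^+ 2 * (1 + 1 / c) * B ^+ 2 in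
  forall h, 0 < h -> exists xi, [/\ 0 < xi < h,
    L2norm (wD (cp (avg J xi 0))) ^+ 2 <= 2 * G ^+ 2 + 4 * M,
    trace (cp (avg J xi 0)) 0 ^+ 2 <= 2 * T ^+ 2 + 4 * M / c &
    N (avg J xi 0) <= B].
Proof.
move=> eps0 hp0 YB G T M h h0.
pose p0 := cp (Y 0).
have iJ t (t0 : 0 <= t) : inH (J t) by have [_ dj _] := hJ t0; exact: domA_inH dj.
have gp := @blin_cp R; have [gp1 _ _] := gp.
have Lp0 : L2 p0 := H1_L2 hp0.
pose f t : R -> R^o := cp (J t) - t *: p0.
have LJ t (t0 : 0 <= t) : L2 (cp (J t)) := gp1 _ (iJ t t0).
have Lf t : 0 <= t -> L2 (f t) by move=> t0; exact: L2B (LJ t t0) (L2Z t Lp0).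
have Df t : 0 <= t -> der (@L2norm R) f t (cp (Y t) - p0).
  move=> t0 e e0; have [de de0 H] := blin_der gp t0 iJ (iY t0) (J_der hY hJ t0) e0.
  exists de => // s s0 sd; have := H s s0 sd.
  congr (L2norm _ <= _); rewrite /f.
  move: (cp (J s)) (cp (J t)) (cp (Y t)) => q q' w.
  by apply/funext => x; rewrite !fctE /GRing.scale/=; ring.
have dphi t (t0 : 0 <= t) := der_L2norm_sqr t0 Lf (L2B (gp1 _ (iY t0)) Lp0) (Df t t0).
have [xi /andP[x0 xh] E] := der_MVT h0 dphi.
have x0' : 0 <= xi := ltW x0.
have [_ dX [_ _ e3]] := hJ x0'.
have [[_ _ [hP hPx]] _] := dX.
have fE : f xi = - xi *: p0 + cp (J xi) by rewrite /f scaleNr addrC.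
have PE : cp (J xi) = xi *: p0 + f xi by rewrite fE scaleNr addrA subrr add0r.
have hf : H1 (f xi) by rewrite fE; exact: (H1_lin (- xi) hp0 hP).
have Lfx := L2_wD hf; have Lp0x := L2_wD hp0; have L1 := @L2_cst R 1.
have Lpxx : L2 (wD (wD (cp (J xi)))) := L2_wD hPx.
have J00 : L2norm (cp (J 0)) = 0.
  apply/eqP; rewrite eq_le L2norm_ge0 andbT.
  by have [_ _ _] := N_components (J 0); rewrite (J0_null hJ).
have pos : 0 <= ip (f xi) (wD (wD (cp (J xi)))).
  have ipE : ip (f xi) (cp (Y xi) - p0) = eps^-1 * ip (f xi) (wD (wD (cp (J xi)))).
    rewrite -(ipZr _ Lpxx (Lf _ x0')).
    apply: (ae_ipr (L2B (gp1 _ (iY x0')) Lp0) (L2Z _ Lpxx) (Lf _ x0')).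
    apply: ae_sub e3 => x ex xT.
    rewrite (_ : (cp (Y xi) - p0) x = cp (Y xi) x - p0 x)// (ex xT).
    rewrite (_ : cp (Y 0 + _) x = p0 x + (eps^-1 *: wD (wD (cp (J xi)))) x)//.
    by rewrite addrC addKr.
  have f0 : L2norm (f 0) = 0 by rewrite /f scale0r subr0.
  move: E; rewrite f0 expr0n subr0 ipE => E.
  have : 0 <= 2 * (eps^-1 * ip (f xi) (wD (wD (cp (J xi))))) * h.
    by rewrite -E; exact: sqr_ge0.
  by rewrite pmulr_lge0// pmulr_rge0// pmulr_rge0// invr_gt0.
have nJ : N (J xi) <= xi * B.
  have jb := J_bound hY hJ YB x0'.
  have := sn_dist DN (iJ xi x0') (iJ 0 (lexx 0)) (sn_Z DN 0 (iJ 0 (lexx 0))).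
  by rewrite scale0r !subr0 (J0_null hJ) addr0 => /le_trans; apply.
pose U := trace (cu (J xi)) 1.
have Ub : `|U| <= xi * B := le_trans (trace1_bound (iJ xi x0')) nJ.
have [hq wq tq] := qst_H1 c0 dX.
have t01 : (0 : R) <= (0 : R) <= 1 by apply/andP; split.
pose f0 := trace (f xi) 0; pose A := L2norm (wD (f xi)).
have tP : trace (cp (J xi)) 0 = xi * T + f0 by rewrite PE (trace_lin xi hp0 hf t01).
have q0E : trace (qst c d (J xi)) 0 = f0 + xi * T - d / c * U.
  by rewrite (tq 0 t01) tP mulr0 addr0 mulr1 [xi * T + f0]addrC.
have ipq : ip (wD (f xi)) (wD (qst c d (J xi))) =
    A ^+ 2 + xi * ip (wD (f xi)) (wD p0) - d * U * ip (wD (f xi)) (cst 1).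
  rewrite -(ipZr xi Lp0x Lfx) -(ipZr (d * U) L1 Lfx) L2norm_sqr.
  have Lx := L2Z xi Lp0x; have Ld := L2Z (d * U) L1.
  rewrite -(ipDr Lfx Lx Lfx) -(ipBr (L2D Lfx Lx) Ld Lfx).
  apply: (ae_ipr (L2_wD hq) (L2B (L2D Lfx Lx) Ld) Lfx).
  have wP := wD_lin xi hp0 hf; rewrite -PE in wP.
  apply: ae_sub (ae_and wq wP) => x [x1 x2] xT.
  rewrite (x1 xT) (_ : (wD (cp (J xi)) - _) x = wD (cp (J xi)) x - d * U)// (x2 xT).
  rewrite (_ : (xi *: _ + _) x = xi * wD p0 x + wD (f xi) x)//.
  by rewrite (_ : (_ - _) x = wD (f xi) x + xi * wD p0 x - d * U * 1)// mulr1 [xi * _ + _]addrC.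
have i1 := cauchy_schwarz Lfx Lp0x.
have i2 : `|ip (wD (f xi)) (cst 1)| <= A.
  by apply: (le_trans (cauchy_schwarz Lfx L1)); rewrite L2norm_cst normr1 mulr1.
move: pos; rewrite (heat_form c0 dX hf) -/f0 q0E ipq => pos.
have Af : A ^+ 2 + c * f0 ^+ 2 <= 2 * xi ^+ 2 * M.
  apply: absorb_boundary i1 i2 Ub _ => //.
    exact: le_trans (N_ge0 _) (YB 0 (lexx 0)).
  by move: pos; rewrite oppr_ge0.
rewrite (_ : 2 * xi ^+ 2 * M = xi ^+ 2 * (2 * M)) in Af; last by rewrite -mulrA mulrCA.
have A2 : 0 <= A ^+ 2 by exact: sqr_ge0.
have cf2 : 0 <= c * f0 ^+ 2 by rewrite mulr_ge0 ?sqr_ge0// ltW.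
have xA : (xi^-1 * A) ^+ 2 <= 2 * M.
  rewrite exprMn exprVn ler_pdivrMl ?exprn_gt0//.
  by apply: le_trans Af; rewrite lerDl.
have xf : (xi^-1 * f0) ^+ 2 <= 2 * M / c.
  rewrite exprMn exprVn ler_pdivrMl ?exprn_gt0// [leRHS]mulrA ler_pdivlMr//.
  by apply: le_trans Af; rewrite [leLHS]mulrC lerDr.
have XE : xi^-1 *: f xi + p0 = cp (avg J xi 0) %[ae mu].
  apply: ae_sub (L2norm0_ae (LJ 0 (lexx 0)) J00) => x ex xT.
  rewrite (_ : cp (avg J xi 0) x = xi^-1 * (cp (J (0 + xi)) x - cp (J 0) x))// (ex xT).
  rewrite add0r PE (_ : (xi *: p0 + f xi) x = xi * p0 x + f xi x)// subr0.
  rewrite (_ : (xi^-1 *: f xi + p0) x = xi^-1 * f xi x + p0 x)//.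
  have xN : xi != 0 by rewrite gt_eqF.
  by rewrite [RHS]mulrDr mulKf// addrC.
have iX : inH (avg J xi 0) := domA_inH (domX x0 (lexx 0)).
have [_ wX tX] := ae_H1 (H1_lin xi^-1 hf hp0) (gp1 _ iX) XE.
exists xi; split.
- by rewrite x0.
- rewrite wX (ae_L2norm (L2_wD (H1_lin xi^-1 hf hp0)) (L2_lin xi^-1 Lfx Lp0x) (wD_lin xi^-1 hf hp0)).
  have := L2normD (L2Z xi^-1 Lfx) Lp0x; rewrite (L2normZ _ Lfx) ger0_norm ?invr_ge0// -/A -/G.
  have := L2norm_ge0 (xi^-1 *: wD (f xi) + wD p0).
  move: (L2norm (_ + _)) xA; move: (xi^-1 * A) => y z xA z0 zy.
  apply: (@le_trans _ _ ((y + G) ^+ 2)); first by rewrite lerXn2r ?nnegrE// (le_trans z0).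
  apply: (le_trans (sqrD_le y G)); rewrite addrC lerD2l.
  by rewrite (_ : 4 * M = 2 * (2 * M)) ?ler_pM2l// mulrA -natrM.
- rewrite tX (trace_lin xi^-1 hf hp0 t01) -/f0 -/T.
  move: xf; rewrite -!mulrA; move: (xi^-1 * f0) (M / c) => y z xf.
  apply: (le_trans (sqrD_le y T)); rewrite addrC lerD2l.
  by rewrite (_ : 4 * z = 2 * (2 * z)) ?ler_pM2l// mulrA -natrM.
- have [_ _ _ hs] := DN.
  have jb := J_bound hY hJ YB x0'.
  rewrite /avg add0r (hs _ _ (sn_B DN (iJ xi x0') (iJ 0 (lexx 0)))) gtr0_norm ?invr_gt0//.
  by rewrite ler_pdivrMl.
Qed.

(** [p_x] is not controlled by the energy norm, so the bound passes from the averages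
    to the solution by [H1_lsc] and not by continuity; the windows are those of
    [heat_start], for which the initial energy is bounded. *)
Lemma px_decay (B K : R) : 0 < eps -> H1 (cp (Y 0)) -> (forall s, 0 <= s -> N (Y s) <= B) ->
  0 <= K -> (forall X, inH X -> Vwave m X <= K * N X ^+ 2) ->
  (F * b ^+ 2 / c + m / 2) * (2 * (1 / c + 1)) + K1 <= 2 / eps ->
  let M := L2norm (wD (cp (Y 0))) ^+ 2 + c * trace (cp (Y 0)) 0 ^+ 2 +
    d ^+ 2 * (1 + 1 / c) * B ^+ 2 in
  forall t, 0 <= t -> H1 (cp (Y t)) /\
  L2norm (wD (cp (Y t))) ^+ 2 <=
    (2 + d ^+ 2 * expR m) * (expR (- (m / 2) * t) * (K * B ^+ 2 + 20 * M)).
Proof.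
move=> eps0 hp0 YB K0 hK he M t t0.
have gp := @blin_cp R; have [gp1 _ _] := gp.
apply: (H1_lsc (gp1 _ (iY t0))) => de de0.
have [h h0 hh] := avg_cvg hY hJ t0 de0.
have [xi [xi_h]] := heat_start eps0 hp0 YB h0.
rewrite -/M => s1 s2 s3; have /andP[xi0 _] := xi_h.
have dZ := domX xi0 t0; have dZ0 := domX xi0 (lexx 0).
exists (cp (avg J xi t)); split.
- by have [[_ _ []]] := dZ.
- apply: le_trans (hh _ xi_h).
  by have [_ _ _] := N_components (avg J xi t - Y t).
have V0 : 0 <= Vwave m (avg J xi t) by rewrite addr_ge0 ?sqr_ge0.
have W0 := Wheat_ge0 d c0 (avg J xi t); have E0 := expR_ge0 m.
apply: (le_trans (px_le_Wheat dZ)).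
apply: (@le_trans _ _ ((2 + d ^+ 2 * expR m) * (Vwave m (avg J xi t) + Wheat c d (avg J xi t)))).
  have k0 : 0 <= d ^+ 2 * expR m by rewrite mulr_ge0 ?sqr_ge0.
  have := mulr_ge0 k0 W0; move: V0 k0.
  by move: (Vwave m _) (Wheat _ _ _) (d ^+ 2 * expR m) => V W k; lra.
rewrite ler_wpM2l//; first by rewrite addr_ge0// mulr_ge0 ?sqr_ge0.
apply: (le_trans (energy_decay_H1 eps0 xi0 he t0)); rewrite ler_wpM2l ?expR_ge0//.
have iZ0 := domA_inH dZ0.
have nB : N (avg J xi 0) ^+ 2 <= B ^+ 2.
  by rewrite lerXn2r ?nnegrE ?N_ge0// (le_trans (N_ge0 _) s3).
have V1 : Vwave m (avg J xi 0) <= K * B ^+ 2.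
  by apply: (le_trans (hK _ iZ0)); rewrite ler_wpM2l.
have U1 : trace (cu (avg J xi 0)) 1 ^+ 2 <= B ^+ 2.
  apply: le_trans nB; rewrite -[_ ^+ 2]real_normK ?num_real//.
  by rewrite lerXn2r ?nnegrE ?N_ge0// trace1_bound.
have W1 := Wheat_upper dZ0.
have D0 : 0 <= d ^+ 2 * (1 + 1 / c).
  by rewrite mulr_ge0 ?sqr_ge0// addr_ge0// divr_ge0// ltW.
have U2 := ler_wpM2l D0 U1.
have s2' : c * trace (cp (avg J xi 0)) 0 ^+ 2 <= 2 * (c * trace (cp (Y 0)) 0 ^+ 2) + 4 * M.
  apply: (le_trans (ler_wpM2l (ltW c0) s2)); rewrite le_eqVlt; apply/orP; left; apply/eqP.
  by move: (trace _ _) => *; field; rewrite gt_eqF.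
have B0 := mulr_ge0 D0 (sqr_ge0 B).
have T0 := mulr_ge0 (ltW c0) (sqr_ge0 (trace (cp (Y 0)) 0)).
have G0 := sqr_ge0 (L2norm (wD (cp (Y 0)))).
apply: (lerD V1); apply: (le_trans W1).
exact: initial_Wheat_sum s1 s2' U2 B0 T0 G0.
Qed.

End OneSolution.

Lemma energy_space_decay : exists e1 C : R, [/\ 0 < e1, 0 < C &
  forall eps, 0 < eps < e1 -> forall X0 Y, inH X0 -> mild_solution a b c d eps X0 Y ->
  forall t, 0 <= t -> N (Y t) <= C * expR (- (m / 4) * t) * N X0].
Proof.
have A0 : 0 <= (F * b ^+ 2 + 2 * K1 + m) * (1 / c + 1).
  apply: mulr_ge0; last by rewrite addr_ge0// divr_ge0// ltW.
  by rewrite !addr_ge0 ?(ltW m0)// mulr_ge0// sqr_ge0.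
have [e1 e10 he1] := small_eps A0.
have [Ka Ka0 ka] := norm_le_energy c d m0.
have [Kb Kb0 kb] := Vwave_upper m.
have [Kc Kc0 kc] := blin_sqr_bound (blin_qst c d).
pose C := Num.sqrt (Ka * (Kb + Kc)) + 1.
have C0 : 0 < C by rewrite ltr_wpDl// sqrtr_ge0.
exists e1, C; split => // eps he X0 Y iX0 hY t t0.
have [iY _ eY0 _] := hY; have [J hJ] := mild_primitive hY.
have ED := energy_decay hY hJ (he1 _ he) t0.
have NX0 : N (Y 0) <= N X0.
  have iY0 := iY 0 (lexx 0).
  have [_ _ ht _] := DN; have := ht (Y 0 - X0) X0 (sn_B DN iY0 iX0) iX0.
  by rewrite subrK eqH_N0// add0r.
have B0 : Vwave m (Y 0) + L2norm (qst c d (Y 0)) ^+ 2 <= (Kb + Kc) * N (Y 0) ^+ 2.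
  by rewrite mulrDl lerD// ?kb ?kc//; exact: iY.
have e4 : expR (- (m / 2) * t) = expR (- (m / 4) * t) ^+ 2.
  by rewrite expr2 -expRD; congr expR; field.
rewrite -ler_sqr ?nnegrE ?mulr_ge0 ?N_ge0 ?expR_ge0 ?(ltW C0)//.
apply: (le_trans (ka _ (iY t t0))).
have h1 := ler_wpM2l Ka0 ED.
have h2 := ler_wpM2l (mulr_ge0 Ka0 (expR_ge0 (- (m / 2) * t))) B0.
apply: (le_trans h1); rewrite mulrA; apply: (le_trans h2).
rewrite !exprMn -e4.
have KK : Ka * (Kb + Kc) <= C ^+ 2.
  have k0 : 0 <= Ka * (Kb + Kc) by rewrite mulr_ge0// addr_ge0.
  rewrite -{1}(sqr_sqrtr k0) lerXn2r ?nnegrE ?sqrtr_ge0 ?(ltW C0)//.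
  by rewrite /C lerDl.
have n2 : N (Y 0) ^+ 2 <= N X0 ^+ 2 by rewrite lerXn2r ?nnegrE ?N_ge0.
have -> : Ka * expR (- (m / 2) * t) * ((Kb + Kc) * N (Y 0) ^+ 2) =
   Ka * (Kb + Kc) * expR (- (m / 2) * t) * N (Y 0) ^+ 2 by ring.
by rewrite ler_pM ?sqr_ge0 ?mulr_ge0 ?addr_ge0 ?expR_ge0// ler_wpM2r ?expR_ge0.
Qed.

Lemma norm_H1L2H1_sqr (X : state R) :
  norm_H1L2H1 X ^+ 2 = N X ^+ 2 + L2norm (wD (cp X)) ^+ 2.
Proof.
rewrite N_sqr /norm_H1L2H1 sqr_sqrtr; last by rewrite !addr_ge0 ?sqr_ge0.
by rewrite /H1norm !sqr_sqrtr ?addr_ge0 ?sqr_ge0// !addrA.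
Qed.

Lemma strong_space_decay : exists e2 C : R, [/\ 0 < e2, 0 < C &
  forall eps, 0 < eps < e2 -> forall X0 Y, inH X0 -> H1 (cp X0) ->
  mild_solution a b c d eps X0 Y ->
  forall t, 0 <= t -> H1 (cp (Y t)) /\
    norm_H1L2H1 (Y t) <= C * expR (- (m / 4) * t) * norm_H1L2H1 X0].
Proof.
have [e1 [C1 [e10 C10 decay]]] := energy_space_decay.
have A0 : 0 <= (F * b ^+ 2 / c + m / 2) * (2 * (1 / c + 1)) + K1.
  apply: addr_ge0 K10; apply: mulr_ge0.
    by rewrite addr_ge0 ?divr_ge0// ?(ltW m0)// ?(ltW c0)// mulr_ge0// sqr_ge0.
  by rewrite mulr_ge0// addr_ge0// divr_ge0// ltW.
have [e2 e20 he2] := small_eps A0.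
have [K K0 hK] := Vwave_upper m.
pose D := d ^+ 2 * (1 + 1 / c).
have D0 : 0 <= D by rewrite mulr_ge0 ?sqr_ge0// addr_ge0// divr_ge0// ltW.
have Q0 : 0 <= 2 + d ^+ 2 * expR m by rewrite addr_ge0// mulr_ge0 ?sqr_ge0// expR_ge0.
pose k := C1 ^+ 2 + (2 + d ^+ 2 * expR m) * (K * C1 ^+ 2 + 20 * (1 + 2 * c + D * C1 ^+ 2)).
have C12 := sqr_ge0 C1.
have k0 : 0 <= k.
  apply: (addr_ge0 C12 (mulr_ge0 Q0 (addr_ge0 (mulr_ge0 K0 C12) _))).
  apply: mulr_ge0 => //; apply: addr_ge0 (mulr_ge0 D0 C12).
  by rewrite addr_ge0// mulr_ge0// ltW.
pose C := Num.sqrt k + 1.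
have C0 : 0 < C by rewrite ltr_wpDl// sqrtr_ge0.
exists (Num.min e1 e2), C; split => //; first by rewrite lt_min e10.
move=> eps /andP[eps0]; rewrite lt_min => /andP[ee1 ee2] X0 Y iX0 hp0 hY t t0.
have [iY _ [_ _ eY0] _] := hY; have [J hJ] := mild_primitive hY.
have [_ _ Lp0] := iY 0 (lexx 0).
have [hpY wY tY] := ae_H1 hp0 Lp0 (ae_symm eY0).
pose N1 := norm_H1L2H1 X0; have N10 : 0 <= N1 by exact: sqrtr_ge0.
have N1E := norm_H1L2H1_sqr X0.
have [_ _ _ cpN] := N_components X0.
have NN1 : N X0 <= N1.
  by rewrite -ler_sqr ?nnegrE ?N_ge0// N1E lerDl sqr_ge0.
have he1 : 0 < eps < e1 by rewrite eps0.
have Yb s (s0 : 0 <= s) : N (Y s) <= C1 * N1.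
  apply: (le_trans (decay _ he1 _ _ iX0 hY _ s0)).
  rewrite ler_pM ?N_ge0 ?mulr_ge0 ?expR_ge0 ?(ltW C10)// ler_piMr ?(ltW C10)//.
  rewrite -expR0 ler_expR mulNr oppr_le0 mulr_ge0// divr_ge0//; exact: ltW.
have he2' : 0 < eps < e2 by rewrite eps0.
have [hpt bpt] := px_decay hY hJ eps0 hpY Yb K0 hK (he2 _ he2') t0.
split => //.
have G2 : L2norm (wD (cp X0)) ^+ 2 <= N1 ^+ 2 by rewrite N1E lerDr sqr_ge0.
have T2 : trace (cp X0) 0 ^+ 2 <= 2 * N1 ^+ 2.
  apply: (@le_trans _ _ ((L2norm (cp X0) + L2norm (wD (cp X0))) ^+ 2)).
    rewrite -[_ ^+ 2]real_normK ?num_real//.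
    by rewrite lerXn2r ?nnegrE ?addr_ge0 ?L2norm_ge0// trace0_bound.
  apply: (le_trans (sqrD_le _ _)); rewrite -mulrDr ler_pM2l// N1E lerD2r.
  by rewrite lerXn2r ?nnegrE ?N_ge0 ?L2norm_ge0.
have e4 : expR (- (m / 2) * t) = expR (- (m / 4) * t) ^+ 2.
  by rewrite expr2 -expRD; congr expR; field.
have x0 := expR_ge0 (- (m / 4) * t).
have y0 : 0 <= norm_H1L2H1 (Y t) by exact: sqrtr_ge0.
have r0 := mulr_ge0 (mulr_ge0 (ltW C0) x0) N10.
rewrite -ler_sqr ?nnegrE// norm_H1L2H1_sqr.
have n1 : N (Y t) ^+ 2 <= C1 ^+ 2 * expR (- (m / 2) * t) * N1 ^+ 2.
  have r1 := mulr_ge0 (ltW C10) x0.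
  have b1 := le_trans (decay _ he1 _ _ iX0 hY _ t0) (ler_wpM2l r1 NN1).
  have b0 := le_trans (N_ge0 (Y t)) b1.
  by rewrite e4 -!exprMn lerXn2r// nnegrE ?N_ge0.
have n2 : L2norm (wD (cp (Y t))) ^+ 2 <= (2 + d ^+ 2 * expR m) *
    (expR (- (m / 2) * t) * ((K * C1 ^+ 2 + 20 * (1 + 2 * c + D * C1 ^+ 2)) * N1 ^+ 2)).
  apply: (le_trans bpt); rewrite ler_wpM2l// ler_wpM2l ?expR_ge0// wY tY -/D.
  have := ler_wpM2l (ltW c0) T2; move: G2.
  move: (L2norm _ ^+ 2) (trace _ _ ^+ 2) => g y h1 h2; lra.
apply: (le_trans (lerD n1 n2)).
have kC : k <= C ^+ 2.
  rewrite -{1}(sqr_sqrtr k0) lerXn2r ?nnegrE ?sqrtr_ge0 ?(ltW C0)//.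
  by rewrite /C lerDl.
rewrite !exprMn -e4 -/N1.
apply: (@le_trans _ _ (k * expR (- (m / 2) * t) * N1 ^+ 2)).
  rewrite le_eqVlt; apply/orP; left; apply/eqP; rewrite /k.
  by move: (expR (- _ * t)) (expR m) => *; ring.
by rewrite ler_wpM2r ?sqr_ge0// ler_wpM2r// expR_ge0.
Qed.

End Estimates.
End Decay.

(** * The conditions on the coefficients *)

Section Coefficients.
Context {R : realType}.

(** Both sides of the bound on [m] are exponentiated and squared: this is the
    condition under which [flux_bound] applies. *)
Lemma damping_bound (a m : R) : 0 < 1 + a -> a != 1 ->
  m <= ln (`|1 + a| / (Num.sqrt 3 * `|1 - a|)) ->
  3 * expR m * (1 - a) ^+ 2 <= expR (- m) * (1 + a) ^+ 2.
Proof.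
move=> a1 aN1; have a2 : 0 < `|1 - a| by rewrite normr_gt0 subr_eq0 eq_sym.
have s3 : 0 < Num.sqrt 3 :> R by rewrite sqrtr_gt0.
have sq3 : Num.sqrt 3 ^+ 2 = 3 :> R by rewrite sqr_sqrtr.
rewrite -ler_expR lnK ?posrE; last by rewrite divr_gt0 ?mulr_gt0// normr_gt0 gt_eqF.
rewrite ler_pdivlMr ?mulr_gt0// (gtr0_norm a1) => h.
have E0 := expR_gt0 m; have E' : expR (- m) * expR m = 1.
  by rewrite expRN mulVf// gt_eqF.
have h2 : (expR m * (Num.sqrt 3 * `|1 - a|)) ^+ 2 <= (1 + a) ^+ 2.
  by rewrite lerXn2r ?nnegrE ?mulr_ge0 ?expR_ge0// ?(ltW s3)// ltW.
rewrite !exprMn sq3 real_normK ?num_real// in h2.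
have := ler_wpM2l (expR_ge0 (- m)) h2; apply: le_trans.
rewrite expr2 !mulrA E' mul1r le_eqVlt; apply/orP; left; apply/eqP; ring.
Qed.

Lemma sqr_le_sqrt (x y z : R) : 0 < z -> 0 <= y -> `|x| / z <= Num.sqrt y -> (x / z) ^+ 2 <= y.
Proof.
move=> z0 y0 h; rewrite -[leRHS](sqr_sqrtr y0) -[(x / z) ^+ 2]real_normK ?num_real//.
by rewrite normrM normfV (gtr0_norm z0) lerXn2r ?nnegrE ?sqrtr_ge0// divr_ge0// ltW.
Qed.

End Coefficients.

Theorem theorem4 (R : realType) (a b c d mu : R) :
  let eta : R := (Num.sqrt 3 + 1) / (Num.sqrt 3 - 1) in
  let F : R := 2 * sinh mu + 10 * cosh mu in
  eta^-1 <= a <= eta -> a != 1 ->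
  0 < mu -> mu <= ln (`|1 + a| / (Num.sqrt 3 * `|1 - a|)) ->
  `|b * d / c| <= 1 ->
  pi ^+ 2 / 8 <= c ->
  1 + 2 * (sinh mu + 2 * cosh mu) * b ^+ 2 <= c ->
  `|d| <= 2 * Num.sqrt (mu * expR (- mu)) ->
  `|b * d| / c <= Num.sqrt (mu * expR (- mu) * F^-1) ->
  (* (i) *)
  (pi ^+ 2 / 4 + F * b ^+ 2 <= c ->
   exists eps1 C1 : R, [/\ 0 < eps1, 0 < C1 &
     forall eps : R, 0 < eps < eps1 ->
     forall u0 u1 p0 : R -> R,
       H1 u0 -> trace u0 0 = 0 -> L2 u1 -> L2 p0 ->
     forall Y : R -> state R,
       mild_solution a b c d eps (u0, u1, p0) Y ->
     forall t : R, 0 <= t ->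
       norm_H1L2L2 (Y t)
         <= C1 * expR (- (mu / 4) * t) * norm_H1L2L2 (u0, u1, p0)])
  /\
  (* (ii) *)
  (3 * F * b ^+ 2 <= c ->
   exists eps2 C2 : R, [/\ 0 < eps2, 0 < C2 &
     forall eps : R, 0 < eps < eps2 ->
     forall u0 u1 p0 : R -> R,
       H1 u0 -> trace u0 0 = 0 -> L2 u1 -> H1 p0 ->
     forall Y : R -> state R,
       mild_solution a b c d eps (u0, u1, p0) Y ->
     forall t : R, 0 <= t ->
       H1 (cp (Y t)) /\
       norm_H1L2H1 (Y t)
         <= C2 * expR (- (mu / 4) * t) * norm_H1L2H1 (u0, u1, p0)]).
Proof.
move=> eta F /andP[ea _] aN1 mu0 mul _ cpi _ _ bd.
have pi2 : 0 < pi ^+ 2 :> R by rewrite exprn_gt0// pi_gt0.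
have c0 : 0 < c by apply: lt_le_trans cpi; rewrite divr_gt0.
have s31 : 1 < Num.sqrt 3 :> R by rewrite -[ltLHS]sqrtr1 ltr_sqrt// ltr1n.
have eta0 : 0 < eta by rewrite divr_gt0 ?subr_gt0// addr_gt0// (lt_trans _ s31).
have a0 : 0 < a by apply: lt_le_trans ea; rewrite invr_gt0.
have a1 : 0 < 1 + a by rewrite addr_gt0.
have ha := damping_bound a1 aN1 mul.
have FE : F = 6 * expR mu + 4 * expR (- mu) by rewrite /F /sinh /cosh; field.
have F0 : 0 < F by rewrite FE addr_gt0// mulr_gt0// expR_gt0.
have hb : (b * d / c) ^+ 2 <= mu * expR (- mu) * F^-1.
  apply: sqr_le_sqrt => //.
  by rewrite mulr_ge0// ?invr_ge0 ?(ltW F0)// mulr_ge0 ?expR_ge0// ltW.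
split=> _.
- have [e1 [C [e0 C0 H]]] := energy_space_decay c0 mu0 a1 ha FE hb.
  exists e1, C; split=> // eps he u0 u1 p0 hu tu Lu1 Lp0 Y hY t t0.
  by apply: (H eps he _ Y _ hY t t0); split.
- have [e2 [C [e0 C0 H]]] := strong_space_decay c0 mu0 a1 ha FE hb.
  exists e2, C; split=> // eps he u0 u1 p0 hu tu Lu1 hp0 Y hY t t0.
  have iX : inH (u0, u1, p0) by split; [split|exact: Lu1|exact: (H1_L2 hp0)].
  exact: (H eps he (u0, u1, p0) Y iX hp0 hY t t0).
Qed.
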